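(* Let $G$ be the simply connected simple complex algebraic group of type $G_2$ and let $H\subset G$ be the subsystem subgroup of type $A_2$ whose roots are the long roots of $G$. Then for all $k\in\mathbb{N}$: \begin{align*} \text{i)}\quad & \mathrm{res}^G_H(V_{k\omega_1})=\bigoplus_{a_1+a_2\le k}V_{a_1\lambda_1+a_2\lambda_2},\\ \text{ii)}\quad & \mathrm{res}^G_H(V_{k\omega_2})=\bigoplus_{a_1+a_2+a_3=k}V_{(a_1+a_3)\lambda_1+(a_2+a_3)\lambda_2}, \end{align*} where the $a_i$ run over non-negative integers.
   Context: The ground field is $\mathbb{C}$. Fix a maximal torus $T$ and a Borel subgroup $B\supset T$ of $G$, with simple roots $\alpha_1,\alpha_2$ and fundamental weights $\omega_1,\omega_2$ in Bourbaki numbering ($\alpha_1$ short, $\alpha_2$ long). The subgroup $H$ contains $T$ and has simple roots $\beta_1=3\alpha_1+\alpha_2$ and $\beta_2=\alpha_2$, with corresponding fundamental weights $\lambda_1,\lambda_2$. $V_\mu$ denotes the irreducible module (of $G$ or of $H$ respectively) of highest weight $\mu$, and $\mathrm{res}^G_H$ denotes restriction of a $G$-module to $H$; equality means isomorphism of $H$-modules. *)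

(* Defs.v *)
From HB Require Import structures.
From mathcomp Require Import all_boot all_order all_algebra.
From mathcomp Require Import ring.
From mathcomp.multinomials Require Import mpoly.

Set Implicit Arguments.
Unset Strict Implicit.
Unset Printing Implicit Defensive.

Import GRing.Theory.
Local Open Scope ring_scope.

(** * Linear algebraic groups in GL_n and their rational modules *)

Section MatrixGroups.
Variables (F : fieldType) (n : nat).
Implicit Types G S : 'M[F]_n -> Prop.

Inductive generated S : 'M[F]_n -> Prop :=
| gen_elt g : S g -> generated S g
| gen_one : generated S 1%:M
| gen_mul g h : generated S g -> generated S h -> generated S (g *m h)
| gen_inv g : generated S g -> generated S (invmx g).

Lemma generated_sub S1 S2 : (forall g, S1 g -> S2 g) ->
  forall g, generated S1 g -> generated S2 g.
Proof.
move=> sS g; elim=> {g} [g /sS||g h _ Hg _ Hh|g _ Hg].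
- exact: gen_elt.
- exact: gen_one.
- exact: gen_mul.
- exact: gen_inv.
Qed.

(* The coordinate ring of GL_n is F[x_ij, 1/det]; the regular functions on a
   closed subgroup of GL_n are the restrictions of its elements. *)
Definition gl_coords (g : 'M[F]_n) : 'I_(n * n + 1) -> F :=
  row_mx (mxvec g) (\det g)^-1%:M 0.

Definition regular_on G (f : 'M[F]_n -> F) : Prop :=
  exists p : {mpoly F[n * n + 1]},
    forall g, G g -> f g = p.@[gl_coords g].

(* A finite-dimensional rational G-module. Rationality is stated without a
   choice of basis: all the matrix coefficients are regular. The values of
   [act] outside G are irrelevant. *)
Record gmodule G := GModule {
  carrier :> vectType F;
  act : 'M[F]_n -> 'End(carrier);
  act1 : act 1%:M = \1%VF;
  actM : forall g h, G g -> G h -> act (g *m h) = (act g \o act h)%VF;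
  act_regular : forall (xi : 'Hom(carrier, F^o)) (v : carrier),
    regular_on G (fun g => xi (act g v))
}.

Definition irreducible G (V : gmodule G) : Prop :=
  (fullv : {vspace V}) <> 0%VS /\
  forall U : {vspace V}, (forall g, G g -> (act V g @: U <= U)%VS) ->
    U = 0%VS \/ U = fullv.

Definition gmodule_iso G (V W : gmodule G) : Prop :=
  exists2 phi : 'Hom(V, W), bijective phi &
    forall g v, G g -> phi (act V g v) = act W g (phi v).

(** ** Restriction to a subgroup *)

Section Restriction.
Variables (G H : 'M[F]_n -> Prop) (sHG : forall g, H g -> G g) (V : gmodule G).

Lemma res_actM g h : H g -> H h -> act V (g *m h) = (act V g \o act V h)%VF.
Proof. by move=> /sHG Gg /sHG; apply: actM. Qed.

Lemma res_regular (xi : 'Hom(V, F^o)) (v : V) :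
  regular_on H (fun g => xi (act V g v)).
Proof. by have [p Hp] := act_regular xi v; exists p => g /sHG /Hp. Qed.

Definition res : gmodule H := GModule (act1 V) res_actM res_regular.

End Restriction.

(** ** Direct sums *)

Section DirectSum.
Variable G : 'M[F]_n -> Prop.

Lemma gmod0_actM g h : G g -> G h ->
  \1%VF = (\1 \o \1)%VF :> 'End('rV[F]_0).
Proof. by rewrite comp_lfun1l. Qed.

Lemma gmod0_regular (xi : 'Hom('rV[F]_0, F^o)) (v : 'rV[F]_0) :
  regular_on G (fun g => xi ((fun=> \1%VF : 'End('rV[F]_0)) g v)).
Proof.
by exists 0 => g _; rewrite meval0 (thinmx0 v) !linear0.
Qed.

Definition gmod0 : gmodule G :=
  @GModule G 'rV[F]_0 (fun=> \1%VF) erefl gmod0_actM gmod0_regular.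

Definition pair_map (V W : vectType F) (f : 'End(V)) (g : 'End(W))
  (x : V * W) : V * W := (f x.1, g x.2).

Lemma pair_map_linear V W f g : linear (@pair_map V W f g).
Proof. by move=> a x y; rewrite /pair_map /= !linearP. Qed.

HB.instance Definition _ (V W : vectType F) (f : 'End(V)) (g : 'End(W)) :=
  GRing.isLinear.Build F (V * W)%type (V * W)%type _ (@pair_map V W f g)
    (@pair_map_linear V W f g).

Variables V W : gmodule G.

Definition gsum_act g : 'End((V * W)%type) :=
  linfun (pair_map (act V g) (act W g)).

Lemma gsum_act1 : gsum_act 1%:M = \1%VF.
Proof. by apply/lfunP => -[x y]; rewrite lfunE /= /pair_map !act1 !id_lfunE. Qed.

Lemma gsum_actM g h : G g -> G h ->
  gsum_act (g *m h) = (gsum_act g \o gsum_act h)%VF.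
Proof.
move=> Gg Gh; apply/lfunP => -[x y].
by rewrite comp_lfunE !lfunE /= /pair_map /= !actM // !comp_lfunE.
Qed.

Lemma gsum_regular (xi : 'Hom((V * W)%type, F^o)) (v : (V * W)%type) :
  regular_on G (fun g => xi (gsum_act g v)).
Proof.
pose i1 (x : V) : (V * W)%type := (x, 0).
pose i2 (y : W) : (V * W)%type := (0, y).
have i1l : linear i1 by move=> a x y; congr pair; rewrite /= scaler0 addr0.
have i2l : linear i2 by move=> a x y; congr pair; rewrite /= scaler0 addr0.
pose I1 := GRing.isLinear.Build F V (V * W)%type _ i1 i1l.
pose I2 := GRing.isLinear.Build F W (V * W)%type _ i2 i2l.
pose l1 : {linear V -> (V * W)%type} := HB.pack i1 I1.
pose l2 : {linear W -> (V * W)%type} := HB.pack i2 I2.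
have [p Hp] := act_regular (xi \o linfun l1)%VF v.1.
have [q Hq] := act_regular (xi \o linfun l2)%VF v.2.
exists (p + q) => g Gg; rewrite mevalD -Hp // -Hq //.
rewrite !comp_lfunE !lfunE /= -[RHS](linearD xi); congr (xi _).
by congr pair; rewrite /= ?addr0 ?add0r.
Qed.

Definition gsum : gmodule G := GModule gsum_act1 gsum_actM gsum_regular.

End DirectSum.

(** ** Highest weights

   [c1] and [c2] are the simple coroots (as one-parameter subgroups of the
   maximal torus) and [U] is the unipotent radical of the Borel subgroup.
   When the coroots form a basis of the cocharacter lattice of the torus, the
   fundamental weights are the dual basis of the character lattice, so the
   torus acts on v through m1 omega_1 + m2 omega_2 exactly when each c_i z acts
   on v as z ^+ m_i. *)

Definition highest_weight_vector (c1 c2 : F -> 'M[F]_n) (U : 'M[F]_n -> Prop)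
    G (V : gmodule G) (m1 m2 : nat) (v : V) : Prop :=
  [/\ v != 0,
      forall z, z != 0 -> act V (c1 z) v = z ^+ m1 *: v,
      forall z, z != 0 -> act V (c2 z) v = z ^+ m2 *: v &
      forall u, U u -> act V u v = v].

Definition irreducible_hw (c1 c2 : F -> 'M[F]_n) (U : 'M[F]_n -> Prop)
    G (V : gmodule G) (m1 m2 : nat) : Prop :=
  irreducible V /\ exists v : V, highest_weight_vector c1 c2 U m1 m2 v.

End MatrixGroups.

Arguments gmod0 {F n} G.

Notation "\gsum_ ( i : t | P ) V" :=
  (\big[@gsum _ _ _/gmod0 _]_(i : t | P%B) V)
  (at level 41, V at level 41, i at level 0,
   format "'[' \gsum_ ( i  :  t  |  P ) '/  '  V ']'") : ring_scope.

(** * The group of type G2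

   The Chevalley-Steinberg construction over F (of characteristic 0) from the
   7-dimensional irreducible representation of the Lie algebra of type G2. Its
   weights span the weight lattice of G2, so that the resulting group is the
   simply connected one. The basis vectors 0, ..., 6 have the weights
     2a1+a2, a1+a2, a1, 0, -a1, -(a1+a2), -(2a1+a2)
   where a1 is the short and a2 the long simple root. *)

Section G2.
Variable F : fieldType.
Local Notation E i j := (delta_mx (i : 'I_7) (j : 'I_7) : 'M[F]_7).

Definition e1 : 'M[F]_7 := E 0 1 + 2 *: E 2 3 + E 3 4 + E 5 6.
Definition f1 : 'M[F]_7 := E 1 0 + E 3 2 + 2 *: E 4 3 + E 6 5.
Definition e2 : 'M[F]_7 := E 1 2 + E 4 5.
Definition f2 : 'M[F]_7 := E 2 1 + E 5 4.

(* pairings of the seven weights with the simple coroots *)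
Definition wt1 (i : 'I_7) : int := [:: 1; -1; 2; 0; -2; 1; -1]`_i.
Definition wt2 (i : 'I_7) : int := [:: 0; 1; -1; 0; 1; -1; 0]`_i.

Definition coroot1 (z : F) : 'M[F]_7 := diag_mx (\row_i z ^ wt1 i).
Definition coroot2 (z : F) : 'M[F]_7 := diag_mx (\row_i z ^ wt2 i).

Definition lie (x y : 'M[F]_7) : 'M[F]_7 := x *m y - y *m x.

(* The next lemmas check that e1, e2, f1, f2 are Chevalley generators for the
   Cartan matrix of G2; they are not used in the statement. *)
Definition h1 : 'M[F]_7 := diag_mx (\row_i (wt1 i)%:~R).
Definition h2 : 'M[F]_7 := diag_mx (\row_i (wt2 i)%:~R).

Lemma lie_ef :
  [/\ lie e1 f1 = h1, lie e2 f2 = h2, lie e1 f2 = 0 & lie e2 f1 = 0].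
Proof.
split; rewrite /lie /e1 /e2 /f1 /f2 ?mulmxDl ?mulmxDr.
all: rewrite -?(scalemxAl, scalemxAr) ?mulmxDr -?scalemxAr !mul_delta_mx_cond /=.
all: rewrite ?(mulr1n, mulr0n, scaler0, add0r, addr0, subrr) //.
all: apply/matrixP => i j; rewrite !mxE.
all: case: i => [[|[|[|[|[|[|[|//]]]]]]] ?];
  case: j => [[|[|[|[|[|[|[|//]]]]]]] ?] //=; rewrite ?/wt1 ?/wt2 /=; ring.
Qed.

Lemma lie_diag (d : 'rV[F]_7) (x : 'M[F]_7) c :
  (forall i j, (d 0 i - d 0 j) * x i j = c * x i j) ->
  lie (diag_mx d) x = c *: x.
Proof.
move=> H; apply/matrixP => i j.
by rewrite /lie mul_diag_mx mul_mx_diag !mxE -H mulrBl [x i j * _]mulrC.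
Qed.

Lemma lie_he :
  [/\ lie h1 e1 = 2 *: e1, lie h1 e2 = - 3 *: e2,
      lie h2 e1 = - 1 *: e1 & lie h2 e2 = 2 *: e2].
Proof.
split; apply: lie_diag => i j; rewrite !mxE.
all: case: i => [[|[|[|[|[|[|[|//]]]]]]] ?];
  case: j => [[|[|[|[|[|[|[|//]]]]]]] ?] //=; rewrite /wt1 /wt2 /=; ring.
Qed.

Lemma lie_hf :
  [/\ lie h1 f1 = - 2 *: f1, lie h1 f2 = 3 *: f2,
      lie h2 f1 = 1 *: f1 & lie h2 f2 = - 2 *: f2].
Proof.
split; apply: lie_diag => i j; rewrite !mxE.
all: case: i => [[|[|[|[|[|[|[|//]]]]]]] ?];
  case: j => [[|[|[|[|[|[|[|//]]]]]]] ?] //=; rewrite /wt1 /wt2 /=; ring.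
Qed.

(* [Rab] is the positive root a * a1 + b * a2. *)
Variant posroot := R10 | R01 | R11 | R21 | R31 | R32.

Definition long (r : posroot) : bool :=
  match r with R01 | R31 | R32 => true | R10 | R11 | R21 => false end.

Definition root_vector (x1 x2 : 'M[F]_7) (r : posroot) : 'M[F]_7 :=
  match r with
  | R10 => x1
  | R01 => x2
  | R11 => lie x1 x2
  | R21 => lie x1 (lie x1 x2)
  | R31 => lie x1 (lie x1 (lie x1 x2))
  | R32 => lie x2 (lie x1 (lie x1 (lie x1 x2)))
  end.

Definition pos_vector : posroot -> 'M[F]_7 := root_vector e1 e2.
Definition neg_vector : posroot -> 'M[F]_7 := root_vector f1 f2.

(* the exponential of a nilpotent matrix x, for which x ^+ 7 = 0 *)
Definition exp_nilp (x : 'M[F]_7) : 'M[F]_7 :=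
  \sum_(i < 7) (i`!%:R)^-1 *: x ^+ i.

Definition torus (g : 'M[F]_7) : Prop :=
  exists z1 z2, [/\ z1 != 0, z2 != 0 & g = coroot1 z1 *m coroot2 z2].

Definition pos_root_elt (P : pred posroot) (g : 'M[F]_7) : Prop :=
  exists r t, P r /\ g = exp_nilp (t *: pos_vector r).

Definition neg_root_elt (P : pred posroot) (g : 'M[F]_7) : Prop :=
  exists r t, P r /\ g = exp_nilp (t *: neg_vector r).

(* the subgroup generated by T and the root subgroups of the roots +-r, r in P *)
Definition subsystem_group (P : pred posroot) : 'M[F]_7 -> Prop :=
  generated (fun g => [\/ torus g, pos_root_elt P g | neg_root_elt P g]).

Definition G2 : 'M[F]_7 -> Prop := subsystem_group predT.
Definition A2 : 'M[F]_7 -> Prop := subsystem_group long.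

Lemma A2_sub_G2 g : A2 g -> G2 g.
Proof.
apply: generated_sub => {}g [Tg|[r [t [_ ->]]]|[r [t [_ ->]]]].
- exact: Or31.
- by apply: Or32; exists r, t.
- by apply: Or33; exists r, t.
Qed.

(* the unipotent radicals of the Borel subgroup B of G and of B :&: H in H *)
Definition U_G2 : 'M[F]_7 -> Prop := generated (pos_root_elt predT).
Definition U_A2 : 'M[F]_7 -> Prop := generated (pos_root_elt long).

(* V is the simple G2-module of highest weight m1 omega_1 + m2 omega_2. *)
Definition is_V_G2 (V : gmodule G2) (m1 m2 : nat) : Prop :=
  irreducible_hw coroot1 coroot2 U_G2 V m1 m2.

(* W is the simple H-module of highest weight m1 lambda_1 + m2 lambda_2. The
   simple roots of H are b1 = 3 a1 + a2 and b2 = a2. As b^v = 2 b / (b, b) and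
   (a2, a2) = 3 (a1, a1), the coroot of b1 is a1^v + a2^v. *)
Definition coroot_b1 (z : F) : 'M[F]_7 := coroot1 z *m coroot2 z.
Definition coroot_b2 (z : F) : 'M[F]_7 := coroot2 z.

Definition is_V_A2 (W : gmodule A2) (m1 m2 : nat) : Prop :=
  irreducible_hw coroot_b1 coroot_b2 U_A2 W m1 m2.

Definition res_G2_A2 : gmodule G2 -> gmodule A2 := res A2_sub_G2.

End G2.

(* Main.v *)
(** Differentiating along one-parameter subgroups turns rational modules into modules
    over the Lie algebras. Embedding the irreducible module V in polynomials in two
    copies of the 7-dimensional representation, with highest weight vector u0^k or
    (u0 v1 - u1 v0)^k, the Fischer inner product gives V a positive definite form for
    which e_r and f_r are adjoint up to sign. Hence V is completely reducible over A2,
    and it suffices to find the vectors killed by the positive long root vectors,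
    that is, the orthogonal of the image of the negative ones.
    Modulo this image V is spanned by the vectors F21^c F10^a v in the first case and
    F21^x F11^y v in the second, which have pairwise distinct weights. Such a vector is
    zero modulo the image when its weight is not dominant, respectively when
    x + y > k, because the conjugate of f2 by exp f1 has (k+1)-st power zero on v.
    The others survive since they pair nontrivially with monomials in the highest
    weight vectors of the A2-summands of the 7-dimensional, respectively adjoint,
    representation. *)
From HB Require Import structures.
Require Import Defs.
From mathcomp Require Import all_boot all_order all_algebra.
From mathcomp Require Import reals.
From mathcomp.real_closed Require Import complex.
From mathcomp Require Import ring lra zify.
From mathcomp.multinomials Require Import mpoly.
From Stdlib Require Import Classical.
Set Implicit Arguments.
Unset Strict Implicit.
Unset Printing Implicit Defensive.
Import Order.TTheory GRing.Theory Num.Theory.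
Local Open Scope ring_scope.

(** * Subspaces and Hermitian forms *)

Section Subspaces.
Variables (F : fieldType) (V : vectType F).

(** Neither complete reducibility nor the uniqueness of simple modules of given highest weight is
    assumed; a definite form replaces both. [V] and the [VH m1 m2] are abstract, so [hw_embedding]
    is used at two levels: it puts [V] into polynomials, and then each A2-module into [V] at an
    invariant vector. No dimensions or characters are compared. That certain vectors span [V] modulo
    the image is proved dually, in [detection]: a nonzero space of long invariants orthogonal to
    them would lead, through successive kernels, to a nonzero vector killed by e1 and e2 and
    orthogonal to [v], hence to all of [V]. Two copies of the 7-dimensional module are taken because
    the adjoint module lies in its exterior square, realized by 2 x 2 minors. In the second family
    dominance does not decide which vectors survive: F21^x F11^y v has the dominant weight (k - x, k
    - y) for all x, y <= k, but vanishes modulo the image once x + y > k. This is why a conjugate of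
    f2 enters there. *)

Definition subspace (S : V -> Prop) :=
  S 0 /\ forall a x y, S x -> S y -> S (a *: x + y).

(** [S] need not be decidable, so [U] is picked classically with largest dimension among the spaces
    inside [S]. Adding the line of a vector of [S] cannot raise the dimension, so that vector was
    already in [U]. *)
Lemma subspace_vspace S : subspace S -> exists U : {vspace V}, forall x, x \in U <-> S x.
Proof.
move=> [S0 Slin].
have subS (X : seq V) : (forall x, x \in X -> S x) -> forall x, x \in <<X>>%VS -> S x.
  elim: X => [|a X IH] XS x; first by rewrite span_nil memv0 => /eqP ->.
  rewrite span_cons => /memv_addP [y /vlineP [c ->] [z zX ->]].
  apply: Slin; first by apply: XS; rewrite mem_head.
  by apply: IH zX => u uX; apply: XS; rewrite inE uX orbT.
have [U US Umax] : exists2 U : {vspace V}, (forall x, x \in U -> S x) &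
    forall U' : {vspace V}, (forall x, x \in U' -> S x) -> (\dim U' <= \dim U)%N.
  pose P d := exists2 U : {vspace V}, (forall x, x \in U -> S x) & \dim U = d.
  have: exists2 d, P d & forall d', P d' -> (d' <= d)%N.
    apply: NNPP => H.
    suff: forall d, exists2 d', P d' & (d <= d')%N.
      move=> /(_ (dim V).+1) [d' [U _ <-]].
      by rewrite ltnNge -dimvf dimvS ?subvf.
    elim=> [|d [d' Pd' ledd']].
      by exists 0%N => //; exists 0%VS; rewrite ?dimv0 // => x; rewrite memv0 => /eqP ->.
    apply: NNPP => H'; apply: H; exists d' => // d'' Pd''.
    rewrite leqNgt; apply/negP => lt; apply: H'; exists d'' => //.
    exact: leq_ltn_trans lt.
  by case=> d [U US <-] dmax; exists U => // U' U'S; apply: dmax; exists U'.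
exists U => x; split=> [/US //|Sx].
have : (forall y, y \in (<[x]> + U)%VS -> S y).
  by move=> y /memv_addP [z /vlineP [c ->] [t /US tU ->]]; apply: Slin.
move=> /Umax le; have := dimv_leqif_eq (addvSr <[x]>%VS U).
rewrite /leqif eqn_leq le => -[-> /esym/eqP ->].
by apply: (subvP (addvSl _ _)); apply: memv_line.
Qed.

End Subspaces.

Section HermitianForms.
Variable C : numClosedFieldType.

Record hermitian (V : lmodType C) := Hermitian {
  form :> V -> V -> C;
  formP : forall a x y z, form (a *: x + y) z = a * form x z + form y z;
  formC : forall x y, form y x = (form x y)^*;
  form_ge0 : forall x, 0 <= form x x;
  form_eq0 : forall x, form x x = 0 -> x = 0 }.

Section Theory.
Variables (V : lmodType C) (B : hermitian V).

Lemma formDl x y z : B (x + y) z = B x z + B y z.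
Proof. by rewrite -{1}(scale1r x) formP mul1r. Qed.
Lemma form0l z : B 0 z = 0.
Proof. by apply: (addrI (B 0 z)); rewrite -formDl !addr0. Qed.
Lemma formZl a x z : B (a *: x) z = a * B x z.
Proof. by rewrite -{1}[a *: x]addr0 formP form0l addr0. Qed.
Lemma formDr x y z : B z (x + y) = B z x + B z y.
Proof. by rewrite !(formC B _ z) formDl rmorphD. Qed.
Lemma formZr a x z : B z (a *: x) = a^* * B z x.
Proof. by rewrite !(formC B _ z) formZl rmorphM. Qed.
Lemma form0r z : B z 0 = 0.
Proof. by rewrite formC form0l rmorph0. Qed.
Lemma formNl x z : B (- x) z = - B x z.
Proof. by rewrite -scaleN1r formZl mulN1r. Qed.
Lemma formNr x z : B z (- x) = - B z x.
Proof. by rewrite !(formC B _ z) formNl rmorphN. Qed.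
Lemma form_sym0 x y : B x y = 0 -> B y x = 0.
Proof. by move=> xy0; rewrite formC xy0 rmorph0. Qed.
End Theory.

(** Transparent, so that the form on [V] unfolds to the Fischer form of the images. *)
Definition hermitian_pullback (V W : lmodType C) (B : hermitian W)
  (phi : {linear V -> W}) (phi_inj : injective phi) : hermitian V.
Proof.
exists (fun x y => B (phi x) (phi y)).
- by move=> a x y z; rewrite linearP formP.
- by move=> x y; rewrite formC.
- by move=> x; apply: form_ge0.
- by move=> x /form_eq0 => phi0; apply: phi_inj; rewrite phi0 linear0.
Defined.

(** Gram-Schmidt along a spanning list: [a'] is the part of the new vector orthogonal to the earlier
    ones, and definiteness allows division by [B a' a'] unless [a'] is zero. *)
Lemma orth_decomp (V : vectType C) (B : hermitian V) (U : {vspace V}) x :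
  exists2 y, y \in U & forall z, z \in U -> B z (x - y) = 0.
Proof.
suff: forall X : seq V, forall x, exists2 y, y \in <<X>>%VS &
    forall z, z \in <<X>>%VS -> B z (x - y) = 0.
  by move=> /(_ (vbasis U)); rewrite (span_basis (vbasisP U)).
elim=> [|a X IH] {}x.
  exists 0; first by rewrite mem0v.
  by move=> z; rewrite span_nil memv0 => /eqP ->; rewrite form0l.
have [ya yaX orta] := IH a; have [y yX ort] := IH x.
have sX u : u \in <<X>>%VS -> u \in <<a :: X>>%VS.
  by apply: subvP; rewrite span_cons addvSr.
have aX : a \in <<a :: X>>%VS by rewrite memv_span ?mem_head.
set a' := a - ya in orta; set x' := x - y in ort.
have [a'0|a'0] := eqVneq a' 0.
  exists y; first exact: sX.
  move=> z; rewrite span_cons => /memv_addP [u /vlineP [c ->] [t tX ->]].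
  rewrite formDl formZl -(subrK ya a) -/a' a'0 add0r -/x' !ort // mulr0 addr0 //.
have Baa : B a' a' != 0 by apply: contra_neq a'0; apply: form_eq0.
pose c := B x' a' / B a' a'.
exists (y + c *: a').
  by apply: memvD; [exact: sX | apply/memvZ/memvB => //; exact: sX].
have ort' z : z \in <<X>>%VS -> B z (x - (y + c *: a')) = 0.
  by move=> zX; rewrite opprD addrA formDr formNr formZr ort // orta // mulr0 subr0.
move=> z; rewrite span_cons => /memv_addP [u /vlineP [d ->] [t tX ->]].
rewrite formDl formZl -(subrK ya a) -/a' formDl (ort' ya) // (ort' t) // !addr0.
apply/eqP; rewrite mulf_eq0; apply/orP; right; apply/eqP; apply: form_sym0.
by rewrite opprD addrA -/x' formDl formNl formZl /c divfK ?subrr.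
Qed.

End HermitianForms.

(** * Highest weight modules of rank two *)

Section HighestWeightModules.
Variables (C : numClosedFieldType) (a : bool -> bool -> C).

(** The relations that move an [e] or an [h] through a word in the [f]'s towards a highest weight
    vector. Later [true] stands for the simple root a1 of G2, or 3 a1 + a2 of A2, and [false] for
    a2. *)
Record chevalley (W : lmodType C) (e f h : bool -> {linear W -> W}) : Prop := Chevalley {
  chev_ef : forall i j x, e i (f j x) = f j (e i x) + (if i == j then h i x else 0);
  chev_hf : forall i j x, h i (f j x) = f j (h i x) - a i j *: f j x }.

Definition hw_vector (W : lmodType C) (e h : bool -> {linear W -> W}) (l : bool -> C) v :=
  (forall i, e i v = 0) /\ (forall i, h i v = l i *: v).

Definition word (W : lmodType C) (f : bool -> {linear W -> W}) (v : W) (s : seq bool) :=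
  foldr (fun i => f i) v s.

Definition word_span (W : lmodType C) (f : bool -> {linear W -> W}) (v x : W) :=
  exists s : seq (C * seq bool), x = \sum_(t <- s) t.1 *: word f v t.2.

Section Words.
Variables (W : lmodType C) (e f h : bool -> {linear W -> W}) (l : bool -> C) (v : W).
Hypotheses (chev : chevalley e f h) (hwv : hw_vector e h l v).

Lemma word_span_word s : word_span f v (word f v s).
Proof. by exists [:: (1, s)]; rewrite big_seq1 scale1r. Qed.

Lemma word_span_lin c x y : word_span f v x -> word_span f v y ->
  word_span f v (c *: x + y).
Proof.
move=> [s ->] [t ->]; exists ([seq (c * u.1, u.2) | u <- s] ++ t).
rewrite big_cat /= big_map /= scaler_sumr; congr (_ + _).
by apply: eq_bigr => u _; rewrite scalerA.
Qed.

Lemma word_span0 : word_span f v 0.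
Proof. by exists [::]; rewrite big_nil. Qed.

Lemma word_span_linear (g : {linear W -> W}) :
  (forall s, word_span f v (g (word f v s))) ->
  forall x, word_span f v x -> word_span f v (g x).
Proof.
move=> gw x [s ->]; elim: s => [|t s IH].
  by rewrite big_nil linear0; apply: word_span0.
by rewrite big_cons linearP; apply: word_span_lin.
Qed.

Lemma word_span_f i x : word_span f v x -> word_span f v (f i x).
Proof. by apply: word_span_linear => s; apply: (word_span_word (i :: s)). Qed.

Lemma word_h i s : h i (word f v s) = (l i - \sum_(j <- s) a i j) *: word f v s.
Proof.
elim: s => [|j s IH] /=; first by rewrite big_nil subr0; apply: hwv.2.
by rewrite (chev_hf chev) IH linearZ /= -scalerBl big_cons; congr (_ *: _); ring.
Qed.

Lemma word_span_e i x : word_span f v x -> word_span f v (e i x).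
Proof.
apply: word_span_linear => s; elim: s => [|j s IH] /=.
  by rewrite hwv.1; apply: word_span0.
rewrite (chev_ef chev) -[f j _]scale1r; apply: word_span_lin; first exact: word_span_f.
case: eqP => _; last exact: word_span0.
by rewrite word_h -[_ *: _]addr0; apply: word_span_lin (word_span_word s) word_span0.
Qed.

End Words.

Definition op_irreducible (W : vectType C) (e f : bool -> {linear W -> W}) :=
  forall U : {vspace W}, (forall i x, x \in U -> e i x \in U) ->
    (forall i x, x \in U -> f i x \in U) -> U = 0%VS \/ U = fullv.

(** The words in the [f]'s applied to [v] span a subspace stable under the [e]'s and [f]'s, which is
    everything by irreducibility. This serves as an induction principle on vectors. *)
Lemma hw_ind (W : vectType C) (e f h : bool -> {linear W -> W}) l (v : W) (S : W -> Prop) :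
  chevalley e f h -> hw_vector e h l v -> v != 0 -> op_irreducible e f ->
  subspace S -> S v -> (forall i x, S x -> S (f i x)) -> forall x, S x.
Proof.
move=> chev hwv v0 irr [S0 Slin] Sv Sf x.
have [|U UP] := @subspace_vspace _ _ (word_span f v).
  by split; [apply: word_span0 | move=> *; apply: word_span_lin].
have /UP [s ->] : x \in U.
  case: (irr U) => [i y /UP|i y /UP|U0|->]; last exact: memvf.
  - by move=> /(word_span_e chev hwv i) /UP.
  - by move=> /(word_span_f i) /UP.
  - have /UP : word_span f v v by apply: (word_span_word f v [::]).
    by rewrite U0 memv0 (negPf v0).
elim: s => [|t s IH]; first by rewrite big_nil.
rewrite big_cons; apply: Slin => //.
by elim: t.2 => [|i r IHr] //=; apply: Sf.
Qed.

Definition prod_map (W P : lmodType C) (g : W -> W) (k : P -> P) (x : W * P) : W * P :=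
  (g x.1, k x.2).

Lemma prod_map_linear (W P : lmodType C) (g : {linear W -> W}) (k : {linear P -> P}) :
  linear (prod_map g k).
Proof. by move=> c x y; rewrite /prod_map /= !linearP. Qed.

HB.instance Definition _ (W P : lmodType C) (g : {linear W -> W}) (k : {linear P -> P}) :=
  GRing.isLinear.Build C (W * P)%type (W * P)%type _ (prod_map g k) (prod_map_linear g k).

Section Embedding.
Variables (W : vectType C) (eW fW hW : bool -> {linear W -> W}) (v : W).
Variables (P : lmodType C) (eP fP hP : bool -> {linear P -> P}) (m : P).
Variables (l g : bool -> C) (B : hermitian P).
Hypotheses (chevW : chevalley eW fW hW) (hwv : hw_vector eW hW l v) (v0 : v != 0) (m0 : m != 0).
Hypothesis irrW : op_irreducible eW fW.
Hypotheses (chevP : chevalley eP fP hP) (hwm : hw_vector eP hP l m).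
Hypothesis adj : forall i x y, B (fP i x) y = B x (eP i y).
Hypothesis grading : forall j, g true * a true j + g false * a false j = 1.

Let e i : {linear (W * P)%type -> (W * P)%type} := prod_map (eW i) (eP i).
Let f i : {linear (W * P)%type -> (W * P)%type} := prod_map (fW i) (fP i).
Let h i : {linear (W * P)%type -> (W * P)%type} := prod_map (hW i) (hP i).
Let u : (W * P)%type := (v, m).

Let chev : chevalley e f h.
Proof.
split=> i j [x p] /=; rewrite /prod_map /=.
  by rewrite (chev_ef chevW) (chev_ef chevP); case: (i == j).
by rewrite (chev_hf chevW) (chev_hf chevP).
Qed.

Let hwu : hw_vector e h l u.
Proof.
by split=> i; rewrite /= /prod_map /= ?hwv.1 ?hwm.1 ?hwv.2 ?hwm.2.
Qed.

Let word_pair s : word f u s = (word fW v s, word fP m s).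
Proof. by elim: s => [|i s IH] //=; rewrite IH. Qed.

(* The grading element [d] has eigenvalue [L - n] on words of length [n], so
   the product of the [d - (L - n)], 0 < n <= M, isolates the empty word. *)
Let d x := g true *: hW true x + g false *: hW false x.
Let L := g true * l true + g false * l false.

Let d_word s : d (word fW v s) = (L - (size s)%:R) *: word fW v s.
Proof.
rewrite /d !(word_h chevW hwv) !scalerA -scalerDl; congr (_ *: _).
rewrite !mulrBr addrACA -opprD -/L; congr (_ - _).
elim: s => [|j s IH] /=; first by rewrite !big_nil !mulr0 addr0.
by rewrite !big_cons !mulrDr addrACA IH grading -add1n natrD.
Qed.

Let shift (n : nat) x := d x - (L - n%:R) *: x.
Let shift_lin n : linear (shift n).
Proof.
move=> c x y; rewrite /shift /d (linearP (hW true)) (linearP (hW false)).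
rewrite scalerBr !scalerDr !scalerA opprD !(mulrC c).
by rewrite (addrACA (_ *: hW true x)) [LHS]addrACA.
Qed.

Let shifts (r : seq nat) x := foldr shift x r.
Let shifts_lin r : linear (shifts r).
Proof. by elim: r => [|n r IH] c x y //=; rewrite IH shift_lin. Qed.

Let shifts_word r s :
  shifts r (word fW v s) = (\prod_(n <- r) (n%:R - (size s)%:R)) *: word fW v s.
Proof.
elim: r => [|n r IH] /=; first by rewrite big_nil scale1r.
have shiftZ c x : shift n (c *: x) = c *: shift n x.
  have shift0 : shift n 0 = 0.
    by have := shift_lin n (-1) 0 0; rewrite scaler0 addr0 scaleN1r addNr.
  by have := shift_lin n c x 0; rewrite shift0 !addr0.
rewrite IH shiftZ /shift d_word -scalerBl scalerA big_cons; congr (_ *: _).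
by ring.
Qed.

(* Together with [pair_inj]: the submodule of [W * P] generated by [(v, m)] meets
   [0 * P] in vectors orthogonal to [m], hence to themselves, so it is a graph. *)
Let pair_orth p : word_span f u (0, p) -> B p m = 0.
Proof.
move=> [s E].
have E1 : 0 = \sum_(t <- s) t.1 *: word fW v t.2.
  transitivity (\sum_(t <- s) t.1 *: word f u t.2).1; first by rewrite -E.
  rewrite (big_morph fst (id1 := 0) (op1 := +%R)) //.
  by apply: eq_bigr => t _; rewrite word_pair.
have E2 : p = \sum_(t <- s) t.1 *: word fP m t.2.
  transitivity (\sum_(t <- s) t.1 *: word f u t.2).2; first by rewrite -E.
  rewrite (big_morph snd (id1 := 0) (op1 := +%R)) //.
  by apply: eq_bigr => t _; rewrite word_pair.
pose c0 := \sum_(t <- s) (if t.2 is [::] then t.1 else 0).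
(* A nonempty word is orthogonal to [m]: [adj] turns its first letter into an [e], which kills [m].
   Only the coefficient [c0] of the empty word remains. *)
have -> : B p m = c0 * B m m.
  rewrite E2 /c0; elim: (s) => [|t r IH]; first by rewrite !big_nil form0l mul0r.
  rewrite !big_cons formP IH mulrDl; congr (_ + _).
  case: t.2 => //= i r'; rewrite mul0r adj hwm.1.
  by rewrite formC form0l rmorph0 mulr0.
pose M := \max_(t <- s) size t.2; pose r := iota 1 M.
have /esym/eqP := congr1 (shifts r) E1.
have shifts0 : shifts r 0 = 0.
  by have := shifts_lin r (-1) 0 0; rewrite scaler0 addr0 scaleN1r addNr.
have -> : shifts r (\sum_(t <- s) t.1 *: word fW v t.2) = (c0 * \prod_(n <- r) n%:R) *: v.
  have szM t : t \in s -> (size t.2 <= M)%N by move=> ts; apply: leq_bigmax_seq.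
  rewrite /c0; elim: (s) szM => [|t s' IH] szM; first by rewrite !big_nil mul0r scale0r.
  rewrite !big_cons shifts_lin IH => [|t' t's]; last by apply: szM; rewrite inE t's orbT.
  rewrite mulrDl scalerDl; congr (_ + _); rewrite shifts_word.
  case Et: t.2 => [|i r'] /=.
    by rewrite scalerA; under eq_bigr do rewrite subr0.
  rewrite (bigD1_seq (size r').+1) ?iota_uniq //=; last first.
    by rewrite mem_iota /= add1n ltnS -[_.+1]/(size (i :: r')) -Et szM ?mem_head.
  by rewrite subrr !mul0r !scale0r scaler0.
rewrite shifts0 scaler_eq0 (negPf v0) orbF mulf_eq0 => /orP [/eqP->|]; first by rewrite mul0r.
rewrite prodf_seq_eq0 => /hasP [n]; rewrite mem_iota pnatr_eq0 /=.
by case: n.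
Qed.

Let pair_inj p : word_span f u (0, p) -> p = 0.
Proof.
move=> Np; apply: (form_eq0 (h := B)).
have [s E] := Np.
have E2 : p = \sum_(t <- s) t.1 *: word fP m t.2.
  transitivity (\sum_(t <- s) t.1 *: word f u t.2).2; first by rewrite -E.
  rewrite (big_morph snd (id1 := 0) (op1 := +%R)) //.
  by apply: eq_bigr => t _; rewrite word_pair.
(* Moving the letters of the word across by [adj] keeps the first component zero, which reduces the
   claim to [pair_orth]. *)
have orth q r : word_span f u (0, q) -> B q (word fP m r) = 0.
  elim: r q => [|i r IH] q Nq /=; first exact: pair_orth.
  rewrite formC adj formC; apply/eqP; rewrite conjCK; apply/eqP/IH.
  have := word_span_e chev hwu i Nq.
  by rewrite /= /prod_map /= linear0.
rewrite {2}E2 formC; apply/eqP; rewrite conjC_eq0; apply/eqP.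
elim: (s) => [|t s' IH]; first by rewrite big_nil form0l.
by rewrite big_cons formP IH addr0 formC orth // rmorph0 mulr0.
Qed.

(** The submodule of [W * P] generated by [(v, m)] is the graph of [phi]: it is functional by
    [pair_inj] and covers [W] by [hw_ind]. The kernel of [phi] is a submodule that misses [v]. Here
    [P] may be infinite dimensional and reducible. *)
Lemma hw_embedding : exists phi : {linear W -> P}, [/\ injective phi, phi v = m,
  forall i x, phi (eW i x) = eP i (phi x) & forall i x, phi (fW i x) = fP i (phi x)].
Proof.
have onto x : exists p, word_span f u (x, p).
  apply: (hw_ind (S := fun x => exists p, word_span f u (x, p))
    chevW hwv v0 irrW).
  - split; first by exists 0; apply: word_span0.
    by move=> c y z [p Np] [q Nq]; exists (c *: p + q); exact: (word_span_lin c Np Nq).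
  - by exists m; apply: (word_span_word f u [::]).
  - by move=> i y [p Np]; exists (fP i p); apply: (word_span_f i) Np.
pose b := vbasis (fullv : {vspace W}).
have [q Nq] := fin_all_exists (fun i : 'I_(\dim (fullv : {vspace W})) => onto b`_i).
pose phi0 x := \sum_i coord b i x *: q i.
have phi_lin : linear phi0.
  move=> c x y; rewrite /phi0 scaler_sumr -big_split; apply: eq_bigr => i _ /=.
  by rewrite linearP scalerDl scalerA.
pose phiL := GRing.isLinear.Build C W P _ phi0 phi_lin.
pose phi : {linear W -> P} := HB.pack phi0 phiL.
have Nphi x : word_span f u (x, phi x).
  rewrite {1}(coord_vbasis (memvf x)) /= /phi0 -/b.
  elim/big_ind2: _ => [|x1 x2 y1 y2 N1 N2|i _]; first exact: word_span0.
    by have := word_span_lin 1 N1 N2; rewrite !scale1r.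
  by have := word_span_lin (coord b i x) (Nq i) (word_span0 f u); rewrite !addr0.
have phi_uniq x p : word_span f u (x, p) -> phi x = p.
  move=> Np; apply/eqP; rewrite -subr_eq0; apply/eqP/pair_inj.
  have := word_span_lin (-1) Np (Nphi x); rewrite scaleN1r.
  by congr word_span; congr pair; rewrite /= ?addNr // addrC.
have phiv : phi v = m by apply/phi_uniq/(word_span_word f u [::]).
have phie i x : phi (eW i x) = eP i (phi x).
  by apply/phi_uniq; apply: (word_span_e chev hwu i (Nphi x)).
have phif i x : phi (fW i x) = fP i (phi x).
  by apply/phi_uniq; apply: (word_span_f i (Nphi x)).
exists phi; split => //.
apply: raddf_inj => x phix0.
have [|U UP] := @subspace_vspace _ _ (fun x => phi x = 0).
  by split; [rewrite linear0 | move=> c y z y0 z0; rewrite linearP y0 z0 scaler0 addr0].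
have xU : x \in U by apply/UP.
have [| |U0|U1] := irrW (U := U).
- by move=> i y /UP y0; apply/UP; rewrite phie y0 linear0.
- by move=> i y /UP y0; apply/UP; rewrite phif y0 linear0.
- by apply/eqP; rewrite -memv0 -U0.
by case/eqP: m0; rewrite -phiv; apply/UP; rewrite U1 memvf.
Qed.

End Embedding.
End HighestWeightModules.

(** * The differential of a rational representation *)

Section RationalDerivatives.
Variable C : numClosedFieldType.
Implicit Types f g : C -> C.

Lemma horner_eq0 (p : {poly C}) : (forall t, p.[t] = 0) -> p = 0.
Proof.
move=> p0; apply/eqP/negPn/negP => pn0.
have := @max_poly_roots C p [seq i%:R | i <- iota 0 (size p)] pn0.
rewrite size_map size_iota ltnn => /(_ _ _)/notF; apply.
  by apply/allP => x _; rewrite /root p0.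
by rewrite map_inj_uniq ?iota_uniq //; apply: mulrIn; apply: oner_neq0.
Qed.

(* [f] agrees off finitely many points with a rational function defined at 0,
   whose derivative at 0 is [d]. *)
Definition rderiv f (d : C) := exists a b : {poly C},
  [/\ b.[0] != 0, forall t, b.[t] != 0 -> f t = a.[t] / b.[t] &
      d = (a^`().[0] * b.[0] - a.[0] * b^`().[0]) / b.[0] ^+ 2].

(** Multiplied by [b * b'], the difference [a * b' - a' * b] vanishes everywhere, also at the zeros
    of the denominators. So it is the zero polynomial, and differentiating [a * b' = a' * b] at 0
    gives the claim. *)
Lemma rderiv_uniq f d d' : rderiv f d -> rderiv f d' -> d = d'.
Proof.
move=> [a [b [b0 fE ->]]] [a' [b' [b'0 f'E ->]]].
have E : a * b' = a' * b.
  apply/eqP; rewrite -subr_eq0.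
  have /eqP : (a * b' - a' * b) * (b * b') = 0.
    apply: horner_eq0 => t; rewrite !(hornerM, hornerD, hornerN).
    have [->|bt] := eqVneq b.[t] 0; first by rewrite mul0r mulr0.
    have [->|b't] := eqVneq b'.[t] 0; first by rewrite !mulr0.
    have := fE t bt; rewrite f'E // => /eqP.
    by rewrite eqr_div // => /eqP <-; rewrite subrr mul0r.
  rewrite mulf_eq0 => /orP [//|]; rewrite mulf_eq0 => /orP [] /eqP E0.
    by move: b0; rewrite E0 horner0 eqxx.
  by move: b'0; rewrite E0 horner0 eqxx.
have E0 : a.[0] * b'.[0] = a'.[0] * b.[0] by rewrite -!hornerM E.
have E1 := congr1 (fun p => p^`().[0]) E.
rewrite /= !derivM !hornerD !hornerM in E1.
apply/eqP; rewrite eqr_div ?expf_neq0 //; apply/eqP.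
have -> : a^`().[0] = (a'^`().[0] * b.[0] + a'.[0] * b^`().[0] - a.[0] * b'^`().[0]) / b'.[0].
  by rewrite -E1; field.
have -> : a.[0] = a'.[0] * b.[0] / b'.[0] by rewrite -E0; field.
by field.
Qed.

Lemma rderiv_ext f g d : f =1 g -> rderiv f d -> rderiv g d.
Proof. by move=> fg [a [b [b0 fE dE]]]; exists a, b; split=> // t bt; rewrite -fg fE. Qed.

Lemma rderiv_poly (p : {poly C}) : rderiv (horner p) p^`().[0].
Proof.
exists p, 1%:P; split=> [|t _|]; rewrite ?derivC ?hornerC ?oner_neq0 ?divr1 //.
by rewrite ?horner0 mulr1 mulr0 subr0 expr1n divr1.
Qed.

Lemma rderiv_const c : rderiv (fun=> c) 0.
Proof.
have := rderiv_poly c%:P; rewrite derivC horner0.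
by apply: rderiv_ext => t; rewrite hornerC.
Qed.

Lemma rderiv0 f d : rderiv f d -> exists a b : {poly C},
  [/\ b.[0] != 0, forall t, b.[t] != 0 -> f t = a.[t] / b.[t], f 0 = a.[0] / b.[0] &
      d = (a^`().[0] * b.[0] - a.[0] * b^`().[0]) / b.[0] ^+ 2].
Proof. by move=> [a [b [b0 fE dE]]]; exists a, b; split => //; apply: fE. Qed.

Lemma rderivD f g d e : rderiv f d -> rderiv g e -> rderiv (fun t => f t + g t) (d + e).
Proof.
move=> [a [b [b0 fE ->]]] [a' [b' [b'0 gE ->]]].
exists (a * b' + a' * b), (b * b'); split.
- by rewrite hornerM mulf_neq0.
- move=> t; rewrite hornerM mulf_eq0 negb_or => /andP [bt b't].
  by rewrite fE // gE // !(hornerM, hornerD); field; rewrite bt b't.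
- by rewrite !(derivD, derivM) !(hornerM, hornerD); field; rewrite b0 b'0.
Qed.

Lemma rderivM f g d e : rderiv f d -> rderiv g e ->
  rderiv (fun t => f t * g t) (d * g 0 + f 0 * e).
Proof.
move=> /rderiv0 [a [b [b0 fE f0 ->]]] /rderiv0 [a' [b' [b'0 gE g0 ->]]].
rewrite f0 g0; exists (a * a'), (b * b'); split.
- by rewrite hornerM mulf_neq0.
- move=> t; rewrite hornerM mulf_eq0 negb_or => /andP [bt b't].
  by rewrite fE // gE // !(hornerM, hornerD); field; rewrite bt b't.
- by rewrite !(derivD, derivM) !(hornerM, hornerD); field; rewrite b0 b'0.
Qed.

Lemma rderivZ c f d : rderiv f d -> rderiv (fun t => c * f t) (c * d).
Proof. by move=> /(rderivM (rderiv_const c)); rewrite mul0r add0r. Qed.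

Lemma rderiv_sum (I : Type) (r : seq I) (f : I -> C -> C) (d : I -> C) :
  (forall i, rderiv (f i) (d i)) ->
  rderiv (fun t => \sum_(i <- r) f i t) (\sum_(i <- r) d i).
Proof.
move=> fd; elim: r => [|i r IH].
  by rewrite big_nil; apply: rderiv_ext (rderiv_const 0) => t; rewrite big_nil.
by rewrite big_cons; apply: rderiv_ext (rderivD (fd i) IH) => t; rewrite big_cons.
Qed.

Lemma mpoly_ind (n : nat) (S : {mpoly C[n]} -> Prop) :
  (forall c, S c%:MP) -> (forall i, S 'X_i) ->
  (forall p q, S p -> S q -> S (p + q)) -> (forall p q, S p -> S q -> S (p * q)) ->
  forall p, S p.
Proof.
move=> SC SX SD SM p; rewrite (mpolyE p).
elim/big_rec: _ => [|m q _ Sq]; first by rewrite -mpolyC0.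
apply: SD => //; rewrite -mul_mpolyC; apply: (SM) => //; rewrite mpolyXE_id.
elim/big_rec: _ => [|i r _ Sr]; first by rewrite -mpolyC1.
apply: (SM) => //; elim: (m i) => [|k IH]; first by rewrite expr0 -mpolyC1.
by rewrite exprS; apply: SM.
Qed.

Lemma mderiv_var n (i l : 'I_n) : ('X_i : {mpoly C[n]})^`M(l) = (i == l)%:R%:MP.
Proof.
rewrite mderivX mnmE; case: eqVneq => [->|_]; last by rewrite scale0r mpolyC0.
rewrite scale1r (_ : (_ - _)%MM = 0%MM) ?mpolyX0 //.
by apply/mnmP => j; rewrite mnmBE subnn mnm0E.
Qed.

Lemma rderiv_meval n (p : {mpoly C[n]}) (c : C -> 'I_n -> C) (d : 'I_n -> C) :
  (forall l, rderiv (c^~ l) (d l)) ->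
  rderiv (fun t => p.@[c t]) (\sum_l d l * p^`M(l).@[c 0]).
Proof.
move=> cd; elim/mpoly_ind: p => [a|i|p q Dp Dq|p q Dp Dq].
- rewrite big1 => [|l _]; last by rewrite mderivC meval0 mulr0.
  by apply: rderiv_ext (rderiv_const a) => t; rewrite mevalC.
- rewrite (bigD1 i) //= big1 => [|l li]; rewrite mderiv_var mevalC.
    rewrite eqxx mulr1 addr0.
    by apply: rderiv_ext (cd i) => t; rewrite mevalXU.
  by rewrite eq_sym (negPf li) mulr0.
- under eq_bigr do rewrite mderivD mevalD mulrDr.
  rewrite big_split.
  by apply: rderiv_ext (rderivD Dp Dq) => t; rewrite mevalD.
- under eq_bigr do rewrite mderivM mevalD !mevalM mulrDr mulrA mulrCA.
  rewrite big_split /= -mulr_suml -mulr_sumr.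
  by apply: rderiv_ext (rderivM Dp Dq) => t; rewrite mevalM.
Qed.

Lemma meval_horner n (p : {mpoly C[n]}) (c : 'I_n -> {poly C}) :
  exists q : {poly C}, forall t, p.@[fun l => (c l).[t]] = q.[t].
Proof.
elim/mpoly_ind: p => [a|i|p q [p' Dp] [q' Dq]|p q [p' Dp] [q' Dq]].
- by exists a%:P => t; rewrite mevalC hornerC.
- by exists (c i) => t; rewrite mevalXU.
- by exists (p' + q') => t; rewrite mevalD Dp Dq hornerD.
- by exists (p' * q') => t; rewrite mevalM Dp Dq hornerM.
Qed.

(** Negative characters of the torus are not polynomial in [t]; they need the denominators in
    [rderiv]. *)
Lemma rderiv_exprz (w : int) : rderiv (fun t => (1 + t) ^ w) w%:~R.
Proof.
have evX n t : (('X + 1%:P : {poly C}) ^+ n).[t] = (1 + t) ^+ n.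
  by rewrite horner_exp hornerD hornerX hornerC addrC.
have dX n : (('X + 1%:P : {poly C}) ^+ n)^`().[0] = n%:R.
  by rewrite deriv_exp derivD derivX derivC addr0 mul1r hornerMn evX addr0 expr1n.
case: w => n.
  have := rderiv_poly (('X + 1%:P) ^+ n); rewrite dX.
  by apply: rderiv_ext => t; rewrite evX.
exists 1%:P, (('X + 1%:P) ^+ n.+1); split=> [|t _|].
- by rewrite evX addr0 expr1n oner_neq0.
- by rewrite evX hornerC div1r.
rewrite evX dX addr0 !expr1n divr1 derivC horner0 hornerC mul0r sub0r mul1r.
by rewrite NegzE mulrNz.
Qed.

Definition mrderiv m n (A : C -> 'M[C]_(m, n)) (D : 'M[C]_(m, n)) :=
  forall i j, rderiv (fun t => A t i j) (D i j).

Lemma mrderivM m n p (A : C -> 'M[C]_(m, n)) (B : C -> 'M[C]_(n, p)) D E :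
  mrderiv A D -> mrderiv B E ->
  mrderiv (fun t => A t *m B t) (D *m B 0 + A 0 *m E).
Proof.
move=> AD BE i j; rewrite !mxE -big_split /=.
apply: rderiv_ext (rderiv_sum _ (fun k => rderivM (AD i k) (BE k j))) => t.
by rewrite mxE.
Qed.

Lemma mrderiv_const m n (A : 'M[C]_(m, n)) : mrderiv (fun=> A) 0.
Proof. by move=> i j; rewrite mxE; apply: rderiv_const. Qed.

End RationalDerivatives.

Section Differential.
Variables (C : numClosedFieldType) (n : nat) (G : 'M[C]_n -> Prop).
Hypothesis detG : forall g, G g -> \det g = 1.
Hypothesis GM : forall g h, G g -> G h -> G (g *m h).
Hypothesis GV : forall g, G g -> G (invmx g).

Definition curve (gam : C -> 'M[C]_n) (X : 'M[C]_n) :=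
  [/\ forall t, G (gam t), gam 0 = 1%:M & mrderiv gam X].

Definition tangent X := exists gam, curve gam X.

(* [d X] is the derivative at 1 of the representation along the curves in [G] with
   tangent vector [X]; it is linear on all matrices, but meaningful only on these [X]. *)
Definition differential (V : gmodule G) (d : 'M[C]_n -> 'End(V)) :=
  (forall c X Y, d (c *: X + Y) = c *: d X + d Y) /\
  forall gam X, curve gam X -> forall v (xi : 'Hom(V, C^o)),
    rderiv (fun t => xi (act V (gam t) v)) (xi (d X v)).

Let gl_line (X : 'M[C]_n) (l : 'I_(n * n + 1)) : C := row_mx (mxvec X) (0 : 'rV_1) 0 l.

Let gl_coordsl gam X (gamX : curve gam X) l :
  rderiv (fun t => gl_coords (gam t) l) (gl_line X l).
Proof.
case: gamX => Ggam _ gamX; rewrite /gl_line /gl_coords -[l]splitK; case: (split l) => k /=.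
  rewrite row_mxEl; case/mxvec_indexP: k => i j; rewrite mxvecE.
  by apply: rderiv_ext (gamX i j) => t; rewrite row_mxEl mxvecE.
rewrite row_mxEr mxE; apply: rderiv_ext (rderiv_const 1) => t.
by rewrite row_mxEr detG // invr1 mxE (ord1 k).
Qed.

Lemma End_linear (V W : vectType C) (phi0 : V -> W) : linear phi0 ->
  exists phi : 'Hom(V, W), forall x, phi x = phi0 x.
Proof.
move=> phi_lin; pose phiL := GRing.isLinear.Build C V W _ phi0 phi_lin.
pose phi : {linear V -> W} := HB.pack phi0 phiL.
by exists (linfun phi) => x; rewrite lfunE.
Qed.

Lemma lfun_separates (V : vectType C) (x y : V) :
  (forall xi : 'Hom(V, C^o), xi x = xi y) -> x = y.
Proof.
move=> xy; rewrite (coord_vbasis (memvf x)) (coord_vbasis (memvf y)).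
apply: eq_bigr => i _; congr (_ *: _).
have [|xi xiE] := @End_linear V C^o (coord (vbasis fullv) i).
  by move=> c u v; rewrite linearP.
by rewrite -!xiE xy.
Qed.

(** Each matrix coefficient is a polynomial in the [gl_coords]; its gradient at 1, applied to the
    direction of [X], is an entry of [d X]. The coordinate 1/det is constant on [G], so [gl_line]
    has direction 0 there. *)
Lemma differential_exists (V : gmodule G) : exists d, @differential V d.
Proof.
pose b := vbasis (fullv : {vspace V}).
have [co coE] : exists co : 'I_(\dim (fullv : {vspace V})) -> 'Hom(V, C^o),
    forall j x, co j x = coord b j x.
  apply: (fin_all_exists (P := fun j (xi : 'Hom(V, C^o)) => forall x, xi x = coord b j x)) => j.
  by apply: End_linear => c u v; rewrite linearP.
have [p pE] := fin_all_exists (fun i : 'I_(\dim (fullv : {vspace V})) =>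
  fin_all_exists (fun j : 'I_(\dim (fullv : {vspace V})) => act_regular (co j) b`_i)).
pose gr i j X := \sum_l gl_line X l * (p i j)^`M(l).@[gl_coords 1%:M].
have grP i j c X Y : gr i j (c *: X + Y) = c * gr i j X + gr i j Y.
  rewrite /gr mulr_sumr -big_split; apply: eq_bigr => l _ /=.
  rewrite mulrA -mulrDl /gl_line; congr (_ * _).
  rewrite -[l]splitK; case: (split l) => k /=; rewrite ?row_mxEl ?row_mxEr.
    by rewrite linearP !mxE.
  by rewrite !mxE mulr0 addr0.
pose d0 X x := \sum_i coord b i x *: \sum_j gr i j X *: b`_j.
have [d dE] : exists d : 'M[C]_n -> 'End(V), forall X x, d X x = d0 X x.
  have d0_lin X : linear (d0 X).
    move=> c x y; rewrite /d0 scaler_sumr -big_split; apply: eq_bigr => i _ /=.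
    by rewrite linearP scalerDl scalerA.
  pose dL X := GRing.isLinear.Build C V V _ (d0 X) (d0_lin X).
  pose d X : {linear V -> V} := HB.pack (d0 X) (dL X).
  by exists (fun X => linfun (d X)) => X x; rewrite lfunE.
exists d; split=> [c X Y|gam X gamX v xi].
  apply/lfunP => x; rewrite add_lfunE scale_lfunE !dE /d0 scaler_sumr -big_split.
  apply: eq_bigr => i _ /=; rewrite scalerA [c * _]mulrC -scalerA -scalerDr; congr (_ *: _).
  rewrite scaler_sumr -big_split; apply: eq_bigr => j _ /=.
  by rewrite grP scalerDl scalerA.
rewrite dE /d0 linear_sum.
pose D i t := coord b i v * (\sum_j (p i j).@[gl_coords (gam t)] * xi b`_j).
have Gg t : G (gam t) by case: gamX.
have E t : xi (act V (gam t) v) = \sum_i D i t.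
  rewrite {1}(coord_vbasis (memvf v)) !linear_sum; apply: eq_bigr => i _.
  rewrite !linearZ /=; congr (_ * _).
  rewrite {1}(coord_vbasis (memvf (act V (gam t) b`_i))) !linear_sum.
  apply: eq_bigr => j _ /=; rewrite linearZ /= -coE pE //.
apply: (rderiv_ext (f := fun t => \sum_i D i t)) => [t|]; first by rewrite E.
apply: rderiv_sum => i; rewrite linearZ /=; apply: rderivZ.
rewrite linear_sum; apply: rderiv_sum => j; rewrite linearZ /= -[_ *: _]/(_ * _) mulrC.
apply: (rderiv_ext (f := fun t => xi b`_j * (p i j).@[gl_coords (gam t)])) => [t|].
  by rewrite mulrC.
apply: rderivZ.
have := rderiv_meval (p i j) (gl_coordsl gamX); rewrite /gr.
by case: gamX => _ -> _.
Qed.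

Variables (V : gmodule G) (d : 'M[C]_n -> 'End(V)).
Hypothesis dV : differential d.

Lemma differentialZD c X Y : d (c *: X + Y) = c *: d X + d Y. Proof. exact: dV.1. Qed.
Lemma differential0 : d 0 = 0.
Proof. by have := differentialZD (-1) 0 0; rewrite scaler0 addr0 scaleN1r addNr. Qed.
Lemma differentialZ c X : d (c *: X) = c *: d X.
Proof. by have := differentialZD c X 0; rewrite !addr0 differential0 addr0. Qed.
Lemma differentialD X Y : d (X + Y) = d X + d Y.
Proof. by have := differentialZD 1 X Y; rewrite !scale1r. Qed.
Lemma differential_sum (I : Type) (r : seq I) (X : I -> 'M[C]_n) :
  d (\sum_(i <- r) X i) = \sum_(i <- r) d (X i).
Proof.
elim: r => [|i r IH]; first by rewrite !big_nil differential0.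
by rewrite !big_cons differentialD IH.
Qed.

Lemma G_unit g : G g -> g \in unitmx.
Proof. by move=> /detG; rewrite unitmxE => ->; rewrite unitr1. Qed.

(** Both sides are the derivative at 0 of [act V (g *m gam t) v], where [g] is applied after the
    curve or before the conjugate curve. *)
Lemma differential_Ad g Y v : G g -> tangent Y ->
  act V g (d Y v) = d (g *m Y *m invmx g) (act V g v).
Proof.
move=> Gg [gam gamY]; case: (gamY) => Gt gam0 dgam.
have gu := G_unit Gg.
apply: lfun_separates => xi.
have gamgY : curve (fun t => g *m gam t *m invmx g) (g *m Y *m invmx g).
  split=> [t||]; first by apply: (GM); [exact: GM|exact: GV].
    by rewrite gam0 mulmx1 mulmxV.
  have := mrderivM (mrderivM (mrderiv_const g) dgam) (mrderiv_const (invmx g)).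
  by rewrite mulmx0 mul0mx add0r addr0.
apply: (rderiv_uniq _ (dV.2 _ _ gamgY (act V g v) xi)).
have := dV.2 _ _ gamY v (xi \o act V g)%VF; rewrite comp_lfunE.
apply: rderiv_ext => t; rewrite comp_lfunE -[act V _ (act V g v)]comp_lfunE -actM //; last first.
  by apply: (GM); [exact: GM|exact: GV].
by rewrite mulmxKV // actM // comp_lfunE.
Qed.

(* For [X ^ 3 = 0] this is the exponential of [t X]. *)
Definition exp3 (X : 'M[C]_n) (t : C) : 'M[C]_n :=
  1%:M + t *: X + (t ^+ 2 / 2) *: (X *m X).

Section OneParameter.
Variable X : 'M[C]_n.
Hypotheses (X3 : X *m X *m X = 0) (GX : forall t, G (exp3 X t)).

Lemma exp3D s t : exp3 X (s + t) = exp3 X s *m exp3 X t.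
Proof.
have X4 : X *m X *m (X *m X) = 0 by rewrite mulmxA X3 mul0mx.
have X3' : X *m (X *m X) = 0 by rewrite mulmxA X3.
rewrite /exp3 !mulmxDl !mulmxDr -!scalemxAl -!scalemxAr !mul1mx !mulmx1 !scalemxAl.
rewrite -!scalemxAl X4 X3 X3' !scaler0 !addr0.
by apply/matrixP => i j; rewrite !mxE; field.
Qed.

Lemma exp3_curve : curve (exp3 X) X.
Proof.
split=> //; first by rewrite /exp3 expr0n /= mul0r !scale0r !addr0.
move=> i j.
pose p := ((1%:M : 'M[C]_n) i j)%:P + (X i j)%:P * 'X + ((X *m X) i j / 2)%:P * 'X ^+ 2.
have pE t : exp3 X t i j = p.[t].
  rewrite !mxE /p !(hornerD, hornerM, hornerC, hornerX, hornerXn) !mxE; ring.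
apply: (rderiv_ext (f := horner p)) => [t|]; first by rewrite pE.
have -> : X i j = p^`().[0]; last exact: rderiv_poly.
rewrite /p !(derivD, derivM, derivC, derivX) !(hornerD, hornerM, hornerX, horner0, hornerC).
ring.
Qed.

Lemma exp3_tangent : tangent X.
Proof. by exists (exp3 X); apply: exp3_curve. Qed.

Lemma exp3_inv t : invmx (exp3 X t) = exp3 X (- t).
Proof.
have E0 : exp3 X 0 = 1%:M by case: exp3_curve.
have gu := G_unit (GX t).
by rewrite -[RHS]mul1mx -(mulVmx gu) -mulmxA -exp3D subrr E0 mulmx1.
Qed.

(** This is [differential_Ad] for [g = exp3 X t], differentiated in [t]: the left side gives
    [d X (d Y v)], and the product rule on the right gives [d] of the bracket plus [d Y (d X v)]. *)
Lemma differential_bracket Y : tangent Y ->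
  forall v, d (X *m Y - Y *m X) v = d X (d Y v) - d Y (d X v).
Proof.
move=> tY v; apply/esym/eqP; rewrite subr_eq; apply/eqP; apply: lfun_separates => xi.
pose Z t := exp3 X t *m Y *m exp3 X (- t).
have [_ E0 dE] := exp3_curve.
have dZ : mrderiv Z (X *m Y - Y *m X).
  have dE' : mrderiv (fun t => exp3 X (- t)) (- X).
    move=> i j; have [a [b [b0 E dX]]] := dE i j.
    exists (a \Po - 'X), (b \Po - 'X); split.
    - by rewrite horner_comp hornerN hornerX oppr0.
    - by move=> t; rewrite !horner_comp hornerN hornerX => /E ->.
    - rewrite !deriv_comp derivN derivX !mulrN1 !(hornerN, horner_comp, hornerX) oppr0 mxE dX.
      by ring.
  have := mrderivM (mrderivM dE (mrderiv_const Y)) dE'.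
  by rewrite oppr0 E0 !mulmx0 addr0 mulmx1 !mul1mx mulmxN.
(* Expanding [d] over elementary matrices reduces to the product rule for scalar functions. These
   matrices are in general not tangent to [G], which is why [d] is linear on all matrices. *)
have ddelta A w : xi (d A w) = \sum_i \sum_j A i j * xi (d (delta_mx i j) w).
  rewrite {1}[A]matrix_sum_delta differential_sum sum_lfunE linear_sum.
  apply: eq_bigr => i _; rewrite differential_sum sum_lfunE linear_sum.
  by apply: eq_bigr => j _; rewrite differentialZ scale_lfunE linearZ.
have H1 := dV.2 _ _ exp3_curve (d Y v) xi.
apply: (rderiv_uniq H1).
pose D i j t := Z t i j * xi (d (delta_mx i j) (act V (exp3 X t) v)).
apply: (rderiv_ext (f := fun t => \sum_i \sum_j D i j t)) => [t|].
  by rewrite differential_Ad // exp3_inv ddelta.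
rewrite linearD /= !ddelta -big_split; apply: rderiv_sum => i /=.
rewrite -big_split; apply: rderiv_sum => j /=; rewrite /D.
have := rderivM (dZ i j) (dV.2 _ _ exp3_curve v (xi \o d (delta_mx i j))%VF).
rewrite /Z oppr0 E0 mulmx1 mul1mx act1 !comp_lfunE id_lfunE.
by apply: rderiv_ext => t; rewrite comp_lfunE.
Qed.

(** Along [exp3 X t] the coordinates, and hence all matrix coefficients of the action, are
    polynomial in [t]. Their Taylor coefficients come from the iterates of [d X], and the bound on
    their degrees makes [d X] nilpotent. *)
Lemma exp3_act : exists N, forall v, iter N (d X) v = 0 /\
  forall t, act V (exp3 X t) v = \sum_(i < N) (t ^+ i / i`!%:R) *: iter i (d X) v.
Proof.
have [_ E0 _] := exp3_curve.
have poly_act (xi : 'Hom(V, C^o)) v : exists q : {poly C}, forall t, xi (act V (exp3 X t) v) = q.[t].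
  have [p pE] := act_regular xi v.
  have [c cE] : exists c : 'I_(n * n + 1) -> {poly C},
      forall l t, gl_coords (exp3 X t) l = (c l).[t].
    apply: (fin_all_exists (P := fun l (c : {poly C}) => forall t, gl_coords (exp3 X t) l = c.[t])) => l.
    rewrite /gl_coords -[l]splitK; case: (split l) => k /=.
      case/mxvec_indexP: k => i j.
      exists (((1%:M : 'M[C]_n) i j)%:P + (X i j)%:P * 'X + ((X *m X) i j / 2)%:P * 'X ^+ 2) => t.
      rewrite row_mxEl mxvecE !mxE !(hornerD, hornerM, hornerC, hornerX, hornerXn) ?mxE; ring.
    by exists 1%:P => t; rewrite row_mxEr detG // invr1 mxE (ord1 k) hornerC.
  have [q qE] := meval_horner p c; exists q => t.
  by rewrite pE // -qE; apply: meval_eq.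
have coefs v (q : {poly C}) (xi : 'Hom(V, C^o)) : (forall t, xi (act V (exp3 X t) v) = q.[t]) ->
    forall i, q`_i = xi (iter i (d X) v) / i`!%:R.
  move=> qE i; elim: i v q qE => [|i IH] v q qE.
    by rewrite -horner_coef0 -qE E0 act1 id_lfunE divr1.
  have [q' q'E] := poly_act xi (d X v).
  (* By [exp3D] the derivative at [t] is a derivative at 0 of the shifted polynomial
     [q \Po ('X + t%:P)]. *)
  have q'q : q^`() = q'.
    apply/eqP; rewrite -subr_eq0; apply/eqP/horner_eq0 => t.
    rewrite hornerD hornerN; apply/eqP; rewrite subr_eq0; apply/eqP.
    have := dV.2 _ _ exp3_curve v (xi \o act V (exp3 X t))%VF; rewrite comp_lfunE q'E => H.
    apply: rderiv_uniq H.
    have := rderiv_poly (q \Po ('X + t%:P)).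
    rewrite deriv_comp derivD derivX derivC addr0 mulr1 horner_comp hornerD hornerX hornerC add0r.
    apply: rderiv_ext => s; rewrite horner_comp hornerD hornerX hornerC comp_lfunE -qE.
    by rewrite addrC exp3D actM // comp_lfunE.
  have := IH _ _ q'E; rewrite -q'q coef_deriv -iterSr factS natrM => E.
  have i0 : i.+1%:R != 0 :> C by rewrite pnatr_eq0.
  have f0 : i`!%:R != 0 :> C by rewrite pnatr_eq0 -lt0n fact_gt0.
  by apply: (mulIf i0); rewrite [LHS]mulr_natr E; field; rewrite f0 addrC natr1 i0.
have iter_lin N c x y : iter N (d X) (c *: x + y) = c *: iter N (d X) x + iter N (d X) y.
  by elim: N => [|N IH] //=; rewrite IH linearP.
pose I := 'I_(\dim (fullv : {vspace V})); pose b := vbasis (fullv : {vspace V}).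
have [co coE] : exists co : I -> 'Hom(V, C^o), forall j x, co j x = coord b j x.
  apply: (fin_all_exists (P := fun j (xi : 'Hom(V, C^o)) => forall x, xi x = coord b j x)) => j.
  by apply: End_linear => c u v; rewrite linearP.
have [q qE] := fin_all_exists (fun i : I => fin_all_exists (fun j : I => poly_act (co j) b`_i)).
pose N := (\max_(i : I) \max_(j : I) size (q i j))%N.
have N0 n' v : (N <= n')%N -> iter n' (d X) v = 0.
  move=> leN; rewrite (coord_vbasis (memvf v)).
  have it0 : iter n' (d X) 0 = 0 by elim: (n') => //= k ->; rewrite linear0.
  elim/big_rec: _ => [//|i x _ IH]; rewrite iter_lin {}IH addr0.
  rewrite [iter _ _ _](coord_vbasis (memvf _)) big1 ?scaler0 // => j _.
  have /(_ n')/eqP := coefs _ _ _ (qE i j); rewrite nth_default; last first.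
    apply: leq_trans leN; apply: leq_trans (leq_bigmax i).
    exact: (leq_bigmax (F := fun j => size (q i j)) j).
  rewrite eq_sym mulf_eq0 invr_eq0 pnatr_eq0 -leqn0 leqNgt fact_gt0 orbF coE => /eqP ->.
  by rewrite scale0r.
exists N => v; split=> [|t]; first exact: N0.
apply: lfun_separates => xi; have [p pE] := poly_act xi v.
rewrite pE (@horner_coef_wide _ N); last first.
  by apply/leq_sizeP => i leNi; rewrite (coefs _ _ _ pE) N0 // linear0 mul0r.
rewrite linear_sum; apply: eq_bigr => i _; rewrite linearZ (coefs _ _ _ pE) /=.
by rewrite -[_ *: _]/(_ * _); ring.
Qed.



End OneParameter.
End Differential.

(** * The subgroups of G2 generated by root elements *)

Section IntegerMatrices.
Variable C : numClosedFieldType.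

(* 7x7 integer matrices as lists of rows, on which brackets of root vectors can be computed. *)
Definition zmatrix := seq (seq int).
Definition zcoef (s : zmatrix) i j : int := nth 0 (nth [::] s i) j.
Definition ztab (f : nat -> nat -> int) : zmatrix := mkseq (fun i => mkseq (f i) 7) 7.
Definition zmul (s t : zmatrix) : zmatrix :=
  ztab (fun i j => foldr +%R 0 (map (fun k => zcoef s i k * zcoef t k j) (iota 0 7))).
Definition zlin (c : int) (s t : zmatrix) : zmatrix :=
  ztab (fun i j => c * zcoef s i j + zcoef t i j).
Definition zlie (s t : zmatrix) : zmatrix := zlin (-1) (zmul t s) (zmul s t).
Definition zzero : zmatrix := ztab (fun _ _ => 0).

Definition zmx (s : zmatrix) : 'M[C]_7 := \matrix_(i, j) (zcoef s i j)%:~R.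

Lemma zcoef_tab f (i j : 'I_7) : zcoef (ztab f) i j = f i j.
Proof. by rewrite /zcoef /ztab !nth_mkseq. Qed.

Lemma zmx_mul s t : zmx s *m zmx t = zmx (zmul s t).
Proof.
apply/matrixP => i j; rewrite !mxE zcoef_tab foldrE big_map.
rewrite -[iota 0 7]/(index_iota 0 7) big_mkord rmorph_sum.
by apply: eq_bigr => k _; rewrite !mxE rmorphM.
Qed.

Lemma zmx_lin c s t : c%:~R *: zmx s + zmx t = zmx (zlin c s t).
Proof. by apply/matrixP => i j; rewrite !mxE zcoef_tab rmorphD rmorphM. Qed.

Lemma zmx_lie s t : lie (zmx s) (zmx t) = zmx (zlie s t).
Proof. by rewrite /lie !zmx_mul /zlie -zmx_lin mulrNz mulr1z scaleN1r addrC. Qed.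

Lemma zmx0 : zmx zzero = 0.
Proof. by apply/matrixP => i j; rewrite !mxE zcoef_tab. Qed.

Definition zE : bool -> zmatrix := fun i => ztab (fun p q =>
  if i then ((p, q) \in [:: (0, 1); (3, 4); (5, 6)])%:R + 2 * ((p, q) == (2, 3))%:R
  else ((p, q) \in [:: (1, 2); (4, 5)])%:R)%N.
Definition zF : bool -> zmatrix := fun i => ztab (fun p q =>
  if i then ((p, q) \in [:: (1, 0); (3, 2); (6, 5)])%:R + 2 * ((p, q) == (4, 3))%:R
  else ((p, q) \in [:: (2, 1); (5, 4)])%:R)%N.

Definition zroot (x1 x2 : zmatrix) (r : posroot) : zmatrix :=
  match r with
  | R10 => x1
  | R01 => x2
  | R11 => zlie x1 x2
  | R21 => zlie x1 (zlie x1 x2)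
  | R31 => zlie x1 (zlie x1 (zlie x1 x2))
  | R32 => zlie x2 (zlie x1 (zlie x1 (zlie x1 x2)))
  end.

(** Names for the root vectors and for the coroots of a1, a2 and 3 a1 + a2, so that brackets among
    them can be checked by computation. *)
Inductive gen := Ep of posroot | Fn of posroot | Hc1 | Hc2 | Hc12.

Definition gen_mx (g : gen) : 'M[C]_7 :=
  match g with
  | Ep r => pos_vector C r
  | Fn r => neg_vector C r
  | Hc1 => h1 C
  | Hc2 => h2 C
  | Hc12 => h1 C + h2 C
  end.

Definition gen_z (g : gen) : zmatrix :=
  match g with
  | Ep r => zroot (zE true) (zE false) r
  | Fn r => zroot (zF true) (zF false) r
  | Hc1 => zlie (zE true) (zF true)
  | Hc2 => zlie (zE false) (zF false)
  | Hc12 => zlin 1 (zlie (zE true) (zF true)) (zlie (zE false) (zF false))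
  end.

Lemma ef_zmx : [/\ e1 C = zmx (zE true), e2 C = zmx (zE false),
  f1 C = zmx (zF true) & f2 C = zmx (zF false)].
Proof.
split; apply/matrixP => i j; rewrite !mxE zcoef_tab /=;
  case: i => [[|[|[|[|[|[|[|//]]]]]]] ?]; case: j => [[|[|[|[|[|[|[|//]]]]]]] ?] //=;
  rewrite ?(mulr0, addr0, add0r, mulr1) //.
Qed.

Lemma gen_mxE g : gen_mx g = zmx (gen_z g).
Proof.
have [E1 E2 F1 F2] := ef_zmx; have [L1 L2 _ _] := lie_ef C.
have H1E : h1 C = zmx (zlie (zE true) (zF true)) by rewrite -L1 E1 F1 zmx_lie.
have H2E : h2 C = zmx (zlie (zE false) (zF false)) by rewrite -L2 E2 F2 zmx_lie.
case: g => [r|r|||] //=.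
- by case: r; rewrite /pos_vector /root_vector ?E1 ?E2 ?zmx_lie.
- by case: r; rewrite /neg_vector /root_vector ?F1 ?F2 ?zmx_lie.
- by rewrite H1E H2E -zmx_lin scale1r.
Qed.

Lemma gen_lie g g' z (c : int) : zlie (gen_z g) (gen_z g') = zlin c (gen_z z) zzero ->
  lie (gen_mx g) (gen_mx g') = c%:~R *: gen_mx z.
Proof. by rewrite !gen_mxE zmx_lie => ->; rewrite -zmx_lin zmx0 addr0. Qed.

Definition is_root g := if g is (Ep _ | Fn _) then true else false.

(** A string of weights of the 7-dimensional module in the direction of a root has at most three
    members, so [exp3] is the full exponential. *)
Lemma gen_mx_cube g : is_root g -> gen_mx g *m gen_mx g *m gen_mx g = 0.
Proof.
rewrite gen_mxE !zmx_mul -zmx0 => rg; congr zmx.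
by case: g rg => // -[] _; vm_compute.
Qed.

End IntegerMatrices.

Section RootElements.
Variable C : numClosedFieldType.
Local Notation mx := (gen_mx C).

Lemma exp_nilp3 (X : 'M[C]_7) t : X *m X *m X = 0 -> exp_nilp (t *: X) = exp3 X t.
Proof.
move=> X3; have X3' : (t *: X) ^+ 3 = 0.
  have X3r : X ^+ 3 = 0 by rewrite !exprS expr0 mulr1 mulrA; apply: X3.
  by rewrite exprZn X3r scaler0.
rewrite /exp_nilp -(big_mkord xpredT (fun i => (i`!%:R)^-1 *: (t *: X) ^+ i)).
rewrite (@big_cat_nat _ _ _ 3) //= [Y in _ + Y]big_nat_cond [Y in _ + Y]big1 ?addr0; last first.
  by move=> i /andP [/andP [/subnK <- _] _]; rewrite exprD X3' mulr0 scaler0.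
rewrite !big_nat_recr //= big_nil add0r expr0 expr1 !invr1 !scale1r; congr (_ + _).
by rewrite exprZn scalerA [_^-1 * _]mulrC.
Qed.

Lemma det_uptri n (A : 'M[C]_n) : (forall i j : 'I_n, (j < i)%N -> A i j = 0) ->
  (forall i, A i i = 1) -> \det A = 1.
Proof.
move=> A0 A1; rewrite -det_tr det_trig; first by rewrite big1 // => i _; rewrite mxE.
by apply/is_trig_mxP => i j ij; rewrite mxE A0.
Qed.

(** The basis is ordered by decreasing height, so a root vector and its square are strictly
    triangular. [low] says that the diagonal and the lower triangle vanish, [upp] the same for the
    upper one. *)
Lemma det_gen_exp g t : is_root g -> \det (exp3 (mx g) t) = 1.
Proof.
move=> rg; rewrite gen_mxE.
set s := gen_z g.
pose low s := all (fun i => all (fun j => (i < j)%N || (zcoef s i j == 0)) (iota 0 7)) (iota 0 7).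
pose upp s := all (fun i => all (fun j => (j < i)%N || (zcoef s i j == 0)) (iota 0 7)) (iota 0 7).
have iI (k : 'I_7) : val k \in iota 0 7 by rewrite mem_iota /= ltn_ord.
have lowP s' : low s' -> forall i j : 'I_7, (j <= i)%N -> zmx C s' i j = 0.
  move=> /allP H i j ji; have /allP/(_ _ (iI j)) := H _ (iI i).
  by rewrite /= ltnNge ji mxE => /eqP ->.
have uppP s' : upp s' -> forall i j : 'I_7, (i <= j)%N -> zmx C s' i j = 0.
  move=> /allP H i j ji; have /allP/(_ _ (iI j)) := H _ (iI i).
  by rewrite /= ltnNge ji mxE => /eqP ->.
have : low s && low (zmul s s) || upp s && upp (zmul s s).
  by rewrite /s; case: (g) rg => // -[] _; vm_compute.
have expE t' i j : exp3 (zmx C s) t' i j =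
    (i == j)%:R + t' * zmx C s i j + t' ^+ 2 / 2 * zmx C (zmul s s) i j.
  by rewrite /exp3 zmx_mul !mxE.
case/orP=> /andP [L1 L2]; [|rewrite -det_tr]; apply: det_uptri => i; try (move=> j); rewrite ?[_^T _ _]mxE expE.
- by move=> ji; rewrite (lowP _ L1) ?(lowP _ L2) ?(ltnW ji) // !mulr0 !addr0 -val_eqE gtn_eqF.
- by rewrite (lowP _ L1) ?(lowP _ L2) // !mulr0 !addr0 eqxx.
- by move=> ji; rewrite (uppP _ L1) ?(uppP _ L2) ?(ltnW ji) // !mulr0 !addr0 -val_eqE ltn_eqF.
- by rewrite (uppP _ L1) ?(uppP _ L2) // !mulr0 !addr0 eqxx.
Qed.

End RootElements.

(** * Torus elements as products of long root elements *)

Section Torus.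
Variable C : numClosedFieldType.
Local Notation mx := (gen_mx C).

Lemma exp3_square0 (E : 'M[C]_7) t : E *m E = 0 -> exp3 E t = 1%:M + t *: E.
Proof. by rewrite /exp3 => ->; rewrite scaler0 addr0. Qed.

Definition weyl_elt (E F : 'M[C]_7) z := exp3 E z *m exp3 F (- z^-1) *m exp3 E z.

(* In SL_2 the element [weyl_elt z] is [[0, z], [- z^-1, 0]]. *)
Lemma weyl_eltE (E F : 'M[C]_7) z : z != 0 -> E *m E = 0 -> F *m F = 0 ->
  E *m F *m E = E -> weyl_elt E F z = 1%:M + z *: E - z^-1 *: F - E *m F - F *m E.
Proof.
move=> z0 EE FF EFE; rewrite /weyl_elt !exp3_square0 //.
rewrite !(mulmxDl, mulmxDr, mul1mx, mulmx1) -!(scalemxAl, scalemxAr) !scalerA.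
rewrite EE EFE; move: (E *m F) (F *m E) => P Q.
by apply/matrixP => i j; rewrite !mxE; field.
Qed.

(** [E *m F] and [F *m E] are orthogonal idempotents; for long roots they project to the weights
    that pair to 1 and -1 with the coroot. The product is the analogue of diag(z, z^-1) in SL_2. *)
Lemma weyl_elt_torus (E F : 'M[C]_7) z : z != 0 -> E *m E = 0 -> F *m F = 0 ->
  E *m F *m E = E -> F *m E *m F = F ->
  weyl_elt E F z *m weyl_elt E F (-1) = 1%:M + (z - 1) *: (E *m F) + (z^-1 - 1) *: (F *m E).
Proof.
move=> z0 EE FF EFE FEF; rewrite !weyl_eltE ?oppr_eq0 ?oner_eq0 //.
rewrite !(mulmxDl, mulmxDr, mulmxN, mulNmx, mul1mx, mulmx1) -!(scalemxAl, scalemxAr).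
rewrite !mulmxA !EFE !FEF EE FF !mul0mx.
have E1 : E *m E *m F = 0 by rewrite EE mul0mx.
have E2 : F *m F *m E = 0 by rewrite FF mul0mx.
have E3 : E *m F *m F = 0 by rewrite -mulmxA FF mulmx0.
have E4 : F *m E *m E = 0 by rewrite -mulmxA EE mulmx0.
rewrite ?E1 ?E2 ?E3 ?E4 ?mul0mx; move: (E *m F) (F *m E) => P Q.
by apply/matrixP => i j; rewrite !mxE; field.
Qed.

Definition zdiag (w : seq int) (c : int) : zmatrix :=
  ztab (fun p q => ((p == q) && (nth 0 w p == c))%:R).

Lemma diag_zdiag (w : seq int) z : all (mem [:: 0; 1; -1]) w ->
  diag_mx (\row_(i < 7) z ^ w`_i) =
  1%:M + (z - 1) *: zmx C (zdiag w 1) + (z^-1 - 1) *: zmx C (zdiag w (-1)).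
Proof.
move=> wP; apply/matrixP => i j; rewrite !mxE !zcoef_tab -!val_eqE /=.
case: eqP => [_|]; last by rewrite !mulr0n !mulr0 !addr0.
have : w`_i \in [:: 0; 1; -1].
  have [lt|ge] := ltnP i (size w); first exact: (allP wP _ (mem_nth _ lt)).
  by rewrite nth_default // mem_head.
rewrite !inE => /or3P [] /eqP ->; rewrite ?expr0z ?expr1z ?exprN1 /= !mulr1n.
- by rewrite !mulr0 !addr0.
- by rewrite mulr1 mulr0; ring.
- by rewrite mulr1 mulr0; ring.
Qed.

Definition wtb1 : seq int := [:: 1; 0; 1; 0; -1; 0; -1].
Definition wtb2 : seq int := [:: 0; 1; -1; 0; 1; -1; 0].

Lemma coroot_b1E (z : C) : z != 0 -> coroot_b1 z = diag_mx (\row_(i < 7) z ^ wtb1`_i).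
Proof.
move=> z0; rewrite /coroot_b1 /coroot1 /coroot2 mulmx_diag; congr diag_mx.
apply/matrixP => i j; rewrite !mxE -expfzDr //; congr (_ ^ _).
by case: j => [[|[|[|[|[|[|[|//]]]]]]] ?].
Qed.

(** The nonzero entries of the iterated bracket for 3 a1 + a2 have absolute value 6, and its product
    with the negative root vector is -36 times a projection. The factors [6^-1] and [- 6^-1]
    normalize the pair to an sl2-triple. *)
Lemma coroot_b1_weyl (z : C) : z != 0 -> coroot_b1 z =
  weyl_elt (6^-1 *: mx (Ep R31)) (- 6^-1 *: mx (Fn R31)) z *m
  weyl_elt (6^-1 *: mx (Ep R31)) (- 6^-1 *: mx (Fn R31)) (-1).
Proof.
have n6 : (6 : C) != 0 by rewrite pnatr_eq0.
set E := _ *: mx (Ep _); set F := _ *: mx (Fn _) => z0.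
have EF : E *m F = zmx C (zdiag wtb1 1).
  rewrite -scalemxAl -scalemxAr !gen_mxE zmx_mul scalerA.
  have -> : zmul (gen_z (Ep R31)) (gen_z (Fn R31)) = zlin (-36) (zdiag wtb1 1) zzero by vm_compute.
  by rewrite -zmx_lin zmx0 addr0 scalerA -[RHS]scale1r; congr (_ *: _); field.
have FE : F *m E = zmx C (zdiag wtb1 (-1)).
  rewrite -scalemxAl -scalemxAr !gen_mxE zmx_mul scalerA.
  have -> : zmul (gen_z (Fn R31)) (gen_z (Ep R31)) = zlin (-36) (zdiag wtb1 (-1)) zzero by vm_compute.
  by rewrite -zmx_lin zmx0 addr0 scalerA -[RHS]scale1r; congr (_ *: _); field.
have sq0 s c : zmul s s = zzero -> (c *: zmx C s) *m (c *: zmx C s) = 0.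
  by rewrite -scalemxAl -scalemxAr zmx_mul => ->; rewrite zmx0 !scaler0.
rewrite weyl_elt_torus ?EF ?FE //; first by rewrite coroot_b1E ?diag_zdiag.
- by rewrite /E gen_mxE sq0 //; vm_compute.
- by rewrite /F gen_mxE sq0 //; vm_compute.
- by rewrite /E -scalemxAr gen_mxE zmx_mul; congr (_ *: zmx _ _); vm_compute.
- by rewrite /F -scalemxAr gen_mxE zmx_mul; congr (_ *: zmx _ _); vm_compute.
Qed.

Lemma coroot2_weyl (z : C) : z != 0 -> coroot2 z =
  weyl_elt (mx (Ep R01)) (mx (Fn R01)) z *m weyl_elt (mx (Ep R01)) (mx (Fn R01)) (-1).
Proof.
move=> z0; rewrite weyl_elt_torus //; try by rewrite !gen_mxE !zmx_mul -?zmx0; congr zmx; vm_compute.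
rewrite !gen_mxE !zmx_mul.
have -> : zmul (gen_z (Ep R01)) (gen_z (Fn R01)) = zdiag wtb2 1 by vm_compute.
have -> : zmul (gen_z (Fn R01)) (gen_z (Ep R01)) = zdiag wtb2 (-1) by vm_compute.
by rewrite -diag_zdiag.
Qed.

End Torus.

Section SubsystemGroup.
Variables (C : numClosedFieldType) (P : pred posroot).
Local Notation G := (@subsystem_group C P).
Local Notation mx := (gen_mx C).

Definition in_roots (g : gen) := match g with Ep r | Fn r => P r | _ => false end.

Lemma in_roots_root g : in_roots g -> is_root g. Proof. by case: g. Qed.

Lemma subsystem_exp g t : in_roots g -> G (exp3 (mx g) t).
Proof.
move=> Pg; rewrite -exp_nilp3; last exact/gen_mx_cube/in_roots_root.
by apply: gen_elt; case: g Pg => // r Pr; [apply: Or32|apply: Or33]; exists r, t.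
Qed.

Lemma det_coroot (w : 'I_7 -> int) (z : C) : z != 0 -> \sum_i w i = 0 ->
  \det (diag_mx (\row_i z ^ w i)) = 1.
Proof.
move=> z0 w0; rewrite det_diag; under eq_bigr do rewrite mxE.
suff -> : \prod_i z ^ w i = z ^ (\sum_i w i) by rewrite w0 expr0z.
by elim/big_rec2: _ => [|i x y _ ->]; rewrite ?expr0z ?expfzDr.
Qed.

Lemma det_coroot1 (z : C) : z != 0 -> \det (coroot1 z) = 1.
Proof. by move=> z0; apply: det_coroot => //; rewrite !big_ord_recl big_ord0. Qed.
Lemma det_coroot2 (z : C) : z != 0 -> \det (coroot2 z) = 1.
Proof. by move=> z0; apply: det_coroot => //; rewrite !big_ord_recl big_ord0. Qed.

Lemma subsystem_det g : G g -> \det g = 1.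
Proof.
elim=> {g} [g|||].
- case=> [[z1 [z2 [z10 z20 ->]]]|[r [t [_ ->]]]|[r [t [_ ->]]]].
  + by rewrite det_mulmx det_coroot1 ?det_coroot2 ?mulr1.
  + by rewrite exp_nilp3 (@gen_mx_cube _ (Ep r), @det_gen_exp _ (Ep r)).
  + by rewrite exp_nilp3 (@gen_mx_cube _ (Fn r), @det_gen_exp _ (Fn r)).
- by rewrite det1.
- by move=> g h _ dg _ dh; rewrite det_mulmx dg dh mulr1.
- by move=> g _ dg; rewrite det_inv dg invr1.
Qed.

Lemma subsystem_coroot1 (z : C) : z != 0 -> G (coroot1 z).
Proof.
move=> z0; apply: gen_elt; apply: Or31; exists z, 1; split=> //; first exact: oner_neq0.
rewrite [X in _ *m X](_ : _ = 1%:M) ?mulmx1 //.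
by apply/matrixP => i j; rewrite !mxE exp1rz.
Qed.

Lemma subsystem_coroot2 (z : C) : z != 0 -> G (coroot2 z).
Proof.
move=> z0; apply: gen_elt; apply: Or31; exists 1, z; split=> //; first exact: oner_neq0.
rewrite [X in X *m _](_ : _ = 1%:M) ?mul1mx //.
by apply/matrixP => i j; rewrite !mxE exp1rz.
Qed.

End SubsystemGroup.

(** * Root operators on the modules of a subsystem group *)

Section SubsystemModules.
Variables (C : numClosedFieldType) (P : pred posroot).
Local Notation G := (@subsystem_group C P).
Local Notation mx := (gen_mx C).

Let detG := @subsystem_det C P.
Let GM := @gen_mul C 7 (fun g => [\/ torus g, pos_root_elt P g | neg_root_elt P g]).
Let GV := @gen_inv C 7 (fun g => [\/ torus g, pos_root_elt P g | neg_root_elt P g]).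

(** Multiplying numerator and denominator by [1 + t] excludes the point -1, where [f] and [g] may
    differ, without changing the quotient near 0. *)
Lemma rderiv_off (f g : C -> C) d : (forall t, 1 + t != 0 -> f t = g t) ->
  rderiv f d -> rderiv g d.
Proof.
move=> fg [a [b [b0 fE ->]]]; exists (a * ('X + 1%:P)), (b * ('X + 1%:P)); split.
- by rewrite hornerM hornerD hornerX hornerC add0r mulr1.
- move=> t; rewrite !(hornerM, hornerD, hornerX, hornerC) mulf_eq0 negb_or => /andP [bt t1].
  have t1' : 1 + t != 0 by rewrite addrC.
  by rewrite -fg // fE //; field; apply/andP; split; [exact: t1|exact: bt].
- rewrite !(derivD, derivM, derivX, derivC) !(hornerM, hornerD, hornerX, hornerC) add0r addr0.
  by field.
Qed.

Section Torus.
Variables (c : C -> 'M[C]_7) (w : 'I_7 -> int).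
Hypotheses (cE : forall z, z != 0 -> c z = diag_mx (\row_i z ^ w i)).
Hypothesis Gc : forall z, z != 0 -> G (c z).

(** The value at [t = -1], where [c] gives no torus element, only has to lie in [G]. *)
Let gam t : 'M[C]_7 := if 1 + t == 0 then 1%:M else c (1 + t).

Lemma torus_curve : curve G gam (diag_mx (\row_i (w i)%:~R)).
Proof.
split=> [t||].
- by rewrite /gam; case: ifPn => [_|/Gc //]; apply: gen_one.
- rewrite /gam addr0 oner_eq0 cE ?oner_eq0 //.
  by apply/matrixP => i j; rewrite !mxE exp1rz.
- move=> i j; rewrite !mxE.
  apply: (@rderiv_off (fun t => (i == j)%:R * (1 + t) ^ w i)) => [t t0|].
    by rewrite /gam (negPf t0) cE // !mxE mulr_natl.
  by rewrite -[X in rderiv _ X]mulr_natl; apply: rderivZ (rderiv_exprz _ _).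
Qed.

Lemma torus_weight (V : gmodule G) d (v : V) m : differential d ->
  (forall z, z != 0 -> act V (c z) v = z ^+ m *: v) ->
  d (diag_mx (\row_i (w i)%:~R)) v = m%:R *: v.
Proof.
move=> dV vm; apply: lfun_separates => xi.
apply: (rderiv_uniq (dV.2 _ _ torus_curve v xi)).
rewrite linearZ /= -[_ *: _]/(_ * _) mulrC.
apply: (@rderiv_off (fun t => xi v * (1 + t) ^ (m : int))) => [t t0|].
  by rewrite /gam (negPf t0) vm // linearZ /= mulrC.
exact: rderivZ (rderiv_exprz _ _).
Qed.
End Torus.


Definition gen_ok g := if is_root g then in_roots P g else true.

Lemma gen_tangent g : gen_ok g -> tangent G (mx g).
Proof.
rewrite /gen_ok.
case Eg: (is_root g) => Pg.
  by apply: exp3_tangent => t; apply: subsystem_exp.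
case: g Eg Pg => // _ _.
- by eexists; apply: (torus_curve (c := @coroot1 C)) => // z z0; apply: subsystem_coroot1.
- by eexists; apply: (torus_curve (c := @coroot2 C)) => // z z0; apply: subsystem_coroot2.
- have -> : mx Hc12 = diag_mx (\row_i (wt1 i + wt2 i)%:~R).
    by apply/matrixP => i j; rewrite !mxE rmorphD mulrnDl.
  eexists; apply: (torus_curve (c := fun z => coroot1 z *m coroot2 z)) => z z0.
    rewrite /coroot1 /coroot2 mulmx_diag; congr diag_mx.
    by apply/matrixP => i j; rewrite !mxE -expfzDr.
  by apply: GM; [apply: subsystem_coroot1|apply: subsystem_coroot2].
Qed.

Section Module.
Variables (V : gmodule G) (d : 'M[C]_7 -> 'End(V)).
Hypothesis dV : differential d.

Lemma gen_bracket g g' z (c : int) x : in_roots P g -> gen_ok g' ->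
  zlie (gen_z g) (gen_z g') = zlin c (gen_z z) zzero ->
  d (mx g) (d (mx g') x) = d (mx g') (d (mx g) x) + c%:~R *: d (mx z) x.
Proof.
move=> Pg Pg' /(gen_lie C) E; apply/eqP; rewrite addrC -subr_eq; apply/eqP.
rewrite -(differential_bracket detG GM GV dV _ _ (gen_tangent Pg')).
- by rewrite -/(lie _ _) E (differentialZ dV) scale_lfunE.
- exact/gen_mx_cube/in_roots_root/Pg.
- by move=> t; apply: subsystem_exp.
Qed.

Lemma gen_act g : in_roots P g -> exists N, forall v, iter N (d (mx g)) v = 0 /\
  forall t, act V (exp3 (mx g) t) v = \sum_(i < N) (t ^+ i / i`!%:R) *: iter i (d (mx g)) v.
Proof.
move=> Pg; apply: (exp3_act detG dV) => [|t]; last exact: subsystem_exp.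
exact/gen_mx_cube/in_roots_root/Pg.
Qed.

Lemma gen_fixed g v : in_roots P g -> (forall t, act V (exp3 (mx g) t) v = v) -> d (mx g) v = 0.
Proof.
move=> Pg fixv; apply: lfun_separates => xi.
have cu : curve G (exp3 (mx g)) (mx g).
  by apply: exp3_curve => t; apply: subsystem_exp.
apply: (rderiv_uniq (dV.2 _ _ cu v xi)); rewrite linear0.
by apply: rderiv_ext (rderiv_const (xi v)) => t; rewrite fixv.
Qed.

Lemma weight_Hc1 v m : (forall z, z != 0 -> act V (coroot1 z) v = z ^+ m *: v) ->
  d (mx Hc1) v = m%:R *: v.
Proof.
by move=> H; apply: (torus_weight (c := @coroot1 C)) H => // z z0; apply: subsystem_coroot1.
Qed.

Lemma weight_Hc2 v m : (forall z, z != 0 -> act V (coroot2 z) v = z ^+ m *: v) ->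
  d (mx Hc2) v = m%:R *: v.
Proof.
by move=> H; apply: (torus_weight (c := @coroot2 C)) H => // z z0; apply: subsystem_coroot2.
Qed.

Lemma weight_Hc12 v m : (forall z, z != 0 -> act V (coroot_b1 z) v = z ^+ m *: v) ->
  d (mx Hc12) v = m%:R *: v.
Proof.
have -> : mx Hc12 = diag_mx (\row_i (wt1 i + wt2 i)%:~R).
  by apply/matrixP => i j; rewrite !mxE rmorphD mulrnDl.
move=> H; apply: (torus_weight (c := @coroot_b1 C)) H => // z z0.
  rewrite /coroot_b1 /coroot1 /coroot2 mulmx_diag; congr diag_mx.
  by apply/matrixP => i j; rewrite !mxE -expfzDr.
by apply: GM; [apply: subsystem_coroot1|apply: subsystem_coroot2].
Qed.

End Module.

Section Closure.
Variables (V W : gmodule G) (dV : 'M[C]_7 -> 'End(V)) (dW : 'M[C]_7 -> 'End(W)).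
Hypotheses (diffV : differential dV) (diffW : differential dW).
Hypothesis longP : forall r, long r -> P r.
Variable S : 'End(V) -> 'End(W) -> Prop.
Hypothesis S1 : S \1 \1.
Hypothesis SD : forall c A B A' B', S A B -> S A' B' -> S (c *: A + A') (c *: B + B').
Hypothesis SM : forall A B A' B', S A B -> S A' B' -> S (A \o A')%VF (B \o B')%VF.
Hypothesis Sroots : forall g, in_roots P g -> S (dV (mx g)) (dW (mx g)).

(** [S] is not assumed closed under inverses, so the inverse of [g] is carried along. *)
Let T g := [/\ G g, S (act V g) (act W g) & S (act V (invmx g)) (act W (invmx g))].

Let S0 : S 0 0.
Proof. by have := SD (-1) S1 S1; rewrite !scaleN1r !addNr. Qed.

Let exp_sum (U : gmodule G) dU g t : differential dU -> in_roots P g -> exists N, forall M,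
  (N <= M)%N -> act U (exp3 (mx g) t) =
  \sum_(i < M) (t ^+ i / i`!%:R) *: iter i (comp_lfun (dU (mx g))) \1%VF.
Proof.
move=> diffU Pg; have [N NP] := gen_act diffU Pg; exists N => M leNM.
have iterE i v : iter i (comp_lfun (dU (mx g))) \1%VF v = iter i (dU (mx g)) v.
  by elim: i => [|i IH] /=; rewrite ?id_lfunE // comp_lfunE IH.
apply/lfunP => v; have [N0 ->] := NP v.
rewrite sum_lfunE -!(big_mkord xpredT (fun i => (t ^+ i / i`!%:R) *: iter i (dU (mx g)) v)).
rewrite -(big_mkord xpredT (fun i => ((t ^+ i / i`!%:R) *: iter i (comp_lfun (dU (mx g))) \1%VF) v)).
rewrite (big_cat_nat (n := N) (p := M)) //= [Y in _ = _ + Y]big_nat_cond [Y in _ = _ + Y]big1 ?addr0.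
  by apply: eq_bigr => i _; rewrite scale_lfunE iterE.
move=> i /andP [/andP [leNi _] _]; rewrite scale_lfunE iterE -(subnK leNi) iterD N0.
suff -> : iter (i - N) (dU (mx g)) 0 = 0 by rewrite scaler0.
by elim: (i - N)%N => //= n ->; rewrite linear0.
Qed.

Let T_exp g t : in_roots P g -> T (exp3 (mx g) t).
Proof.
move=> Pg; have Sexp t' : S (act V (exp3 (mx g) t')) (act W (exp3 (mx g) t')).
  have [N NP] := exp_sum t' diffV Pg; have [M MP] := exp_sum t' diffW Pg.
  rewrite (NP (maxn N M)) ?leq_maxl // (MP (maxn N M)) ?leq_maxr //.
  elim/big_ind2: _ => // [A B A' B' SA SA'|i _].
    by have := SD 1 SA SA'; rewrite !scale1r.
  have Si : S (iter i (comp_lfun (dV (mx g))) \1%VF) (iter i (comp_lfun (dW (mx g))) \1%VF).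
    by elim: (nat_of_ord i) => //= k IH; apply: SM => //; apply: Sroots.
  by have := SD (t' ^+ i / i`!%:R) Si S0; rewrite !addr0.
split=> //; first exact: subsystem_exp.
rewrite (exp3_inv detG) ?gen_mx_cube ?(in_roots_root Pg) // => t'.
exact: subsystem_exp.
Qed.

Let T_mul g h : T g -> T h -> T (g *m h).
Proof.
move=> [Gg Sg Sg'] [Gh Sh Sh']; split; first exact: GM.
  by rewrite !actM //; apply: SM.
have -> : invmx (g *m h) = invmx h *m invmx g.
  by apply: invrM; apply: (G_unit detG).
by rewrite !actM //; [apply: SM| apply: GV..].
Qed.

Let T_inv g : T g -> T (invmx g).
Proof. by move=> [Gg Sg Sg']; split; rewrite ?invmxK //; apply: GV. Qed.

Let exp3Z (X : 'M[C]_7) c t : exp3 (c *: X) t = exp3 X (t * c).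
Proof.
rewrite /exp3 -scalemxAl -scalemxAr !scalerA; congr (_ + _ + _ *: _); by field.
Qed.

Let T_coroot_b1 (z : C) : z != 0 -> T (coroot_b1 z).
Proof.
move=> z0; rewrite coroot_b1_weyl // /weyl_elt !exp3Z.
have Pr : P R31 by apply: longP.
by do !apply: T_mul; apply: T_exp.
Qed.

Let T_coroot2 (z : C) : z != 0 -> T (coroot2 z).
Proof.
move=> z0; rewrite coroot2_weyl // /weyl_elt.
have Pr : P R01 by apply: longP.
by do !apply: T_mul; apply: T_exp.
Qed.

(** Root elements act by finite exponentials of root operators and torus elements are products of
    long root elements, so [SD] and [SM] build every [act g] from root operators. With [S] as
    stability of a subspace, or as intertwining by a map, this passes from the Lie algebra back to
    the group. *)
Lemma subsystem_closure g : G g -> S (act V g) (act W g).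
Proof.
suff: G g -> T g by move=> H /H [].
elim=> {g} [g|||]; [|split; rewrite ?invmx1 ?act1 //; apply: gen_one|move=> g h _ Tg _; exact: T_mul|move=> g _; exact: T_inv].
case=> [[z1 [z2 [z10 z20 ->]]]|[r [t [Pr ->]]]|[r [t [Pr ->]]]].
(* Change of basis from the coroots of a1, a2 to those of the simple roots of A2, both of which are
   long. *)
- have -> : coroot1 z1 *m coroot2 z2 = coroot_b1 z1 *m coroot2 (z2 / z1).
    rewrite /coroot_b1 /coroot1 /coroot2 -mulmxA !mulmx_diag; congr diag_mx.
    apply/matrixP => i j; rewrite !mxE; congr (_ * _).
    by rewrite -expfzMl mulrC divfK.
  by apply: T_mul; [apply: T_coroot_b1|apply: T_coroot2; rewrite mulf_neq0 ?invr_eq0].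
- by rewrite exp_nilp3 ?(@gen_mx_cube _ (Ep r)) //; apply: (@T_exp (Ep r)).
- by rewrite exp_nilp3 ?(@gen_mx_cube _ (Fn r)) //; apply: (@T_exp (Fn r)).
Qed.

End Closure.
End SubsystemModules.

(** * The polynomial model *)

Section PolynomialModel.
Variable C : numClosedFieldType.
Local Notation P := {mpoly C[7 + 7]}.

Definition copy (c : bool) (i : 'I_7) : 'I_(7 + 7) := if c then lshift 7 i else rshift 7 i.

Lemma copy_inj c i c' i' : (copy c i == copy c' i') = (c == c') && (i == i').
Proof.
rewrite -!val_eqE /copy; case: c c' => -[] //=; try by rewrite eqn_add2l.
  by apply/eqP => E; move: (ltn_ord i); rewrite E ltnNge leq_addr.
by apply/eqP => E; move: (ltn_ord i'); rewrite -E ltnNge leq_addr.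
Qed.

(** The derivation extending the action of [X] on the variables, in both copies at once. *)
Definition pd (X : 'M[C]_7) (p : P) : P :=
  \sum_i \sum_j X i j *: \sum_c 'X_(copy c i) * p^`M(copy c j).

Lemma pd_linear X : linear (pd X).
Proof.
move=> a p q; rewrite /pd scaler_sumr -big_split; apply: eq_bigr => i _ /=.
rewrite scaler_sumr -big_split; apply: eq_bigr => j _ /=.
rewrite scalerA mulrC -scalerA -scalerDr; congr (_ *: _).
rewrite scaler_sumr -big_split; apply: eq_bigr => c _ /=.
by rewrite mderivD mderivZ mulrDr scalerAr.
Qed.

HB.instance Definition _ X := GRing.isLinear.Build C P P _ (pd X) (pd_linear X).

Lemma pdZD a X Y p : pd (a *: X + Y) p = a *: pd X p + pd Y p.
Proof.
rewrite /pd scaler_sumr -big_split; apply: eq_bigr => i _ /=.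
rewrite scaler_sumr -big_split; apply: eq_bigr => j _ /=.
by rewrite !mxE scalerDl scalerA.
Qed.

Lemma pd0 p : pd 0 p = 0.
Proof. by have := pdZD (-1) 0 0 p; rewrite scaler0 addr0 scaleN1r addNr. Qed.
Lemma pdZ a X p : pd (a *: X) p = a *: pd X p.
Proof. by have := pdZD a X 0 p; rewrite !addr0 pd0 addr0. Qed.

Lemma pdM X p q : pd X (p * q) = pd X p * q + p * pd X q.
Proof.
rewrite /pd mulr_suml mulr_sumr -big_split; apply: eq_bigr => i _ /=.
rewrite mulr_suml mulr_sumr -big_split; apply: eq_bigr => j _ /=.
rewrite -scalerAl -scalerAr -scalerDr; congr (_ *: _).
rewrite mulr_suml mulr_sumr -big_split; apply: eq_bigr => c _ /=.
by rewrite mderivM; ring.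
Qed.

Lemma pdC X a : pd X a%:MP = 0.
Proof.
rewrite /pd big1 // => i _; rewrite big1 // => j _; rewrite big1 ?scaler0 // => c _.
by rewrite mderivC mulr0.
Qed.

Lemma pd_var X c j : pd X 'X_(copy c j) = \sum_i X i j *: 'X_(copy c i).
Proof.
apply: eq_bigr => i _; rewrite (bigD1 j) //= [Y in _ + Y]big1 ?addr0 => [|j' j'j].
  congr (_ *: _); rewrite (bigD1 c) //= big1 ?addr0 => [|c' c'c]; rewrite mderiv_var copy_inj.
    by rewrite !eqxx mpolyC1 mulr1.
  by rewrite eq_sym (negPf c'c) mpolyC0 mulr0.
rewrite big1 ?scaler0 // => c' _.
by rewrite mderiv_var copy_inj [j == j']eq_sym (negPf j'j) andbF mpolyC0 mulr0.
Qed.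

Lemma copyP l : exists c i, l = copy c i.
Proof.
by rewrite -[l]splitK; case: (split l) => i; [exists true|exists false]; exists i.
Qed.

Lemma pd_bracket X Y p : pd X (pd Y p) = pd Y (pd X p) + pd (lie X Y) p.
Proof.
elim/mpoly_ind: p => [a|l|p q Dp Dq|p q Dp Dq].
- by rewrite !pdC ?linear0 addr0.
- have [c [j ->]] := copyP l; rewrite !pd_var !linear_sum /lie.
  have E (Z T : 'M[C]_7) : \sum_i pd Z (T i j *: 'X_(copy c i)) = \sum_k (Z *m T) k j *: 'X_(copy c k).
    under eq_bigr => i _.
      rewrite linearZ /= pd_var scaler_sumr; under eq_bigr do rewrite scalerA mulrC; over.
    rewrite exchange_big; apply: eq_bigr => k _ /=.
    by rewrite -scaler_suml mxE.
  rewrite !E -big_split; apply: eq_bigr => k _ /=.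
  by rewrite -scalerDl !mxE; congr (_ *: _); ring.
- by rewrite !linearD /= Dp Dq addrACA.
- rewrite !pdM !linearD /= !pdM Dp Dq.
  move: (pd Y (pd X p)) (pd Y (pd X q)) (pd _ p) (pd _ q) (pd X p) (pd X q) (pd Y p) (pd Y q).
  by move=> *; ring.
Qed.

Lemma pd_exp X p n : pd X (p ^+ n) = (p ^+ n.-1 * pd X p) *+ n.
Proof.
elim: n => [|n IH]; first by rewrite expr0 mulr0n -mpolyC1 pdC.
rewrite exprS pdM IH /=; case: n {IH} => [|n]; first by rewrite !expr0 mulr0n mulr0 addr0 mulr1 mul1r.
by rewrite exprS /= mulrnAr [in RHS]mulrS; congr (_ + _); [ring|rewrite mulrA].
Qed.

(* The factor 2 on the variables of weight zero makes the operators of f1, f2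
   adjoint to those of e1, e2 for the Fischer form below. *)
Definition fweight (l : 'I_(7 + 7)) : nat :=
  if (l == copy true 3) || (l == copy false 3) then 2 else 1.
Definition mweight (m : 'X_{1..7 + 7}) : C := (\prod_l ((m l)`! * fweight l ^ m l))%N%:R.

Lemma mweight_gt0 m : 0 < mweight m.
Proof.
rewrite ltr0n prodn_gt0 // => l; rewrite muln_gt0 fact_gt0 expn_gt0 /fweight.
by case: ifP.
Qed.

Lemma mweightU m l : mweight (m + U_(l))%MM = (fweight l)%:R * (m l).+1%:R * mweight m.
Proof.
rewrite /mweight -!natrM; congr (_%:R).
rewrite (bigD1 l) // [in RHS](bigD1 l) //= mnmDE mnmE eqxx addn1 factS expnS.
rewrite !mulnA; congr (_ * _)%N; first by lia.
by apply: eq_bigr => i il; rewrite mnmDE mnmE eq_sym (negPf il) addn0.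
Qed.

(** Monomials are orthogonal with square norm [mweight m]. Up to the factors [fweight], this applies
    [p], read as a differential operator, to the conjugate of [q] and evaluates at 0. *)
Definition fischer (p q : P) : C := \sum_(m <- msupp p) p@_m * ((q@_m)^* * mweight m).

Lemma supp_sum (p : P) (c : 'X_{1..7 + 7} -> C) r : uniq r -> {subset msupp p <= r} ->
  \sum_(m <- msupp p) p@_m * c m = \sum_(m <- r) p@_m * c m.
Proof.
move=> ur sub; rewrite [RHS](bigID (mem (msupp p))) /= [Y in _ + Y]big1 ?addr0 => [|m /memN_msupp_eq0 ->]; last by rewrite mul0r.
rewrite -[RHS]big_filter; apply: perm_big; apply: uniq_perm; rewrite ?filter_uniq ?msupp_uniq // => m.
by rewrite mem_filter; case: (boolP (m \in _)) => //= /sub ->.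
Qed.

Lemma fischerP a p q r : fischer (a *: p + q) r = a * fischer p r + fischer q r.
Proof.
rewrite /fischer; pose s := undup (msupp p ++ msupp q ++ msupp (a *: p + q)).
have us : uniq s by apply: undup_uniq.
rewrite !(@supp_sum _ _ s) // ?mulr_sumr -?big_split /=; last first.
- by move=> m mp; rewrite mem_undup !mem_cat mp !orbT.
- by move=> m mp; rewrite mem_undup !mem_cat mp.
- by move=> m mp; rewrite mem_undup !mem_cat mp !orbT.
by apply: eq_bigr => m _; rewrite mcoeffD mcoeffZ; ring.
Qed.

Lemma fischerC p q : fischer q p = (fischer p q)^*.
Proof.
rewrite /fischer; pose s := undup (msupp p ++ msupp q).
have us : uniq s by apply: undup_uniq.
rewrite !(@supp_sum _ _ s) //; last first.
- by move=> m mp; rewrite mem_undup !mem_cat mp !orbT.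
- by move=> m mp; rewrite mem_undup !mem_cat mp.
rewrite rmorph_sum; apply: eq_bigr => m _.
rewrite !rmorphM /= conjCK (CrealP (ger0_real (ltW (mweight_gt0 m)))); ring.
Qed.

Lemma fischer_term_ge0 (p : P) m : 0 <= p@_m * ((p@_m)^* * mweight m).
Proof. by rewrite mulrA mulr_ge0 ?mul_conjC_ge0 // ltW ?mweight_gt0. Qed.

Lemma fischer_ge0 p : 0 <= fischer p p.
Proof. by apply: sumr_ge0 => m _; apply: fischer_term_ge0. Qed.

Lemma fischer_eq0 p : fischer p p = 0 -> p = 0.
Proof.
move=> /eqP; rewrite psumr_eq0 => [/allP p0|m _]; last exact: fischer_term_ge0.
apply/eqP; rewrite -msupp_eq0; case E: (msupp p) => [//|m s].
have mp : m \in msupp p by rewrite E mem_head.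
have := p0 m mp; rewrite mulrA mulf_eq0 mul_conjC_eq0 (gt_eqF (mweight_gt0 m)) orbF.
by move: mp; rewrite mcoeff_msupp => /negPf ->.
Qed.

Definition fischer_form : hermitian P :=
  Hermitian fischerP fischerC fischer_ge0 fischer_eq0.

Lemma fischer0l q : fischer 0 q = 0. Proof. exact: (form0l fischer_form). Qed.

Lemma fischerZl a p q : fischer (a *: p) q = a * fischer p q.
Proof. exact: (formZl fischer_form). Qed.
Lemma fischerZr a p q : fischer p (a *: q) = a^* * fischer p q.
Proof. exact: (formZr fischer_form). Qed.

Lemma fischerX m q : fischer 'X_[m] q = (q@_m)^* * mweight m.
Proof. by rewrite /fischer msuppX big_seq1 mcoeffX eqxx mul1r. Qed.

(** The recursion [mweightU] for the norms is what makes multiplication by a variable adjoint to a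
    multiple of differentiation. *)
Lemma fischer_mulX l p q : fischer ('X_l * p) q = (fweight l)%:R * fischer p q^`M(l).
Proof.
rewrite (mpolyE p) mulr_sumr.
elim/big_rec2: _ => [|m x y _ E].
  by rewrite !fischer0l mulr0.
rewrite -scalerAr !fischerP E mulrDr; congr (_ + _).
rewrite -mpolyXD addmC !fischerX mcoeff_deriv mweightU rmorphMn /=.
by rewrite -mulr_natr; ring.
Qed.

Lemma fischer_deriv l p q : (fweight l)%:R * fischer p^`M(l) q = fischer p ('X_l * q).
Proof.
by rewrite [fischer p^`M(l) q]fischerC [RHS]fischerC fischer_mulX rmorphM /= rmorph_nat.
Qed.

Lemma fweight_copy c i : fweight (copy c i) = if i == 3 then 2%N else 1%N.
Proof. by rewrite /fweight !copy_inj; case: c; rewrite /= ?andbF ?orbF. Qed.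

(** The hypothesis says that [X] and [Y] are adjoint on the 7-dimensional space when the basis is
    orthogonal with square norms 1, except 2 for the vector of weight zero. *)
Lemma pd_adj (X Y : 'M[C]_7) :
  (forall i j : 'I_7, (if j == 3 then 2%N else 1%N)%:R * (Y j i)^* = (if i == 3 then 2%N else 1%N)%:R * X i j) ->
  forall p q, fischer (pd X p) q = fischer p (pd Y q).
Proof.
move=> XY p q.
have suml (I : finType) (F : I -> P) r : fischer (\sum_i F i) r = \sum_i fischer (F i) r.
  elim/big_rec2: _ => [|i x y _ <-]; first exact: fischer0l.
  exact: (formDl fischer_form).
have sumr (I : finType) (F : I -> P) r : fischer r (\sum_i F i) = \sum_i fischer r (F i).
  by rewrite fischerC suml rmorph_sum; apply: eq_bigr => i _; rewrite [RHS]fischerC.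
rewrite /pd suml sumr; under eq_bigr do rewrite suml.
under [RHS]eq_bigr do rewrite sumr.
rewrite [RHS]exchange_big; apply: eq_bigr => i _; apply: eq_bigr => j _ /=.
rewrite fischerZl fischerZr suml sumr !mulr_sumr.
apply: eq_bigr => c _; rewrite -fischer_deriv fischer_mulX !fweight_copy.
by rewrite mulrCA mulrA -XY [RHS]mulrA; congr (_ * _); rewrite mulrC.
Qed.

(* Every column of a root vector has at most one nonzero entry. *)
Lemma pd_gen_var g c (j : 'I_7) (i : 'I_7) (z : int) :
  all (fun k => zcoef (gen_z g) k j == (k == i :> nat)%:R * z) (iota 0 7) ->
  pd (gen_mx C g) 'X_(copy c j) = z%:~R *: 'X_(copy c i).
Proof.
move=> /allP colP; rewrite pd_var gen_mxE.
have E (k : 'I_7) : zcoef (gen_z g) k j = (k == i)%:R * z.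
  by apply/eqP/colP; rewrite mem_iota /= ltn_ord.
rewrite (bigD1 i) //= big1 ?addr0 => [|k ki]; rewrite mxE E.
  by rewrite eqxx mul1r.
by rewrite (negPf ki) mul0r scale0r.
Qed.

Definition pd_gen g : {linear P -> P} := pd (gen_mx C g).

Lemma pd_gen_bracket g g' z (c : int) x : zlie (gen_z g) (gen_z g') = zlin c (gen_z z) zzero ->
  pd_gen g (pd_gen g' x) = pd_gen g' (pd_gen g x) + c%:~R *: pd_gen z x.
Proof. by move=> /(gen_lie C) E; rewrite /pd_gen /= pd_bracket E pdZ. Qed.

Lemma pd_gen_adj r : (r = R10) \/ (r = R01) -> forall p q,
  fischer_form (pd_gen (Fn r) p) q = fischer_form p (pd_gen (Ep r) q).
Proof.
move=> r_simple p q; apply: pd_adj => i j; rewrite !gen_mxE !mxE rmorph_int.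
rewrite !pmulrn -!intrM; congr (_%:~R).
have : all (fun i => all (fun j => (if j == 3%N then 2%N else 1%N)%:Z * zcoef (gen_z (Ep r)) j i ==
   (if i == 3%N then 2%N else 1%N)%:Z * zcoef (gen_z (Fn r)) i j) (iota 0 7)) (iota 0 7).
  by case: r_simple => ->; vm_compute.
have iI (k : 'I_7) : val k \in iota 0 7 by rewrite mem_iota /= ltn_ord.
by move=> /allP/(_ _ (iI i))/allP/(_ _ (iI j))/eqP.
Qed.

End PolynomialModel.

(** * Vectors invariant under the unipotent radical of A2 *)

Section Contravariant.
Variables (C : numClosedFieldType) (L : lmodType C) (op : gen -> {linear L -> L}).

Definition bracket_rep := forall g g' z (c : int), is_root g ->
  zlie (gen_z g) (gen_z g') = zlin c (gen_z z) zzero ->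
  forall x, op g (op g' x) = op g' (op g x) + c%:~R *: op z x.

Definition contravariant (B : hermitian L) := forall r, r = R10 \/ r = R01 -> forall x y,
  B (op (Fn r) x) y = B x (op (Ep r) y).

Hypothesis brk : bracket_rep.

Lemma comm0 g g' x : is_root g -> zlie (gen_z g) (gen_z g') = zzero ->
  op g (op g' x) = op g' (op g x).
Proof.
move=> rg E; rewrite (@brk g g' Hc1 0) ?scale0r ?addr0 // E.
Qed.

Lemma op_bracket g g' z c x : is_root g ->
  zlie (gen_z g) (gen_z g') = zlin c (gen_z z) zzero ->
  c%:~R *: op z x = op g (op g' x) - op g' (op g x).
Proof. by move=> rg E; rewrite (brk rg E) addrC addKr. Qed.

Lemma op_bracket1 g g' z x : is_root g ->
  zlie (gen_z g) (gen_z g') = zlin 1 (gen_z z) zzero ->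
  op z x = op g (op g' x) - op g' (op g x).
Proof. by move=> rg E; rewrite -(op_bracket _ rg E) mulr1z scale1r. Qed.

Lemma F11E x : op (Fn R11) x = op (Fn R10) (op (Fn R01) x) - op (Fn R01) (op (Fn R10) x).
Proof. by apply: op_bracket1 => //; vm_compute. Qed.
Lemma F21E x : op (Fn R21) x = op (Fn R10) (op (Fn R11) x) - op (Fn R11) (op (Fn R10) x).
Proof. by apply: op_bracket1 => //; vm_compute. Qed.
Lemma F31E x : op (Fn R31) x = op (Fn R10) (op (Fn R21) x) - op (Fn R21) (op (Fn R10) x).
Proof. by apply: op_bracket1 => //; vm_compute. Qed.
Lemma F32E x : op (Fn R32) x = op (Fn R01) (op (Fn R31) x) - op (Fn R31) (op (Fn R01) x).
Proof. by apply: op_bracket1 => //; vm_compute. Qed.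
Lemma E11E x : op (Ep R11) x = op (Ep R10) (op (Ep R01) x) - op (Ep R01) (op (Ep R10) x).
Proof. by apply: op_bracket1 => //; vm_compute. Qed.
Lemma E21E x : op (Ep R21) x = op (Ep R10) (op (Ep R11) x) - op (Ep R11) (op (Ep R10) x).
Proof. by apply: op_bracket1 => //; vm_compute. Qed.
Lemma E31E x : op (Ep R31) x = op (Ep R10) (op (Ep R21) x) - op (Ep R21) (op (Ep R10) x).
Proof. by apply: op_bracket1 => //; vm_compute. Qed.
Lemma E32E x : op (Ep R32) x = op (Ep R01) (op (Ep R31) x) - op (Ep R31) (op (Ep R01) x).
Proof. by apply: op_bracket1 => //; vm_compute. Qed.

Variable B : hermitian L.
Hypothesis adjB : contravariant B.

(** Adjunction reverses a bracket, so each bracketing step in [root_vector] contributes a sign. *)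
Definition rsign (r : posroot) : C := match r with R11 | R31 => -1 | _ => 1 end.

Lemma rsign_neq0 r : rsign r != 0.
Proof. by case: r; rewrite ?oppr_eq0 oner_eq0. Qed.

Let adj_step r s t : rsign t = - rsign r * rsign s ->
  (forall x y, B (op (Fn r) x) y = rsign r * B x (op (Ep r) y)) ->
  (forall x y, B (op (Fn s) x) y = rsign s * B x (op (Ep s) y)) ->
  (forall x, op (Fn t) x = op (Fn r) (op (Fn s) x) - op (Fn s) (op (Fn r) x)) ->
  (forall x, op (Ep t) x = op (Ep r) (op (Ep s) x) - op (Ep s) (op (Ep r) x)) ->
  forall x y, B (op (Fn t) x) y = rsign t * B x (op (Ep t) y).
Proof.
move=> st Ar As Ft Et x y; rewrite Ft Et formDl formNl formDr formNr !(Ar, As) st.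
by ring.
Qed.

Lemma adj r x y : B (op (Fn r) x) y = rsign r * B x (op (Ep r) y).
Proof.
have A10 x' y' : B (op (Fn R10) x') y' = rsign R10 * B x' (op (Ep R10) y').
  by rewrite mul1r; apply: adjB; left.
have A01 x' y' : B (op (Fn R01) x') y' = rsign R01 * B x' (op (Ep R01) y').
  by rewrite mul1r; apply: adjB; right.
have A11 := @adj_step R10 R01 R11 (esym (mulr1 _)) A10 A01 F11E E11E.
have A21 := @adj_step R10 R11 R21 ltac:(by rewrite /= mulrN1 opprK) A10 A11 F21E E21E.
have A31 := @adj_step R10 R21 R31 (esym (mulr1 _)) A10 A21 F31E E31E.
have A32 := @adj_step R01 R31 R32 ltac:(by rewrite /= mulrN1 opprK) A01 A31 F32E E32E.
by case: r.
Qed.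

Lemma adjE r x y : B (op (Ep r) x) y = rsign r * B x (op (Fn r) y).
Proof.
rewrite formC [B x _]formC adj rmorphM mulrA.
by case: r => /=; rewrite ?rmorphN ?rmorph1 ?mulrNN mulr1 mul1r.
Qed.

Lemma adj_iter r n x y : B (iter n (op (Fn r)) x) y = rsign r ^+ n * B x (iter n (op (Ep r)) y).
Proof.
elim: n x y => [|n IH] x y; first by rewrite expr0 mul1r.
by rewrite iterS adj IH -iterSr exprS mulrA.
Qed.

Lemma adjE_iter r n x y : B (iter n (op (Ep r)) x) y = rsign r ^+ n * B x (iter n (op (Fn r)) y).
Proof.
elim: n x y => [|n IH] x y; first by rewrite expr0 mul1r.
by rewrite iterS adjE IH -iterSr exprS mulrA.
Qed.

Definition long_invariant x := forall r, long r -> op (Ep r) x = 0.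

Definition long_image x := exists x1 x2 x3,
  x = op (Fn R31) x1 + op (Fn R01) x2 + op (Fn R32) x3.

Lemma long_image_sub : long_image 0 /\
  forall a x y, long_image x -> long_image y -> long_image (a *: x + y).
Proof.
split; first by exists 0, 0, 0; rewrite !linear0 !addr0.
move=> a x y [x1 [x2 [x3 ->]]] [y1 [y2 [y3 ->]]].
exists (a *: x1 + y1), (a *: x2 + y2), (a *: x3 + y3); rewrite !linearP !scalerDr.
by rewrite [LHS]addrACA; congr (_ + _); rewrite [LHS]addrACA.
Qed.

Lemma long_imageF r x : long r -> long_image (op (Fn r) x).
Proof.
by case: r => // _; [exists 0, x, 0|exists x, 0, 0|exists 0, 0, x];
  rewrite !linear0 ?addr0 ?add0r.
Qed.

Lemma long_invariant_orth x y : long_invariant x -> long_image y -> B x y = 0.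
Proof.
move=> xinv [x1 [x2 [x3 ->]]]; apply: form_sym0; rewrite !formDl !adj !xinv //.
by rewrite !form0r !mulr0 !addr0.
Qed.

Lemma orth_long_invariant x : (forall y, long_image y -> B y x = 0) -> long_invariant x.
Proof.
move=> orth r lr; apply: (form_eq0 (h := B)); rewrite adjE.
by apply/eqP; rewrite mulf_eq0 (negPf (rsign_neq0 _)); apply/eqP/form_sym0/orth/long_imageF.
Qed.

Lemma weight_orth g (n m : int) x y : (forall x y, B (op g x) y = B x (op g y)) ->
  op g x = n%:~R *: x -> op g y = m%:~R *: y -> n != m -> B x y = 0.
Proof.
move=> sa ex ey nm; have := sa x y; rewrite ex ey formZl formZr rmorph_int => /eqP.
by rewrite -subr_eq0 -mulrBl mulf_eq0 -rmorphB intr_eq0 subr_eq0 (negPf nm) => /eqP.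
Qed.

Lemma Hc2_selfadj x y : B (op Hc2 x) y = B x (op Hc2 y).
Proof.
have E z : op Hc2 z = op (Ep R01) (op (Fn R01) z) - op (Fn R01) (op (Ep R01) z).
  by apply: op_bracket1 => //; vm_compute.
by rewrite !E formDl formDr formNl formNr !adj !adjE !adj /= !mul1r.
Qed.

Lemma Hc12_scaled z :
  -36 *: op Hc12 z = op (Ep R31) (op (Fn R31) z) - op (Fn R31) (op (Ep R31) z).
Proof.
by rewrite -(@op_bracket (Ep R31) (Fn R31) Hc12 (-36)) // mulrNz.
Qed.

Lemma Hc12_selfadj x y : B (op Hc12 x) y = B x (op Hc12 y).
Proof.
have n36 : -36 != 0 :> C by rewrite oppr_eq0 pnatr_eq0.
apply: (mulfI n36); rewrite -formZl Hc12_scaled.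
have -> : -36 = (-36)^* :> C by rewrite rmorphN rmorph_nat.
rewrite -formZr Hc12_scaled formDl formDr formNl formNr !adj !adjE !adj /=; ring.
Qed.

End Contravariant.

(** * Projection to the long invariants and a criterion for vanishing *)

Section LongInvariants.
Variables (C : numClosedFieldType) (V : vectType C) (op : gen -> {linear V -> V}).
Variable B : hermitian V.
Hypotheses (brk : bracket_rep op) (adjB : contravariant op B).
Hypothesis nilp : forall g, is_root g -> exists N, forall x, iter N (op g) x = 0.

Definition long_torus g := match g with Hc12 | Hc2 => true | _ => false end.

Lemma torus_comm g : long_torus g -> forall r, long r -> exists c : int, forall x,
  op g (op (Fn r) x) = op (Fn r) (op g x) + c%:~R *: op (Fn r) x /\
  op g (op (Ep r) x) = op (Ep r) (op g x) - c%:~R *: op (Ep r) x.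
Proof.
move=> tg r lr.
have [c [cF cE]] : exists c : int,
    zlie (gen_z (Fn r)) (gen_z g) = zlin (- c) (gen_z (Fn r)) zzero /\
    zlie (gen_z (Ep r)) (gen_z g) = zlin c (gen_z (Ep r)) zzero.
  by case: g tg => // _; case: r lr => // _;
    [exists (-2)|exists 1|exists (-1)|exists 1|exists (-2)|exists (-1)]; split; vm_compute.
exists c => x; rewrite (brk _ cF) // (brk _ cE) //.
by rewrite mulrNz scaleNr subrK addrK.
Qed.

Lemma nilpotent_kernel (S : V -> Prop) g u : is_root g -> (forall x, S x -> S (op g x)) ->
  S u -> u != 0 -> exists2 x, S x /\ x != 0 & op g x = 0.
Proof.
move=> rg Sg Su u0; have [N N0] := nilp rg; have := N0 u.
elim: N {N0} u Su u0 => [|N IH] u Su u0; first by move=> /= E; rewrite E eqxx in u0.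
rewrite iterSr; have [gu0 _|gu0] := eqVneq (op g u) 0; first by exists u.
by apply: IH gu0; apply: Sg.
Qed.

(** [w] is the component of [Q] orthogonal to the image. It inherits torus weights because the image
    is torus stable: [z = op g w - c *: w] is both long invariant and in the image, hence orthogonal
    to itself. *)
Lemma long_projection Q : exists w, [/\ long_invariant op w, long_image op (Q - w) &
  forall g c, long_torus g -> op g Q = c *: Q -> op g w = c *: w].
Proof.
have [U UP] := subspace_vspace (long_image_sub op).
have [y /UP yI yorth] := orth_decomp B U Q; exists (Q - y).
have winv : long_invariant op (Q - y).
  by apply: (orth_long_invariant brk adjB) => z /UP; apply: yorth.
split=> // [|g c tg gQ]; first by rewrite opprB addrC subrK.
apply/eqP; rewrite -subr_eq0; apply/eqP.
set z := _ - _.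
have zinv : long_invariant op z.
  move=> r lr; rewrite /z linearB linearZ /= winv // scaler0 subr0.
  have [c' /(_ (Q - y)) [_]] := torus_comm tg lr.
  by rewrite winv // !linear0 addr0 => <-.
have zI : long_image op z.
  have -> : z = (-1) *: op g y + c *: y.
    by rewrite /z linearB /= gQ scalerBr opprB addrC addrA subrK scaleN1r addrC.
  have [_ Ilin] := long_image_sub op; apply: (Ilin) => //; last first.
    by rewrite -[_ *: _]addr0; apply: Ilin => //; case: (long_image_sub op).
  have [x1 [x2 [x3 ->]]] := yI; rewrite !linearD /=.
  have gF r x : long r -> long_image op (op g (op (Fn r) x)).
    move=> lr; have [c' /(_ x) [-> _]] := torus_comm tg lr.
    by rewrite addrC; apply: Ilin; apply: long_imageF.
  rewrite -[op g _ + _]scale1r; apply: (Ilin); last exact: gF.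
  by rewrite -[op g _]scale1r; apply: (Ilin); apply: gF.
by apply: (form_eq0 (h := B)); apply: (long_invariant_orth brk adjB).
Qed.

(** Adding a positive long root to 2 a1 + a2 or to a1 + a2 never gives a root. *)
Lemma short_stable s : s = R21 \/ s = R11 -> forall u, long_invariant op u ->
  long_invariant op (op (Ep s) u).
Proof.
move=> hs u uinv r lr; rewrite (comm0 brk) ?uinv ?linear0 //.
by case: hs => ->; case: r lr => // _; vm_compute.
Qed.

Lemma E21_E11 u : long_invariant op u ->
  op (Ep R21) (op (Ep R11) u) = op (Ep R11) (op (Ep R21) u).
Proof.
by move=> uinv; rewrite (@brk (Ep R21) (Ep R11) (Ep R32) 1) // (uinv R32) // scaler0 addr0.
Qed.

Section Detection.
Variables (v : V) (e f h : bool -> {linear V -> V}) (l : bool -> C) (a : bool -> bool -> C).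
Hypothesis fE : forall i, f i = op (Fn (if i then R10 else R01)).
Hypotheses (chev : chevalley a e f h) (hwv : hw_vector e h l v) (v0 : v != 0).
Hypothesis irr : op_irreducible e f.

(** Dual to spanning [V] by ordered products of negative root vectors. The last nonzero vector of
    the descent is killed by [E10] and [E01] and orthogonal to [v]; by adjunction it is orthogonal
    to every word in the [f]'s applied to [v]. *)
Lemma detection (Z : V -> Prop) :
  (forall u, Z u -> long_invariant op u) ->
  (forall u, Z u -> Z (op (Ep R21) u)) -> (forall u, Z u -> Z (op (Ep R11) u)) ->
  (forall u n, Z u -> B u (iter n (op (Fn R10)) v) = 0) ->
  forall u, Z u -> u = 0.
Proof.
move=> Zinv Z21 Z11 Zorth u Zu; apply/eqP/negPn/negP => u0.
have [u1 [Zu1 u10] E21u1] := @nilpotent_kernel Z (Ep R21) u isT Z21 Zu u0.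
pose Z1 x := Z x /\ op (Ep R21) x = 0.
have [|u2 [[Zu2 E21u2] u20] E11u2] := @nilpotent_kernel Z1 (Ep R11) u1 isT _ (conj Zu1 E21u1) u10.
  move=> x [Zx Ex]; split; first exact: Z11.
  by rewrite E21_E11 ?Ex ?linear0 //; apply: Zinv.
(* Nothing makes [Z] stable under [E10], but the common kernel of the other positive root vectors
   is, as their brackets with [E10] stay among them. *)
pose Z2 x := [/\ long_invariant op x, op (Ep R21) x = 0, op (Ep R11) x = 0 &
  forall n, B x (iter n (op (Fn R10)) v) = 0].
have [x [x1 x2 x3 x4]|||u3 [[uinv E21u3 E11u3 uorth] u30] E10u3] := @nilpotent_kernel Z2 (Ep R10) u2 isT.
- split=> [r lr|||n].
  + case: r lr => // _.
    * by have := E11E brk x; rewrite x3 x1 // linear0 sub0r => /esym/eqP; rewrite oppr_eq0 => /eqP.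
    * by rewrite (comm0 brk) ?x1 ?linear0 //; vm_compute.
    * by rewrite (comm0 brk) ?x1 ?linear0 //; vm_compute.
  + by have := E31E brk x; rewrite x2 x1 // linear0 sub0r => /esym/eqP; rewrite oppr_eq0 => /eqP.
  + by have := E21E brk x; rewrite x2 x3 // linear0 sub0r => /esym/eqP; rewrite oppr_eq0 => /eqP.
  + by rewrite (adjE brk adjB) mul1r -iterS.
- by split=> //; [apply: Zinv|move=> n; apply: Zorth].
- by [].
case/eqP: u30; apply: (form_eq0 (h := B)).
apply: (hw_ind (S := fun x => B u3 x = 0) chev hwv v0 irr).
- split; first exact: form0r.
  by move=> c x y x0 y0; rewrite formDr formZr x0 y0 mulr0 addr0.
- exact: (uorth 0%N).
- move=> i x x0; apply: form_sym0; rewrite fE (adj brk adjB).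
  suff -> : op (Ep (if i then R10 else R01)) u3 = 0 by rewrite form0r mulr0.
  by case: i; [|apply: uinv].
Qed.

End Detection.
End LongInvariants.

(** * Decomposition from invariant vectors *)

Section ModuleOperators.
Variables (C : numClosedFieldType) (P : pred posroot).
Local Notation G := (@subsystem_group C P).
Local Notation mx := (gen_mx C).

Definition module_op (V : gmodule G) (d : 'M[C]_7 -> 'End(V)) (g : gen) : {linear V -> V} :=
  d (mx g).

(** [P] will be all roots or the long ones, and [P R10] tells which; the simple roots are a1, a2 or
    3 a1 + a2, a2. *)
Definition simple_roots (r : posroot) : bool :=
  match r with R01 => true | R10 => P R10 | R31 => ~~ P R10 | _ => false end.

Section Closure.
Variables (V W : gmodule G) (dV : 'M[C]_7 -> 'End(V)) (dW : 'M[C]_7 -> 'End(W)).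
Hypotheses (diffV : differential dV) (diffW : differential dW).
Hypothesis P_cases : P =1 predT \/ P =1 long.
Variable S : 'End(V) -> 'End(W) -> Prop.
Hypothesis S1 : S \1 \1.
Hypothesis SD : forall c A B A' B', S A B -> S A' B' -> S (c *: A + A') (c *: B + B').
Hypothesis SM : forall A B A' B', S A B -> S A' B' -> S (A \o A')%VF (B \o B')%VF.
Hypothesis Ssimple : forall r, simple_roots r ->
  S (dV (mx (Ep r))) (dW (mx (Ep r))) /\ S (dV (mx (Fn r))) (dW (mx (Fn r))).

Let bracket_lfun (U : gmodule G) (dU : 'M[C]_7 -> 'End(U)) g g' z : differential dU ->
  in_roots P g -> in_roots P g' ->
  zlie (gen_z g) (gen_z g') = zlin 1 (gen_z z) zzero ->
  dU (mx z) = (dU (mx g) \o dU (mx g'))%VF - (dU (mx g') \o dU (mx g))%VF.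
Proof.
move=> diffU Pg Pg' E; apply/lfunP => x; rewrite add_lfunE opp_lfunE !comp_lfunE.
rewrite (gen_bracket diffU _ Pg _ E); last by case: (g') Pg'.
by rewrite mulr1z scale1r addrC addKr.
Qed.

Let S_bracket g g' z : in_roots P g -> in_roots P g' ->
  zlie (gen_z g) (gen_z g') = zlin 1 (gen_z z) zzero ->
  S (dV (mx g)) (dW (mx g)) -> S (dV (mx g')) (dW (mx g')) -> S (dV (mx z)) (dW (mx z)).
Proof.
move=> Pg Pg' E Sg Sg'; rewrite (bracket_lfun diffV Pg Pg' E) (bracket_lfun diffW Pg Pg' E).
have S0 : S 0 0 by have := SD (-1) S1 S1; rewrite !scaleN1r !addNr.
have := SD (-1) (SM Sg' Sg) (SM Sg Sg').
by rewrite !scaleN1r addrC [X in S _ X]addrC.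
Qed.

Lemma simple_closure g : G g -> S (act V g) (act W g).
Proof.
apply: (subsystem_closure diffV diffW) => // [r|].
  by case: P_cases => -> //.
case: P_cases => PE.
  have PT r : P r by rewrite PE.
  have [E10 F10] : _ /\ _ := Ssimple (r := R10) ltac:(by rewrite /simple_roots /= ?PE).
  have [E01 F01] : _ /\ _ := Ssimple (r := R01) ltac:(by rewrite /simple_roots /= ?PE).
  have E11 := S_bracket (g := Ep R10) (g' := Ep R01) (z := Ep R11) (PT _) (PT _) erefl E10 E01.
  have E21 := S_bracket (g := Ep R10) (g' := Ep R11) (z := Ep R21) (PT _) (PT _) erefl E10 E11.
  have E31 := S_bracket (g := Ep R10) (g' := Ep R21) (z := Ep R31) (PT _) (PT _) erefl E10 E21.
  have E32 := S_bracket (g := Ep R01) (g' := Ep R31) (z := Ep R32) (PT _) (PT _) erefl E01 E31.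
  have F11 := S_bracket (g := Fn R10) (g' := Fn R01) (z := Fn R11) (PT _) (PT _) erefl F10 F01.
  have F21 := S_bracket (g := Fn R10) (g' := Fn R11) (z := Fn R21) (PT _) (PT _) erefl F10 F11.
  have F31 := S_bracket (g := Fn R10) (g' := Fn R21) (z := Fn R31) (PT _) (PT _) erefl F10 F21.
  have F32 := S_bracket (g := Fn R01) (g' := Fn R31) (z := Fn R32) (PT _) (PT _) erefl F01 F31.
  by case=> // -[].
have P31 : P R31 by rewrite PE.
have P01 : P R01 by rewrite PE.
have [E31 F31] : _ /\ _ := Ssimple (r := R31) ltac:(by rewrite /simple_roots /= ?PE).
have [E01 F01] : _ /\ _ := Ssimple (r := R01) ltac:(by rewrite /simple_roots /= ?PE).
have E32 := S_bracket (g := Ep R01) (g' := Ep R31) (z := Ep R32) P01 P31 erefl E01 E31.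
have F32 := S_bracket (g := Fn R01) (g' := Fn R31) (z := Fn R32) P01 P31 erefl F01 F31.
by case=> // r /=; rewrite PE; case: r.
Qed.

End Closure.

Lemma simple_irreducible (V : gmodule G) (d : 'M[C]_7 -> 'End(V)) (e f : bool -> {linear V -> V})
  (c c' : bool -> C) (rho : bool -> posroot) :
  differential d -> P =1 predT \/ P =1 long -> irreducible V ->
  (forall r, simple_roots r -> exists i, r = rho i) ->
  (forall i x, d (mx (Ep (rho i))) x = c i *: e i x) ->
  (forall i x, d (mx (Fn (rho i))) x = c' i *: f i x) ->
  op_irreducible e f.
Proof.
move=> diffd P_cases [_ irr] rhoP eE fE U Ue Uf; apply: irr => g Gg.
apply/subvP => _ /memv_imgP [x xU ->].
pose S (A _ : 'End(V)) := forall x, x \in U -> A x \in U.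
apply: (@simple_closure V V d d diffd diffd P_cases S _ _ _ _ g Gg x xU).
- by move=> y; rewrite id_lfunE.
- by move=> k A B A' B' SA SA' y yU; rewrite add_lfunE scale_lfunE memvD ?memvZ ?SA ?SA'.
- by move=> A B A' B' SA SA' y yU; rewrite comp_lfunE SA ?SA'.
- move=> r /rhoP [i ->]; split=> y yU; [rewrite eE|rewrite fE]; apply: memvZ.
    exact: Ue.
  exact: Uf.
Qed.

End ModuleOperators.

Section LongChevalley.
Variables (C : numClosedFieldType) (L : lmodType C) (op : gen -> {linear L -> L}).

Definition long_bracket := forall g g' z (c : int), in_roots long g -> gen_ok long g' ->
  zlie (gen_z g) (gen_z g') = zlin c (gen_z z) zzero ->
  forall x, op g (op g' x) = op g' (op g x) + c%:~R *: op z x.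

(* [E31, F31] = -36 (h1 + h2), hence the scaling of the sl2-triple. *)
Definition long_e (i : bool) : {linear L -> L} :=
  if i then (6^-1 \*: op (Ep R31) : {linear L -> L}) else op (Ep R01).
Definition long_f (i : bool) : {linear L -> L} :=
  if i then (- 6^-1 \*: op (Fn R31) : {linear L -> L}) else op (Fn R01).
Definition long_h (i : bool) : {linear L -> L} := if i then op Hc12 else op Hc2.
Definition cartan_A2 (i j : bool) : C := if i == j then 2 else -1.

Lemma long_chevalley : long_bracket -> chevalley cartan_A2 long_e long_f long_h.
Proof.
have n6 : 6 != 0 :> C by rewrite pnatr_eq0.
move=> brk; split=> i j x.
  case: i j => -[]; rewrite /long_e /long_f /long_h /=.
  - rewrite !linearZ /= (brk (Ep R31) (Fn R31) Hc12 (-36)) // scalerDr scalerA.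
    rewrite !scalerDr !scalerA; congr (_ + _); first by congr (_ *: _); ring.
    by rewrite -[RHS]scale1r; congr (_ *: _); field.
  - by rewrite addr0 linearZ /= (brk (Ep R31) (Fn R01) Hc12 0) // scale0r addr0.
  - by rewrite addr0 !linearZ /= (brk (Ep R01) (Fn R31) Hc12 0) // scale0r addr0.
  - by rewrite (brk (Ep R01) (Fn R01) Hc2 1) // scale1r.
have hF g r c : in_roots long (Fn r) -> gen_ok long g ->
    zlie (gen_z (Fn r)) (gen_z g) = zlin c (gen_z (Fn r)) zzero ->
    op g (op (Fn r) x) = op (Fn r) (op g x) - c%:~R *: op (Fn r) x.
  by move=> lr og E; rewrite (brk _ _ _ _ lr og E) addrK.
case: i j => -[]; rewrite /long_f /long_h /cartan_A2 /=.
- rewrite [op Hc12 (_ *: _)]linearZ /= (hF Hc12 R31 2) // scalerBr !scalerA.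
  by congr (_ - _ *: _); rewrite mulrC.
- by rewrite (hF Hc12 R01 (-1)).
- rewrite [op Hc2 (_ *: _)]linearZ /= (hF Hc2 R31 (-1)) // scalerBr !scalerA.
  by congr (_ - _ *: _); rewrite mulrC.
- by rewrite (hF Hc2 R01 2).
Qed.

(** The minus sign in [long_f] cancels [rsign R31], so the rescaled generators are exactly adjoint,
    as [hw_embedding] requires. *)
Lemma long_adj (B : hermitian L) : bracket_rep op -> contravariant op B ->
  forall i x y, B (long_f i x) y = B x (long_e i y).
Proof.
move=> brk adjB [] x y; rewrite /long_f /long_e /= ?(adj brk adjB) ?mul1r //.
rewrite formZl formZr (adj brk adjB) /= mulN1r mulrN mulNr opprK; congr (_ * _).
by rewrite fmorphV rmorph_nat.
Qed.

End LongChevalley.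

Arguments gen_mx : simpl never.

(** * Decomposition along long invariants of distinct weights *)

Section Branching.
Variables (C : numClosedFieldType) (V : gmodule (@G2 C)) (d : 'M[C]_7 -> 'End(V)).
Hypothesis dV : differential d.
Variable B : hermitian V.
Local Notation op := (module_op d).
Hypothesis adjB : contravariant op B.

Lemma G2_bracket : bracket_rep op.
Proof.
move=> g g' z c rg E x; apply: (gen_bracket dV) E; first by case: g rg.
by case: g'.
Qed.

Lemma G2_nilp g : is_root g -> exists N, forall x, iter N (op g) x = 0.
Proof.
move=> rg; have Pg : in_roots predT g by case: g rg.
by have [N NP] := gen_act dV Pg; exists N => x; case: (NP x).
Qed.

Lemma res_differential : differential (V := res_G2_A2 V) d.
Proof.
split=> [|gam X [Ggam gam0 dgam]]; first exact: dV.1.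
by apply: dV.2; split=> // t; apply: A2_sub_G2.
Qed.

(** [hw_embedding] with [V] as the ambient space. The last two properties serve orthogonality
    arguments: the image is stable under long root operators, and it is generated from [w] by the
    negative ones. *)
Lemma A2_embedding (M : gmodule (@A2 C)) (p q : nat) (w : V) :
  is_V_A2 M p q -> w != 0 -> long_invariant op w ->
  op Hc12 w = p%:R *: w -> op Hc2 w = q%:R *: w ->
  exists phi : 'Hom(M, V), [/\ forall g x, A2 g -> phi (act M g x) = act V g (phi x),
    injective phi, exists x, phi x = w,
    forall r x, long r -> exists y y', op (Ep r) (phi x) = phi y /\ op (Fn r) (phi x) = phi y' &
    forall S : V -> Prop, S 0 -> (forall a x y, S x -> S y -> S (a *: x + y)) -> S w ->
      (forall r x, long r -> S x -> S (op (Fn r) x)) -> forall x, S (phi x)].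
Proof.
move=> [irrM [v [v0 v12 v2 vU]]] w0 winv w12 w2.
have [dM dMP] := differential_exists (@subsystem_det C long) M.
have brkM : long_bracket (module_op dM).
  by move=> g g' z c Pg Pg' E x; apply: (gen_bracket dMP).
have brkV := G2_bracket.
have brkVl : long_bracket op.
  by move=> g g' z c Pg Pg' E x; apply: brkV => //; apply: in_roots_root Pg.
have vE r : long r -> dM (gen_mx C (Ep r)) v = 0.
  move=> lr; apply: (gen_fixed dMP) => // t; apply: vU; apply: gen_elt.
  by exists r, t; split=> //; rewrite exp_nilp3 // (@gen_mx_cube _ (Ep r)).
pose l (i : bool) : C := if i then p%:R else q%:R.
have hwv : hw_vector (long_e (module_op dM)) (long_h (module_op dM)) l v.
  split=> -[]; rewrite /long_e /long_h /= /module_op ?vE ?scaler0 //.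
    exact: (weight_Hc12 dMP v12).
  exact: (weight_Hc2 dMP v2).
have hww : hw_vector (long_e op) (long_h op) l w.
  by split=> -[]; rewrite /long_e /long_h /= ?winv ?scaler0.
have n6 : 6 != 0 :> C by rewrite pnatr_eq0.
have irr : op_irreducible (long_e (module_op dM)) (long_f (module_op dM)).
  apply: (@simple_irreducible C long M dM _ _ (fun i => if i then 6 else 1)
    (fun i => if i then - 6 else 1) (fun i => if i then R31 else R01)) => //.
  - by right.
  - by case=> // _; [exists false|exists true].
  - by case=> x; rewrite /long_e /= ?scale1r // scalerA divff // scale1r.
  - by case=> x; rewrite /long_f /= ?scale1r // scalerA mulrNN divff // scale1r.
have grading j : 1 * cartan_A2 C true j + 1 * cartan_A2 C false j = 1.
  by case: j; rewrite /cartan_A2 /=; ring.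
have [phi0 [phi_inj phiv phie phif]] := @hw_embedding _ _ _ _ _ _ _ _ _ _ _ _ _
  (fun=> 1) B (long_chevalley brkM) hwv v0 w0 irr (long_chevalley brkVl) hww
  (long_adj brkV adjB) grading.
pose phi := linfun phi0; have phiE x : phi x = phi0 x by rewrite lfunE.
have phir r x : simple_roots long r ->
    phi (dM (gen_mx C (Ep r)) x) = d (gen_mx C (Ep r)) (phi x) /\
    phi (dM (gen_mx C (Fn r)) x) = d (gen_mx C (Fn r)) (phi x).
  rewrite !phiE; case: r => // _; split.
  - exact: (phie false).
  - exact: (phif false).
  - have := phie true x; rewrite /long_e /= linearZ /= => /(scalerI (invr_neq0 n6)) //.
  - have := phif true x; rewrite /long_f /= linearZ /= => /(@scalerI _ _ (- 6^-1)).
    by rewrite oppr_eq0 invr_eq0 n6; apply.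
exists phi; split.
- move=> g x Gg.
  pose S (A : 'End(M)) (A' : 'End(res_G2_A2 V)) := forall x, phi (A x) = A' (phi x).
  apply: (@simple_closure C long M (res_G2_A2 V) dM d dMP res_differential _ S _ _ _ _ g Gg).
  + by right.
  + by move=> y; rewrite !id_lfunE.
  + by move=> k A A1 A' A1' SA SA' y; rewrite !add_lfunE !scale_lfunE linearD linearZ /= SA SA'.
  + by move=> A A1 A' A1' SA SA' y; rewrite !comp_lfunE SA SA'.
  + by move=> r sr; split=> y; case: (phir r y sr).
- by move=> x y; rewrite !phiE; apply: phi_inj.
- by exists v; rewrite phiE.
- have E31 x : op (Ep R31) (phi x) = phi (dM (gen_mx C (Ep R31)) x) by case: (phir R31 x isT).
  have E01 x : op (Ep R01) (phi x) = phi (dM (gen_mx C (Ep R01)) x) by case: (phir R01 x isT).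
  have F31 x : op (Fn R31) (phi x) = phi (dM (gen_mx C (Fn R31)) x) by case: (phir R31 x isT).
  have F01 x : op (Fn R01) (phi x) = phi (dM (gen_mx C (Fn R01)) x) by case: (phir R01 x isT).
  case=> // x _; do 2!eexists; [by split; [apply: E01|apply: F01]|by split; [apply: E31|apply: F31]|].
  by split; [rewrite (E32E brkV) !(E31, E01) -linearB|rewrite (F32E brkV) !(F31, F01) -linearB].
move=> S S0 Slin Sw SF.
apply: (hw_ind (S := fun x => S (phi x)) (long_chevalley brkM) hwv v0 irr).
- by split=> [|a x y Sx Sy]; rewrite ?linear0 // linearP; apply: Slin.
- by rewrite phiE phiv.
- move=> i x Sx; rewrite phiE phif -phiE /long_f; case: i => /=; last exact: SF.
  by rewrite -[_ *: _]addr0; apply: (Slin) => //; apply: SF.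
Qed.

(** The submodules generated by the [w t] are pairwise orthogonal since their generators have
    distinct weights. A nonzero orthogonal complement of their sum would contain a nonzero long
    invariant, against [wspan]. *)
Lemma branching (T : finType) (Pt : pred T) (p q : T -> nat) (w : T -> V)
    (VH : nat -> nat -> gmodule (@A2 C)) :
  (forall m1 m2, is_V_A2 (VH m1 m2) m1 m2) ->
  (forall t, Pt t -> [/\ w t != 0, long_invariant op (w t),
     op Hc12 (w t) = (p t)%:R *: w t & op Hc2 (w t) = (q t)%:R *: w t]) ->
  (forall t t', Pt t -> Pt t' -> p t = p t' -> q t = q t' -> t = t') ->
  (forall u, long_invariant op u -> (forall t, Pt t -> B u (w t) = 0) -> u = 0) ->
  gmodule_iso (res_G2_A2 V) (\gsum_(t : T | Pt t) VH (p t) (q t)).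
Proof.
move=> hVH wP pq_inj wspan; have brk := G2_bracket.
have E t : exists phi : 'Hom(VH (p t) (q t), V), Pt t ->
    [/\ forall g x, A2 g -> phi (act (VH (p t) (q t)) g x) = act V g (phi x),
    injective phi, exists x, phi x = w t,
    forall r x, long r -> exists y y', op (Ep r) (phi x) = phi y /\ op (Fn r) (phi x) = phi y' &
    forall S : V -> Prop, S 0 -> (forall a x y, S x -> S y -> S (a *: x + y)) -> S (w t) ->
      (forall r x, long r -> S x -> S (op (Fn r) x)) -> forall x, S (phi x)].
  case Ptt: (Pt t); last by exists 0.
  have [w0 winv w12 w2] := wP _ Ptt.
  by have [phi H] := A2_embedding (hVH _ _) w0 winv w12 w2; exists phi.
have {E} [Phi PhiP] : exists Phi : forall t, 'Hom(VH (p t) (q t), V), forall t, Pt t -> _ :=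
  fin_all_exists E.
have Phi_orth t t' : Pt t -> Pt t' -> t != t' -> forall x y, B (Phi t x) (Phi t' y) = 0.
  move=> Ptt Ptt' tt'; have [_ _ _ _ ind] := PhiP _ Ptt; have [_ _ _ stE ind'] := PhiP _ Ptt'.
  have [w0 winv w12 w2] := wP _ Ptt; have [w0' winv' w12' w2'] := wP _ Ptt'.
  apply: (ind (fun z => forall y, B z (Phi t' y) = 0)).
  - by move=> y; rewrite form0l.
  - by move=> a x y x0 y0 z; rewrite formP x0 y0 mulr0 addr0.
  - apply: (ind' (fun z => B (w t) z = 0)).
    + exact: form0r.
    + by move=> a x y x0 y0; rewrite formDr formZr x0 y0 mulr0 addr0.
    + have [ppt|npt] := eqVneq (p t) (p t'); last first.
        apply: (@weight_orth _ _ op B Hc12 (p t) (p t')) => //.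
        exact: (Hc12_selfadj brk adjB).
      have [qqt|nqt] := eqVneq (q t) (q t'); last first.
        apply: (@weight_orth _ _ op B Hc2 (q t) (q t')) => //.
        exact: (Hc2_selfadj brk adjB).
      by rewrite (pq_inj t t') ?eqxx in tt'.
    + move=> r x lr x0; apply: form_sym0.
      by rewrite (adj brk adjB) winv // form0r mulr0.
  - move=> r x lr x0 y; have [y' [_ [yE _]]] := stE r y lr.
    by rewrite (adj brk adjB) yE x0 mulr0.
(* The map is built along the enumeration of [T]. The last clause, orthogonality to the summands
   still to come, yields injectivity when the next one is added. *)
have [Psi [PsiE Psi_inj Psi_img _]] : exists Psi : 'Hom(\gsum_(t : T | Pt t) VH (p t) (q t), V),
  [/\ forall g x, A2 g -> Psi (act _ g x) = act V g (Psi x), injective Psi,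
      forall t x, t \in index_enum T -> Pt t -> exists y, Phi t x = Psi y &
      forall t x y, t \notin index_enum T -> Pt t -> B (Phi t x) (Psi y) = 0].
  elim: (index_enum T) (index_enum_uniq T) => [_|t r IH /= /andP [tr ur]].
    rewrite big_nil; exists 0; split=> //.
    - by move=> g x _; rewrite !zero_lfunE linear0.
    - by move=> x y _; rewrite (thinmx0 x) (thinmx0 y).
    - by move=> t x y _ _; rewrite zero_lfunE form0r.
  have [Psi [PsiE Psi_inj Psi_img Psi_orth]] := IH ur.
  rewrite big_cons; case Ptt: (Pt t); last first.
    exists Psi; split=> // t'; case: (eqVneq t' t) => [->|t't] x; rewrite inE ?eqxx ?Ptt //.
    - by rewrite (negPf t't); apply: Psi_img.
    - by move=> y; rewrite negb_or => /andP [_ t'r] Pt'; apply: Psi_orth.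
  have [PhiE Phi_inj _ _ _] := PhiP _ Ptt.
  have [Psi' Psi'E] := @End_linear C _ V
    (fun x : (VH (p t) (q t) * \big[gsum (G:=@A2 C)/gmod0 (@A2 C)]_(j <- r | Pt j) VH (p j) (q j))%type =>
     Phi t x.1 + Psi x.2) ltac:(by move=> a x y; rewrite /= !linearP scalerDr addrACA).
  exists Psi'; split.
  - move=> g x Gg; rewrite !Psi'E linearD -[X in _ = X + _]PhiE // -[X in _ = _ + X]PsiE //.
    by rewrite /= lfunE.
  - apply: raddf_inj => x x0'.
    have x0 : Phi t x.1 + Psi x.2 = 0 by rewrite -Psi'E; exact: x0'.
    have x1 : Phi t x.1 = 0.
      apply: (form_eq0 (h := B)).
      have : B (Phi t x.1) (Phi t x.1 + Psi x.2) = 0 by rewrite x0 form0r.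
      by rewrite formDr Psi_orth // addr0.
    have x2 : Psi x.2 = 0 by rewrite x1 add0r in x0.
    rewrite [x]surjective_pairing; congr pair.
      by apply: Phi_inj; rewrite x1 linear0.
    by apply: Psi_inj; rewrite x2 linear0.
  - move=> t'; case: (eqVneq t' t) => [->|t't] x; rewrite inE.
      by move=> _ _; exists (x, 0); rewrite Psi'E linear0 addr0.
    rewrite (negPf t't) => /= t'r Pt'.
    have [y yE] := Psi_img _ x t'r Pt'; exists (0, y).
    by rewrite Psi'E /= linear0 add0r.
  - move=> t' x y; rewrite inE negb_or => /andP [t't t'r] Pt'.
    by rewrite Psi'E formDr Phi_orth // Psi_orth // addr0.
have Psi_surj x : exists y, Psi y = x.
  have [_ /memv_imgP [y _ ->] yorth] := orth_decomp B (limg Psi) x.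
  exists y; apply/esym/eqP; rewrite -subr_eq0; apply/negPn/negP => z0.
  pose S z := forall t x, Pt t -> B z (Phi t x) = 0.
  have Sz : S (x - Psi y).
    move=> t x' Ptt; apply: form_sym0.
    by have [y' ->] := Psi_img t x' (mem_index_enum t) Ptt; apply: yorth; rewrite memv_img ?memvf.
  have SE r z : long r -> S z -> S (op (Ep r) z).
    move=> lr Sz' t x' Ptt; rewrite (adjE brk adjB).
    have [_ _ _ /(_ r x' lr) [_ [y' [_ ->]]] _] := PhiP _ Ptt.
    by rewrite Sz' // mulr0.
  (* The order of the kernels matters: [E32] commutes with the other two, and [E01] preserves the
     common kernel of [E32] and [E31] because its bracket with [E31] is [E32]. *)
  have [z1 [Sz1 z10] E32z1] := nilpotent_kernel (S := S) (g := Ep R32) (u := x - Psi y) G2_nilp isT (fun z => SE R32 z isT) Sz z0.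
  pose S1 z := S z /\ op (Ep R32) z = 0.
  have [|z2 [[Sz2 E32z2] z20] E31z2] := nilpotent_kernel (S := S1) (g := Ep R31) (u := z1) G2_nilp isT _ (conj Sz1 E32z1) z10.
    move=> z [Sz' Ez]; split; first exact: SE.
    by rewrite (comm0 brk) ?Ez ?linear0.
  pose S2 z := [/\ S z, op (Ep R32) z = 0 & op (Ep R31) z = 0].
  have [|||z3 [[Sz3 E32z3 E31z3] z30] E01z3] := nilpotent_kernel (S := S2) (g := Ep R01) (u := z2) G2_nilp isT.
  - move=> z [Sz' Ez E'z]; split; first exact: SE.
      by rewrite (comm0 brk) ?Ez ?linear0.
    by have := E32E brk z; rewrite Ez E'z linear0 sub0r => /esym/eqP; rewrite oppr_eq0 => /eqP.
  - by split.
  - by [].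
  case/eqP: z30; apply: wspan => [r lr|t Ptt]; first by case: r lr.
  by have [_ _ [x' <-] _ _] := PhiP _ Ptt; apply: Sz3.
have kerPsi : lker Psi == 0%VS by apply/lker0P.
have Psi_full : limg Psi = fullv.
  by apply/vspaceP => x; rewrite memvf; have [y <-] := Psi_surj x; rewrite memv_img ?memvf.
exists (Psi^-1)%VF.
  exists Psi => x; last exact: lker0_lfunK.
  by rewrite limg_lfunVK // Psi_full memvf.
move=> g x Gg; have [y <-] := Psi_surj x.
have -> : act (res_G2_A2 V) g (Psi y) = Psi (act _ g y) by rewrite PsiE.
by rewrite !lker0_lfunK.
Qed.

End Branching.

(** * Highest weight vectors in the polynomial model *)

Section ModelVectors.
Variable C : numClosedFieldType.
Local Notation P := {mpoly C[7 + 7]}.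
Local Notation op := (pd_gen C).

Lemma pd_genM g (x y : P) : op g (x * y) = op g x * y + x * op g y.
Proof. exact: pdM. Qed.

Lemma pd_genD g (x y : P) : op g (x + y) = op g x + op g y.
Proof. exact: linearD. Qed.

Lemma pd_gen_mul0 g (x y : P) : op g x = 0 -> op g y = 0 -> op g (x * y) = 0.
Proof. by move=> x0 y0; rewrite pd_genM x0 y0 mul0r mulr0 addr0. Qed.

Lemma pd_gen_exp0 g (x : P) n : op g x = 0 -> op g (x ^+ n) = 0.
Proof. by move=> x0; rewrite /pd_gen /= pd_exp [pd _ x]x0 mulr0 mul0rn. Qed.

Lemma pd_gen_weight g (x : P) c n : op g x = c *: x -> op g (x ^+ n) = (c * n%:R) *: x ^+ n.
Proof.
move=> gx; rewrite /pd_gen /= pd_exp [pd _ x]gx -scalerAr -scaler_nat scalerA mulrC.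
by case: n => [|n]; rewrite ?mulr0 ?scale0r // -exprSr.
Qed.

(** [op g] is a derivation killing [a] and [z], so each application turns one remaining factor [y]
    into [c *: z]; the factorial counts the orders. *)
Lemma pd_gen_iter g (a y z : P) c n : op g a = 0 -> op g y = c *: z -> op g z = 0 ->
  iter n (op g) (a * y ^+ n) = (c ^+ n * n`!%:R) *: (a * z ^+ n).
Proof.
move=> a0 gy gz; elim: n a a0 => [|n IH] a a0; first by rewrite !expr0 mul1r scale1r.
rewrite iterSr pd_genM a0 mul0r add0r.
have -> : a * op g (y ^+ n.+1) = (c *+ n.+1) *: ((a * z) * y ^+ n).
  rewrite /pd_gen /= pd_exp [pd _ y]gy -scalerAr -scaler_nat scalerA mulr_natl.
  by rewrite -scalerAr; congr (_ *: _); rewrite mulrA mulrAC.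
have itZ k (b : C) x : iter k (op g) (b *: x) = b *: iter k (op g) x.
  by elim: k => //= k ->; rewrite linearZ.
rewrite itZ IH ?pd_gen_mul0 // scalerA exprS factS natrM -mulr_natl.
by rewrite -mulrA -exprS; congr (_ *: _); ring.
Qed.

Definition uv (c : bool) (i : nat) : P := 'X_(copy c (inord i)).

Lemma pd_uv g c j i (z : int) : (i < 7)%N -> (j < 7)%N ->
  all (fun k => zcoef (gen_z g) k j == (k == i)%:R * z) (iota 0 7) ->
  op g (uv c j) = z%:~R *: uv c i.
Proof.
move=> i7 j7 /allP H; apply: pd_gen_var; rewrite !inordK //.
by apply/allP => k /H.
Qed.

Lemma pd_uv0 g c j : (j < 7)%N -> all (fun k => zcoef (gen_z g) k j == 0) (iota 0 7) ->
  op g (uv c j) = 0.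
Proof.
move=> j7 /allP H; rewrite (@pd_uv g c j 0 0) ?scale0r //.
by apply/allP => k /H; rewrite mulr0.
Qed.

Lemma pd_uvM g c j i (z : int) : (i < 7)%N -> (j < 7)%N ->
  all (fun k => zcoef (gen_z g) k j == (k == i)%:R * z) (iota 0 7) ->
  op g (uv c j) = z%:~R * uv c i.
Proof. by move=> i7 j7 H; rewrite (pd_uv _ i7 j7 H) scaler_int mulrzl. Qed.

Definition minor i j : P := uv true i * uv false j - uv true j * uv false i.

Lemma minorC i j : minor i j = - minor j i.
Proof. by rewrite /minor opprB. Qed.

Lemma minorii i : minor i i = 0.
Proof. exact: subrr. Qed.

Lemma pd_minor g i i' (z : int) j j' (z' : int) :
  (forall c, op g (uv c i) = z%:~R * uv c i') -> (forall c, op g (uv c j) = z'%:~R * uv c j') ->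
  op g (minor i j) = z%:~R * minor i' j + z'%:~R * minor i j'.
Proof.
move=> gi gj; rewrite /minor linearB /= !pd_genM !gi !gj.
move: (uv true i) (uv true j) (uv false i) (uv false j) (uv true i') (uv true j') => a b c d x y.
by move: (uv false i') (uv false j') => t w; ring.
Qed.

Definition theta : P := minor 0 1.
(** [th1] and [th2] are the highest weight vectors, of weights 2 a1 + a2 and a1 + a2, of the
    3-dimensional A2-summands of the adjoint module. The 7-dimensional summand of the exterior
    square has highest weight vector [minor 0 3 - 2 * minor 1 2]. The square norm of [minor 0 3] is
    twice that of [minor 1 2], so equal coefficients make [th1] orthogonal to it. *)
Definition th1 : P := minor 0 3 + minor 1 2.
Definition th2 : P := minor 0 4 + minor 1 3.

Ltac uv_image i z := move=> ?; apply: (@pd_uvM _ _ _ i z); vm_compute.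

Lemma pd_gen_theta :
  [/\ forall r, op (Ep r) theta = 0, op Hc1 theta = 0 *: theta & op Hc2 theta = 1 *: theta].
Proof.
split=> [r||].
- have E0 c : op (Ep r) (uv c 0) = 0%:~R * uv c 0 by move: c; case: r; uv_image 0%N (0 : int).
  have E1 c : op (Ep r) (uv c 1) = (if r is R10 then 1 else 0)%:~R * uv c 0.
    by move: c; clear E0; case: r; [uv_image 0%N (1 : int)|uv_image 0%N (0 : int)..].
  by rewrite (pd_minor E0 E1) minorii mulr0 mul0r addr0.
- have E0 c : op Hc1 (uv c 0) = 1%:~R * uv c 0 by move: c; uv_image 0%N (1 : int).
  have E1 c : op Hc1 (uv c 1) = (-1)%:~R * uv c 1 by move: c; uv_image 1%N (-1 : int).
  by rewrite (pd_minor E0 E1) -mulrDl -intrD mul0r scale0r.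
- have E0 c : op Hc2 (uv c 0) = 0%:~R * uv c 0 by move: c; uv_image 0%N (0 : int).
  have E1 c : op Hc2 (uv c 1) = 1%:~R * uv c 1 by move: c; uv_image 1%N (1 : int).
  by rewrite (pd_minor E0 E1) mul0r add0r mul1r scale1r.
Qed.

Lemma pd_gen_u0 :
  [/\ forall r, op (Ep r) (uv true 0) = 0, op Hc1 (uv true 0) = 1 *: uv true 0
   & op Hc2 (uv true 0) = 0 *: uv true 0].
Proof.
split=> [r||]; first by case: r; apply: pd_uv0; vm_compute.
- by apply: (@pd_uv _ _ 0 0 1); vm_compute.
- by rewrite scale0r; apply: pd_uv0; vm_compute.
Qed.

(** As vectors for A2, the factors [u], [y], [z] of [D] have weights lambda_1, lambda_2 and 0. *)
Lemma model_vector1 a1 a2 a3 : exists D : P, [/\ forall r, long r -> op (Ep r) D = 0 &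
  exists2 c : C, c != 0 & iter a2 (op (Ep R10)) (iter a3 (op (Ep R21)) D) =
    c *: uv true 0 ^+ (a1 + a2 + a3)].
Proof.
set u := uv true 0; set y := uv true 1; set z := uv true 3.
have [u0 _ _] := pd_gen_u0.
exists (u ^+ a1 * y ^+ a2 * z ^+ a3); split.
  move=> r lr; rewrite !pd_gen_mul0 ?pd_gen_exp0 ?u0 //.
    by clear u0; case: r lr => // _; apply: pd_uv0; vm_compute.
  by clear u0; case: r lr => // _; apply: pd_uv0; vm_compute.
have y21 : op (Ep R21) y = 0 by apply: pd_uv0; vm_compute.
have z21 : op (Ep R21) z = (-4)%:~R *: u by apply: pd_uv; vm_compute.
have y10 : op (Ep R10) y = 1%:~R *: u by apply: pd_uv; vm_compute.
(* [E21] must go first: it kills [u] and [y], whereas [E10] does not kill [z]. *)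
rewrite (pd_gen_iter _ _ z21) ?u0 ?pd_gen_mul0 ?pd_gen_exp0 ?u0 //.
have itZ k (b : C) x : iter k (op (Ep R10)) (b *: x) = b *: iter k (op (Ep R10)) x.
  by elim: k => //= k ->; rewrite linearZ.
rewrite itZ mulrAC (pd_gen_iter _ _ y10) ?pd_gen_mul0 ?pd_gen_exp0 ?u0 // scalerA.
eexists; last by rewrite -!exprD addnAC.
by rewrite !mulf_neq0 ?expf_neq0 ?intr_eq0 ?pnatr_eq0 -?lt0n ?fact_gt0.
Qed.

Lemma pd_gen_th :
  [/\ forall r, long r -> op (Ep r) th1 = 0 /\ op (Ep r) th2 = 0,
      op (Ep R21) th1 = 0 /\ op (Ep R11) th1 = (-3)%:~R * theta &
      op (Ep R21) th2 = 6%:~R * theta /\ op (Ep R11) th2 = 0].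
Proof.
split.
- move=> r lr; rewrite /th1 /th2 (pd_genD _ (minor 0 3)) (pd_genD _ (minor 0 4)).
  have E0 c : op (Ep r) (uv c 0) = 0%:~R * uv c 0.
    by move: c; case: r lr => // _; uv_image 0%N (0 : int).
  have E1 c : op (Ep r) (uv c 1) = 0%:~R * uv c 1.
    by move: c; clear E0; case: r lr => // _; uv_image 1%N (0 : int).
  have E2 c : op (Ep r) (uv c 2) = (if r is R01 then 1 else 0)%:~R * uv c 1.
    by move: c; clear E0 E1; case: r lr => // _; [uv_image 1%N (1 : int)|uv_image 1%N (0 : int)..].
  have E3 c : op (Ep r) (uv c 3) = 0%:~R * uv c 0.
    by move: c; clear E0 E1 E2; case: r lr => // _; uv_image 0%N (0 : int).
  have E4 c : op (Ep r) (uv c 4) = (if r is R31 then 6 else 0)%:~R * uv c 0.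
    by move: c; clear E0 E1 E2 E3; case: r lr => // _;
      [uv_image 0%N (0 : int)|uv_image 0%N (6 : int)|uv_image 0%N (0 : int)].
  rewrite (pd_minor E0 E3) (pd_minor E1 E2) (pd_minor E0 E4) (pd_minor E1 E3).
  by rewrite !minorii !mulr0 !mul0r !addr0.
- have E0 c : op (Ep R21) (uv c 0) = 0%:~R * uv c 0 by move: c; uv_image 0%N (0 : int).
  have E1 c : op (Ep R21) (uv c 1) = 0%:~R * uv c 1 by move: c; uv_image 1%N (0 : int).
  have E2 c : op (Ep R21) (uv c 2) = 0%:~R * uv c 2 by move: c; uv_image 2%N (0 : int).
  have E3 c : op (Ep R21) (uv c 3) = (-4)%:~R * uv c 0 by move: c; uv_image 0%N (-4 : int).
  have F0 c : op (Ep R11) (uv c 0) = 0%:~R * uv c 0 by move: c; uv_image 0%N (0 : int).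
  have F1 c : op (Ep R11) (uv c 1) = 0%:~R * uv c 1 by move: c; uv_image 1%N (0 : int).
  have F2 c : op (Ep R11) (uv c 2) = 1%:~R * uv c 0 by move: c; uv_image 0%N (1 : int).
  have F3 c : op (Ep R11) (uv c 3) = (-2)%:~R * uv c 1 by move: c; uv_image 1%N (-2 : int).
  rewrite /th1 !(pd_genD _ (minor 0 3)) (pd_minor E0 E3) (pd_minor E1 E2) (pd_minor F0 F3) (pd_minor F1 F2).
  rewrite minorii /theta (minorC 1 0) !mulr0 !mul0r !add0r; split=> //.
  by move: (minor 0 1) => x; ring.
- have E0 c : op (Ep R21) (uv c 0) = 0%:~R * uv c 0 by move: c; uv_image 0%N (0 : int).
  have E1 c : op (Ep R21) (uv c 1) = 0%:~R * uv c 1 by move: c; uv_image 1%N (0 : int).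
  have E3 c : op (Ep R21) (uv c 3) = (-4)%:~R * uv c 0 by move: c; uv_image 0%N (-4 : int).
  have E4 c : op (Ep R21) (uv c 4) = 2%:~R * uv c 1 by move: c; uv_image 1%N (2 : int).
  have F0 c : op (Ep R11) (uv c 0) = 0%:~R * uv c 0 by move: c; uv_image 0%N (0 : int).
  have F1 c : op (Ep R11) (uv c 1) = 0%:~R * uv c 1 by move: c; uv_image 1%N (0 : int).
  have F3 c : op (Ep R11) (uv c 3) = (-2)%:~R * uv c 1 by move: c; uv_image 1%N (-2 : int).
  have F4 c : op (Ep R11) (uv c 4) = 0%:~R * uv c 0 by move: c; uv_image 0%N (0 : int).
  rewrite /th2 !(pd_genD _ (minor 0 4)) (pd_minor E0 E4) (pd_minor E1 E3) (pd_minor F0 F4) (pd_minor F1 F3).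
  rewrite !minorii /theta (minorC 1 0) !mulr0 !mul0r !add0r; split=> //.
  by move: (minor 0 1) => x; ring.
Qed.

(** [th1], [th2] and [theta] have A2-weights lambda_1, lambda_2 and lambda_1 + lambda_2, whence the
    exponents [a1], [a2], [a3]. [E21] sends [th2] to a multiple of [theta] and kills [th1]; [E11]
    does the reverse. *)
Lemma model_vector2 a1 a2 a3 : exists D : P, [/\ forall r, long r -> op (Ep r) D = 0 &
  exists2 c : C, c != 0 & iter a1 (op (Ep R11)) (iter a2 (op (Ep R21)) D) =
    c *: theta ^+ (a1 + a2 + a3)].
Proof.
have [K0 _ _] := pd_gen_theta; have [K12 [S1 +] [+ T2]] := pd_gen_th.
rewrite !mulrzl -!scaler_int => T1 S2; exists (th1 ^+ a1 * theta ^+ a3 * th2 ^+ a2); split.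
  by move=> r lr; have [k1 k2] := K12 r lr; rewrite !pd_gen_mul0 ?pd_gen_exp0 ?K0.
rewrite (pd_gen_iter _ _ S2) ?pd_gen_mul0 ?pd_gen_exp0 ?K0 //.
have itZ k (b : C) x : iter k (op (Ep R11)) (b *: x) = b *: iter k (op (Ep R11)) x.
  by elim: k => //= k ->; rewrite linearZ.
rewrite itZ -mulrA [th1 ^+ _ * _]mulrC (pd_gen_iter _ _ T1) ?pd_gen_mul0 ?pd_gen_exp0 ?K0 // scalerA.
eexists; last by rewrite -!exprD addnC (addnC a3) addnA.
by rewrite !mulf_neq0 ?expf_neq0 ?intr_eq0 ?pnatr_eq0 -?lt0n ?fact_gt0.
Qed.

Lemma uv_neq0 c i : uv c i != 0.
Proof.
apply/eqP => /(congr1 (meval (fun=> 1))) /eqP.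
by rewrite mevalXU meval0 oner_eq0.
Qed.

Lemma theta_neq0 : theta != 0.
Proof.
pose pt l : C := ((l == copy true (inord 0)) || (l == copy false (inord 1)))%:R.
apply/eqP => /(congr1 (meval pt)) /eqP; rewrite meval0 mevalB !mevalM !mevalXU /pt.
have n01 : inord 0 == inord 1 :> 'I_7 = false by rewrite -val_eqE /= !inordK.
by rewrite !copy_inj !eqxx [inord 1 == _]eq_sym n01 /= mul0r subr0 mul1r oner_eq0.
Qed.

Lemma pd_gen_power (x : P) (c1 c2 : C) k : (forall r, op (Ep r) x = 0) ->
  op Hc1 x = c1 *: x -> op Hc2 x = c2 *: x ->
  [/\ forall r, op (Ep r) (x ^+ k) = 0, op Hc1 (x ^+ k) = (c1 * k%:R) *: x ^+ k &
      op Hc2 (x ^+ k) = (c2 * k%:R) *: x ^+ k].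
Proof.
by move=> x0 x1 x2; split=> [r||]; [apply: pd_gen_exp0|apply: pd_gen_weight..].
Qed.

End ModelVectors.

(** * The two families of G2-modules *)

Section ShortChevalley.
Variables (C : numClosedFieldType) (L : lmodType C) (op : gen -> {linear L -> L}).

Definition simple_e (i : bool) : {linear L -> L} := op (Ep (if i then R10 else R01)).
Definition simple_f (i : bool) : {linear L -> L} := op (Fn (if i then R10 else R01)).
Definition simple_h (i : bool) : {linear L -> L} := op (if i then Hc1 else Hc2).
Definition cartan_G2 (i j : bool) : C := (if i == j then 2 else if i then -3 else -1 : int)%:~R.

Lemma simple_chevalley : bracket_rep op -> chevalley cartan_G2 simple_e simple_f simple_h.
Proof.
move=> brk; split=> i j x.
  case: i j => -[]; rewrite /simple_e /simple_f /simple_h /=.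
  - by rewrite (brk (Ep R10) (Fn R10) Hc1 1) // scale1r.
  - by rewrite (comm0 brk) ?addr0.
  - by rewrite (comm0 brk) ?addr0.
  - by rewrite (brk (Ep R01) (Fn R01) Hc2 1) // scale1r.
have hF g r c : is_root (Fn r) ->
    zlie (gen_z (Fn r)) (gen_z g) = zlin c (gen_z (Fn r)) zzero ->
    op g (op (Fn r) x) = op (Fn r) (op g x) - c%:~R *: op (Fn r) x.
  by move=> rr E; rewrite (brk _ _ _ _ rr E) addrK.
by case: i j => -[]; rewrite /simple_f /simple_h /cartan_G2 /=; apply: hF.
Qed.

End ShortChevalley.

Section G2Embedding.
Variables (C : numClosedFieldType) (V : gmodule (@G2 C)) (d : 'M[C]_7 -> 'End(V)).
Hypothesis dV : differential d.
Local Notation op := (module_op d).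

Lemma G2_op_irreducible : irreducible V -> op_irreducible (simple_e op) (simple_f op).
Proof.
move=> irrV; apply: (@simple_irreducible C predT V d _ _ (fun=> 1) (fun=> 1)
  (fun i => if i then R10 else R01)) => //.
- by left.
- by case=> // _; [exists true|exists false].
- by move=> i x; rewrite scale1r.
- by move=> i x; rewrite scale1r.
Qed.

Lemma G2_hw_vector m1 m2 : is_V_G2 V m1 m2 -> exists v, [/\ v != 0,
  forall r, op (Ep r) v = 0, op Hc1 v = m1%:R *: v & op Hc2 v = m2%:R *: v].
Proof.
move=> [_ [v [v0 v1 v2 vU]]]; exists v; split=> // [r||].
- apply: (gen_fixed dV) => // t; apply: vU; apply: gen_elt.
  by exists r, t; split=> //; rewrite exp_nilp3 // (@gen_mx_cube _ (Ep r)).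
- exact: (weight_Hc1 dV v1).
- exact: (weight_Hc2 dV v2).
Qed.

Lemma G2_embedding (v : V) (m1 m2 : C) (x : {mpoly C[7 + 7]}) : irreducible V -> v != 0 -> x != 0 ->
  (forall r, op (Ep r) v = 0) -> op Hc1 v = m1 *: v -> op Hc2 v = m2 *: v ->
  (forall r, pd_gen C (Ep r) x = 0) -> pd_gen C Hc1 x = m1 *: x -> pd_gen C Hc2 x = m2 *: x ->
  exists phi : {linear V -> {mpoly C[7 + 7]}}, [/\ injective phi, phi v = x,
    forall r y, phi (op (Ep r) y) = pd_gen C (Ep r) (phi y) &
    forall r y, phi (op (Fn r) y) = pd_gen C (Fn r) (phi y)].
Proof.
move=> irrV v0 x0 vE v1 v2 xE x1 x2.
have brkV := G2_bracket dV.
have brkP : bracket_rep (pd_gen C) by move=> g g' z c _ E y; apply: pd_gen_bracket.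
have hwv : hw_vector (simple_e op) (simple_h op) (fun i => if i then m1 else m2) v.
  by split=> -[]; rewrite /simple_e /simple_h.
have hwx : hw_vector (simple_e (pd_gen C)) (simple_h (pd_gen C)) (fun i => if i then m1 else m2) x.
  by split=> -[]; rewrite /simple_e /simple_h.
have adjP i y z : fischer_form C (simple_f (pd_gen C) i y) z = fischer_form C y (simple_e (pd_gen C) i z).
  by apply: pd_gen_adj; case: i; [left|right].
have grading j : 3 * cartan_G2 C true j + 5 * cartan_G2 C false j = 1.
  by case: j; rewrite /cartan_G2 /=; ring.
(* 3 h1 + 5 h2 has eigenvalue 1 on both simple root vectors. *)
have [phi [phi_inj phiv phie phif]] := @hw_embedding _ _ _ _ _ _ _ _ _ _ _ _ _
  (fun i => if i then 3 else 5) (fischer_form C) (simple_chevalley brkV) hwv v0 x0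
  (G2_op_irreducible irrV) (simple_chevalley brkP) hwx adjP grading.
exists phi; split=> //.
- have E10 := phie true; have E01 := phie false; rewrite /simple_e /= in E10 E01.
  have E11 y : phi (op (Ep R11) y) = pd_gen C (Ep R11) (phi y).
    by rewrite (E11E brkV) (E11E brkP) linearB !E10 !E01 !E10.
  have E21 y : phi (op (Ep R21) y) = pd_gen C (Ep R21) (phi y).
    by rewrite (E21E brkV) (E21E brkP) linearB !E10 !E11 !E10.
  have E31 y : phi (op (Ep R31) y) = pd_gen C (Ep R31) (phi y).
    by rewrite (E31E brkV) (E31E brkP) linearB !E10 !E21 !E10.
  have E32 y : phi (op (Ep R32) y) = pd_gen C (Ep R32) (phi y).
    by rewrite (E32E brkV) (E32E brkP) linearB !E01 !E31 !E01.
  by case; [exact: E10|exact: E01|exact: E11|exact: E21|exact: E31|exact: E32].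
- have F10 := phif true; have F01 := phif false; rewrite /simple_f /= in F10 F01.
  have F11 y : phi (op (Fn R11) y) = pd_gen C (Fn R11) (phi y).
    by rewrite (F11E brkV) (F11E brkP) linearB !F10 !F01 !F10.
  have F21 y : phi (op (Fn R21) y) = pd_gen C (Fn R21) (phi y).
    by rewrite (F21E brkV) (F21E brkP) linearB !F10 !F11 !F10.
  have F31 y : phi (op (Fn R31) y) = pd_gen C (Fn R31) (phi y).
    by rewrite (F31E brkV) (F31E brkP) linearB !F10 !F21 !F10.
  have F32 y : phi (op (Fn R32) y) = pd_gen C (Fn R32) (phi y).
    by rewrite (F32E brkV) (F32E brkP) linearB !F01 !F31 !F01.
  by case; [exact: F10|exact: F01|exact: F11|exact: F21|exact: F31|exact: F32].
Qed.

End G2Embedding.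

Section Iteration.
Variables (C : numClosedFieldType) (L : lmodType C) (op : gen -> {linear L -> L}).
Hypothesis brk : bracket_rep op.

Lemma weight_lower r g (c m : int) n x : zlie (gen_z (Fn r)) (gen_z g) = zlin c (gen_z (Fn r)) zzero ->
  op g x = m%:~R *: x -> op g (iter n (op (Fn r)) x) = (m - c * n%:Z)%:~R *: iter n (op (Fn r)) x.
Proof.
move=> E gx; elim: n => [|n IH]; first by rewrite mulr0 subr0.
rewrite iterS; have /eqP := brk (g := Fn r) isT E (iter n (op (Fn r)) x).
rewrite -subr_eq IH linearZ /= -scalerBl -intrB => /eqP <-.
by congr (_%:~R *: _); rewrite -addn1 PoszD; ring.
Qed.

Lemma weight_raise r g (c m : int) n x : zlie (gen_z (Ep r)) (gen_z g) = zlin c (gen_z (Ep r)) zzero ->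
  op g x = m%:~R *: x -> op g (iter n (op (Ep r)) x) = (m - c * n%:Z)%:~R *: iter n (op (Ep r)) x.
Proof.
move=> E gx; elim: n => [|n IH]; first by rewrite mulr0 subr0.
rewrite iterS; have /eqP := brk (g := Ep r) isT E (iter n (op (Ep r)) x).
rewrite -subr_eq IH linearZ /= -scalerBl -intrB => /eqP <-.
by congr (_%:~R *: _); rewrite -addn1 PoszD; ring.
Qed.

End Iteration.

(** * Conjugation of f2 by exp f1 *)

Section Conjugation.
Variables (C : numClosedFieldType) (V : gmodule (@G2 C)) (d : 'M[C]_7 -> 'End(V)).
Hypothesis dV : differential d.
Local Notation op := (module_op d).

Definition exp_f1 : 'M[C]_7 := exp3 (gen_mx C (Fn R10)) 1.

(* The adjoint action exp(ad f1) f2 = f2 + [f1, f2] + [f1, [f1, f2]] / 2 + [f1, [f1, [f1, f2]]] / 6. *)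
Lemma exp_f1_conj x : act V exp_f1 (op (Fn R01) x) =
  op (Fn R01) (act V exp_f1 x) + op (Fn R11) (act V exp_f1 x)
  + 2^-1 *: op (Fn R21) (act V exp_f1 x) + 6^-1 *: op (Fn R31) (act V exp_f1 x).
Proof.
have Gexp t : G2 (exp3 (gen_mx C (Fn R10)) t) by apply: (@subsystem_exp C predT (Fn R10)).
have tg : tangent (@G2 C) (gen_mx C (Fn R01)) by apply: (@gen_tangent C predT (Fn R01)).
have E : exp_f1 *m gen_mx C (Fn R01) *m invmx exp_f1 =
    gen_mx C (Fn R01) + gen_mx C (Fn R11) + 2^-1 *: gen_mx C (Fn R21) + 6^-1 *: gen_mx C (Fn R31).
  rewrite (exp3_inv (@subsystem_det C predT) _ Gexp) ?gen_mx_cube // /exp_f1 /exp3.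
  rewrite !gen_mxE; set f := gen_z (Fn R10).
  pose zid : zmatrix := ztab (fun i j => (i == j)%:R).
  have zidE : 1%:M = zmx C zid by apply/matrixP => i j; rewrite !mxE zcoef_tab -val_eqE; case: eqP.
  (* Denominators are cleared to allow integer computation: [a c] is twice exp(c f1), and a further
     factor 3 makes all coefficients of the conjugate integral. *)
  pose a (c : int) := zlin 2 zid (zlin (2 * c) f (zmul f f)).
  have aE (c : int) : c ^+ 2 = 1 ->
      1%:M + c%:~R *: zmx C f + (c%:~R ^+ 2 / 2) *: (zmx C f *m zmx C f) = 2^-1 *: zmx C (a c).
    move=> c2; rewrite zidE zmx_mul -!zmx_lin -rmorphXn c2 !scalerDr !scalerA addrA.
    congr (_ + _ + _ *: _); rewrite ?rmorphM /= ?mulVf ?pnatr_eq0 ?scale1r ?mulrA ?mul1r //.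
    by rewrite mulVf ?pnatr_eq0 ?mul1r.
  have fin s1 s2 s3 s4 : (2^-1 * 2^-1) *: (3^-1 *: zmx C (zlin 12 s1 (zlin 12 s2 (zlin 6 s3 (zlin 2 s4 zzero))))) =
      zmx C s1 + zmx C s2 + 2^-1 *: zmx C s3 + 6^-1 *: zmx C s4.
    rewrite -!zmx_lin zmx0 addr0 !scalerDr !scalerA -!addrA -[zmx C s1 in RHS]scale1r.
    rewrite -[zmx C s2 in RHS]scale1r.
    by congr (_ *: _ + (_ *: _ + (_ *: _ + _ *: _))); field.
  have /= -> := aE 1 erefl; have := aE (-1) erefl; rewrite mulrNz mulr1z => ->.
  rewrite -!scalemxAl -scalemxAr scalerA !zmx_mul.
  set m := zmul _ _.
  have -> : zmx C m = 3^-1 *: zmx C (zlin 3 m zzero).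
    by rewrite -zmx_lin zmx0 addr0 scalerA mulVf ?scale1r ?pnatr_eq0.
  have -> : zlin 3 m zzero = zlin 12 (gen_z (Fn R01)) (zlin 12 (gen_z (Fn R11))
      (zlin 6 (gen_z (Fn R21)) (zlin 2 (gen_z (Fn R31)) zzero))) by vm_compute.
  exact: fin.
transitivity (d (exp_f1 *m gen_mx C (Fn R01) *m invmx exp_f1) (act V exp_f1 x)).
  exact: (differential_Ad (@subsystem_det C predT) (@gen_mul C 7 _) (@gen_inv C 7 _) dV x (Gexp 1) tg).
have lin X Y Z W (a b : C) y : d (X + Y + a *: Z + b *: W) y = d X y + d Y y + a *: d Z y + b *: d W y.
  by rewrite !(differentialD dV) !(differentialZ dV) !add_lfunE !scale_lfunE.
rewrite E; exact: lin.
Qed.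

Lemma exp_f1_fixed v : v != 0 -> op (Fn R10) v = 0 -> act V exp_f1 v = v.
Proof.
move=> v0 Fv; have [N NP] := @gen_act C predT V d dV (Fn R10) isT.
have [N0 ->] := NP v; case: N N0 {NP} => [/= v00|N _]; first by rewrite v00 eqxx in v0.
rewrite big_ord_recl /= expr0 divr1 scale1r big1 ?addr0 // => i _.
rewrite -iterS iterSr [X in iter i _ X]Fv.
suff -> : iter i (d (gen_mx C (Fn R10))) 0 = 0 by rewrite scaler0.
by elim: (nat_of_ord i) => //= j ->; rewrite linear0.
Qed.

End Conjugation.

Section Cases.
Variables (C : numClosedFieldType) (V : gmodule (@G2 C)) (d : 'M[C]_7 -> 'End(V)).
Hypothesis dV : differential d.
(* [op] is kept abstract to prevent unification from comparing root vectors as matrices. *)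
Variable op : gen -> {linear V -> V}.
Hypothesis opE : op = module_op d.
Variables (phi : {linear V -> {mpoly C[7 + 7]}}).
Hypothesis phiE : forall r y, phi (op (Ep r) y) = pd_gen C (Ep r) (phi y).
Hypothesis phiF : forall r y, phi (op (Fn r) y) = pd_gen C (Fn r) (phi y).
Variable B : hermitian V.
Hypothesis Bphi : forall x y, B x y = fischer_form C (phi x) (phi y).

Let brk : bracket_rep op.
Proof. by rewrite opE; apply: G2_bracket. Qed.

Let nilp g : is_root g -> exists N, forall x, iter N (op g) x = 0.
Proof. by rewrite opE; apply: G2_nilp. Qed.

Let brkP : bracket_rep (pd_gen C).
Proof. by move=> g g' z c _ E y; apply: pd_gen_bracket. Qed.

Let adjB : contravariant op B.
Proof. by move=> r hr x y; rewrite !Bphi phiE phiF; apply: pd_gen_adj. Qed.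

Let adjP : contravariant (pd_gen C) (fischer_form C).
Proof. by move=> r hr x y; apply: pd_gen_adj. Qed.

Let phi_iterF r n y : phi (iter n (op (Fn r)) y) = iter n (pd_gen C (Fn r)) (phi y).
Proof. by elim: n => //= n IH; rewrite phiF IH. Qed.

(* A vector of [V] is detected modulo the image of the negative long root vectors by
   pairing its image in the polynomial model with a long invariant [D]. *)
Let not_long_image r s m n v (D : {mpoly C[7 + 7]}) (c : C) : phi v != 0 ->
  (forall t, long t -> pd_gen C (Ep t) D = 0) -> c != 0 ->
  iter n (pd_gen C (Ep s)) (iter m (pd_gen C (Ep r)) D) = c *: phi v ->
  ~ long_image op (iter m (op (Fn r)) (iter n (op (Fn s)) v)).
Proof.
move=> v0 D0 c0 E [x1 [x2 [x3 /(congr1 phi)]]].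
rewrite !phi_iterF !linearD /= !phiF => /(congr1 (fun x => fischer_form C x D)).
rewrite !(adj_iter brkP adjP) E !formDl !(adj brkP adjP) !D0 // !form0r !mulr0 !addr0.
rewrite formZr => /eqP; rewrite !mulf_eq0 !expf_eq0 !(negPf (rsign_neq0 _ _)) !andbF /=.
rewrite conjC_eq0 (negPf c0) /= => /eqP E0.
by move: v0; rewrite (form_eq0 (h := fischer_form C) E0) eqxx.
Qed.

Let Hc12E x : op Hc12 x = op Hc1 x + op Hc2 x.
Proof. by rewrite opE /module_op /= (differentialD dV) add_lfunE. Qed.

Variable VH : nat -> nat -> gmodule (@A2 C).
Hypothesis hVH : forall m1 m2, is_V_A2 (VH m1 m2) m1 m2.

Let branching_vectors (T : finType) (Pt : pred T) (p q : T -> nat) (Q : T -> V) :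
  (forall t, Pt t -> [/\ ~ long_image op (Q t),
     op Hc12 (Q t) = (p t)%:R *: Q t & op Hc2 (Q t) = (q t)%:R *: Q t]) ->
  (forall t t', Pt t -> Pt t' -> p t = p t' -> q t = q t' -> t = t') ->
  (forall u, long_invariant op u -> (forall t, Pt t -> B u (Q t) = 0) -> u = 0) ->
  gmodule_iso (res_G2_A2 V) (\gsum_(t : T | Pt t) VH (p t) (q t)).
Proof.
move=> QP pq_inj Qspan.
have [w wP] := fin_all_exists (fun t : T => long_projection brk adjB (Q t)).
have adjB' : contravariant (module_op d) B by rewrite -opE.
apply: (branching dV adjB' (w := w)) => // [t Ptt|u uinv uw]; rewrite -?opE //.
  have [QI Q1 Q2] := QP t Ptt; have [winv wI wt] := wP t.
  split=> //; try exact: wt.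
  by apply/eqP => w0; apply: QI; rewrite w0 subr0 in wI.
rewrite -opE in uinv; apply: Qspan => // t Ptt; have [winv wI _] := wP t.
by rewrite -(subrK (w t) (Q t)) formDr uw // addr0 (long_invariant_orth brk adjB).
Qed.

(** * The modules of highest weight k omega_1 *)

Section Case1.
Variables (v : V) (k : nat).
Hypotheses (irrV : op_irreducible (simple_e op) (simple_f op)) (v0 : v != 0) (vE : forall r, op (Ep r) v = 0).
Hypotheses (v1 : op Hc1 v = k%:R *: v) (v2 : op Hc2 v = 0).
Hypothesis phiv : phi v = uv C true 0 ^+ k.

Let Q c a := iter c (op (Fn R21)) (iter a (op (Fn R10)) v).

Let F01v : op (Fn R01) v = 0.
Proof.
apply: (form_eq0 (h := B)); rewrite (adj brk adjB) mul1r.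
rewrite (brk (g := Ep R01) (g' := Fn R01) (z := Hc2) (c := 1)) //.
by rewrite vE linear0 v2 scaler0 addr0 form0r.
Qed.

Let Q12 c a : op Hc12 (Q c a) = (k%:Z - a%:Z - c%:Z)%:~R *: Q c a.
Proof.
rewrite /Q (weight_lower brk (c := 1) (m := k%:Z - a%:Z)); first by rewrite mul1r.
  by vm_compute.
rewrite (weight_lower brk (c := 1) (m := k)); first by rewrite mul1r.
  by vm_compute.
by rewrite Hc12E v1 v2 addr0.
Qed.

Let Q2 c a : op Hc2 (Q c a) = (a%:Z)%:~R *: Q c a.
Proof.
rewrite /Q (weight_lower brk (c := 0) (m := a)); first by rewrite mul0r subr0.
  by vm_compute.
rewrite (weight_lower brk (c := -1) (m := 0)); first by rewrite mulN1r sub0r opprK.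
  by vm_compute.
by rewrite v2 scale0r.
Qed.

(** The projection [w] of [Q c a] would be an A2-highest weight vector with negative weight
    [k - a - c] on the coroot of 3 a1 + a2. The square norm of [F31 w] is 36 times this weight times
    that of [w], so positivity forces [w = 0]. *)
Let Q_large u c a : long_invariant op u -> (k < a + c)%N -> B u (Q c a) = 0.
Proof.
move=> uinv kac; have [w [winv wI wt]] := long_projection brk adjB (Q c a).
suff w0 : w = 0.
  by rewrite -(subrK w (Q c a)) formDr w0 form0r addr0 (long_invariant_orth brk adjB) // -w0.
have w12 := wt Hc12 _ isT (Q12 c a).
apply: (form_eq0 (h := B)).
pose F := op (Fn R31) w.
have FF : B F F = 36 * (k%:Z - a%:Z - c%:Z)%:~R * B w w.
  rewrite /F (adj brk adjB) (brk (g := Ep R31) (g' := Fn R31) (z := Hc12) (c := -36)) //.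
  rewrite winv // linear0 add0r w12 scalerA formZr rmorphM /= !rmorph_int mulrA; congr (_ * _).
  by rewrite mulrNz mulrA mulN1r opprK.
have : B F F <= 0.
  rewrite FF; apply: mulr_le0_ge0; last exact: form_ge0.
  by rewrite mulr_ge0_le0 // lerz0; lia.
have FF0 := form_ge0 B F; move=> FF1.
have /eqP : B F F = 0 by apply/eqP; rewrite eq_le FF0 FF1.
rewrite FF !mulf_eq0 pnatr_eq0 intr_eq0 /= => /orP [|/eqP //].
by move=> /eqP; lia.
Qed.

(** Membership in the span of the vectors F10^n v, expressed by double orthogonality. *)
Let span10 y := forall u, (forall n, B u (iter n (op (Fn R10)) v) = 0) -> B u y = 0.

Let span10_F y : span10 y -> span10 (op (Fn R10) y).
Proof.
move=> sy u hu; apply: form_sym0; rewrite (adj brk adjB) mul1r; apply: form_sym0; apply: sy => n.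
by rewrite (adjE brk adjB) mul1r -iterS.
Qed.

(* As F01 maps into the orthogonal of the long invariants, this expresses F11 F10^n v
   there through vectors F21 F10^m v. *)
Let F01F10 n : exists c y z, [/\ c != 0, span10 y &
  op (Fn R01) (iter n.+1 (op (Fn R10)) v) =
    c%:~R *: op (Fn R11) (iter n (op (Fn R10)) v) + op (Fn R21) y + op (Fn R31) z].
Proof.
suff [y [z [sy E]]] : exists y z, span10 y /\ op (Fn R01) (iter n.+1 (op (Fn R10)) v) =
    (- n.+1%:Z)%:~R *: op (Fn R11) (iter n (op (Fn R10)) v) + op (Fn R21) y + op (Fn R31) z.
  by exists (- n.+1%:Z), y, z; rewrite oppr_eq0.
have c1 x : op (Fn R10) (op (Fn R01) x) = op (Fn R01) (op (Fn R10) x) + op (Fn R11) x.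
  by rewrite (F11E brk) addrC subrK.
have c2 x : op (Fn R10) (op (Fn R11) x) = op (Fn R11) (op (Fn R10) x) + op (Fn R21) x.
  by rewrite (F21E brk) addrC subrK.
have c3 x : op (Fn R10) (op (Fn R21) x) = op (Fn R21) (op (Fn R10) x) + op (Fn R31) x.
  by rewrite (F31E brk) addrC subrK.
have c4 x : op (Fn R10) (op (Fn R31) x) = op (Fn R31) (op (Fn R10) x).
  by rewrite (comm0 brk) //; vm_compute.
elim: n => [|n [y [z [sy IH]]]].
  exists 0, 0; split; first by move=> u _; rewrite form0r.
  rewrite !linear0 !addr0 /= mulrNz scaleN1r; apply/eqP; rewrite -addr_eq0 -c1 F01v linear0 //.
exists ((- n.+1%:Z)%:~R *: iter n (op (Fn R10)) v + op (Fn R10) y), (y + op (Fn R10) z); split.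
  move=> u hu; rewrite formDr formZr hu mulr0 add0r; exact: span10_F.
rewrite iterS; apply: (addIr (op (Fn R11) (iter n.+1 (op (Fn R10)) v))).
rewrite -c1 IH !linearD !linearZ /= c2 c3 c4 scalerDr.
have -> : (- n.+2%:Z)%:~R = (- n.+1%:Z)%:~R - 1 :> C by rewrite -[1]/(1%:~R) -intrB; congr (_%:~R); lia.
rewrite scalerBl scale1r.
have zmodE (x x' y1 y2 z1 z2 : V) : x + y1 + (y2 + z1) + z2 = x - x' + (y1 + y2) + (z1 + z2) + x'.
  by rewrite [RHS]addrAC (addrAC (x - x')) subrK !addrA.
exact: zmodE.
Qed.

Let Z u := long_invariant op u /\ forall c a, B u (Q c a) = 0.

Let Z_E21 u : Z u -> Z (op (Ep R21) u).
Proof.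
move=> [uinv uQ]; split; first by apply: (short_stable brk) => //; left.
by move=> c a; rewrite (adjE brk adjB) mul1r -(uQ c.+1 a).
Qed.

Let Z_iter21 n u : Z u -> Z (iter n (op (Ep R21)) u).
Proof. by elim: n => //= n IH Zu; apply/Z_E21/IH. Qed.

Let Z_F11 u n : Z u -> B u (op (Fn R11) (iter n (op (Fn R10)) v)) = 0.
Proof.
move=> Zu; have [uinv uQ] := Zu; have [c [y [z [c0 sy E]]]] := F01F10 n.
have /eqP : B u (op (Fn R01) (iter n.+1 (op (Fn R10)) v)) = 0.
  by apply: (long_invariant_orth brk adjB) => //; apply: long_imageF.
rewrite E !formDr [B u (op (Fn R31) z)](long_invariant_orth brk adjB) //; last exact: long_imageF.
have -> : B u (op (Fn R21) y) = 0.
  apply: form_sym0; rewrite (adj brk adjB) mul1r; apply: form_sym0; apply: sy => m.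
  exact: (Z_E21 Zu).2 0%N m.
by rewrite !addr0 formZr rmorph_int mulf_eq0 intr_eq0 (negPf c0) => /eqP.
Qed.

Lemma branching_case1 : gmodule_iso (res_G2_A2 V)
  (\gsum_(a : 'I_k.+1 * 'I_k.+1 | (a.1 + a.2 <= k)%N) VH a.1 a.2).
Proof.
(* [Q c a] has weight (k - a - c, a), so this choice gives (a1, a2). *)
apply: (branching_vectors (Q := fun a : 'I_k.+1 * 'I_k.+1 => Q (k - a.1 - a.2) a.2)).
- move=> [a1 a2] /= lek; split.
  + have [D [D0 [c c0 E]]] := model_vector1 C a1 a2 (k - a1 - a2).
    apply: (not_long_image _ D0 c0 (v := v)); first by rewrite phiv expf_neq0 ?uv_neq0.
    by rewrite E phiv; congr (_ *: _ ^+ _); lia.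
  + by rewrite Q12; congr (_ *: _); rewrite pmulrn; congr (_%:~R); lia.
  + by rewrite Q2.
- by move=> [a1 a2] [b1 b2] _ _ /= /val_inj -> /val_inj ->.
move=> u uinv uQ.
have {uQ} uQ c a : B u (Q c a) = 0.
  have [le|/(Q_large uinv)//] := leqP (a + c) k.
  have a1k : (k - a - c < k.+1)%N by lia.
  have a2k : (a < k.+1)%N by lia.
  have := uQ (Ordinal a1k, Ordinal a2k) ltac:(rewrite /=; lia).
  by rewrite /= (_ : k - (k - a - c) - a = c)%N //; lia.
have hwv : hw_vector (simple_e op) (simple_h op) (fun i => if i then k%:R else 0) v.
  by split=> -[]; rewrite /simple_e /simple_h ?vE // v2 scale0r.
suff: Z u -> u = 0 by apply; split.
apply: (detection (e := simple_e op) (f := simple_f op) brk adjB nilp (fun=> erefl)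
  (simple_chevalley brk) hwv v0 irrV (Z := Z)) => //.
- by move=> x [].
- move=> x Zx; have [xinv xQ] := Zx; split; first by apply: (short_stable brk) => //; right.
  (* Moving F21^c across and commuting [E11] past the [E21]'s leaves a vector of [Z] paired with F11
     F10^a v. *)
  move=> c a; rewrite /Q; apply: form_sym0; rewrite (adj_iter brk adjB).
  have -> : iter c (op (Ep R21)) (op (Ep R11) x) = op (Ep R11) (iter c (op (Ep R21)) x).
    elim: c => //= c ->; rewrite (E21_E11 brk) //; exact: (Z_iter21 c Zx).1.
  rewrite [B _ (op (Ep R11) _)]formC (adjE brk adjB) (Z_F11 _ (Z_iter21 c Zx)).
  by rewrite mulr0 rmorph0 mulr0.
- by move=> x n [_ xQ]; apply: (xQ 0%N n).
Qed.

End Case1.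

(** * The modules of highest weight k omega_2 *)

Section Case2.
Variables (v : V) (k : nat).
Hypotheses (irrV : op_irreducible (simple_e op) (simple_f op)) (v0 : v != 0).
Hypotheses (vE : forall r, op (Ep r) v = 0) (v1 : op Hc1 v = 0) (v2 : op Hc2 v = k%:R *: v).
Hypothesis phiv : phi v = theta C ^+ k.

Let Q x y := iter x (op (Fn R21)) (iter y (op (Fn R11)) v).

Let F10v : op (Fn R10) v = 0.
Proof.
apply: (form_eq0 (h := B)); rewrite (adj brk adjB) mul1r.
rewrite (brk (g := Ep R10) (g' := Fn R10) (z := Hc1) (c := 1)) //.
by rewrite vE linear0 v1 scaler0 addr0 form0r.
Qed.

Let Q12 x y : op Hc12 (Q x y) = (k%:Z - x%:Z)%:~R *: Q x y.
Proof.
rewrite /Q (weight_lower brk (c := 1) (m := k)); first by rewrite mul1r.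
  by vm_compute.
rewrite (weight_lower brk (c := 0) (m := k)); first by rewrite mul0r subr0.
  by vm_compute.
by rewrite Hc12E v1 v2 add0r.
Qed.

Let Q2 x y : op Hc2 (Q x y) = (k%:Z - y%:Z)%:~R *: Q x y.
Proof.
rewrite /Q (weight_lower brk (c := 0) (m := k%:Z - y%:Z)); first by rewrite mul0r subr0.
  by vm_compute.
rewrite (weight_lower brk (c := 1) (m := k)); first by rewrite mul1r.
  by vm_compute.
by rewrite v2.
Qed.

Let F01_step n : op (Ep R01) (iter n.+1 (op (Fn R01)) v) =
  (n.+1%:Z * (k%:Z - n%:Z))%:~R *: iter n (op (Fn R01)) v.
Proof.
have H2 m : op Hc2 (iter m (op (Fn R01)) v) = (k%:Z - 2 * m%:Z)%:~R *: iter m (op (Fn R01)) v.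
  by apply: (weight_lower brk); [vm_compute|].
elim: n => [|n IH]; rewrite iterS (brk (g := Ep R01) (g' := Fn R01) (z := Hc2) (c := 1)) // scale1r H2.
  by rewrite /= vE linear0 add0r; congr (_%:~R *: _); lia.
rewrite IH linearZ /= -iterS -scalerDl -intrD; congr (_%:~R *: _).
by rewrite -[n.+2]addn2 -[n.+1]addn1 !PoszD; ring.
Qed.

Let F01_large n : (k < n)%N -> iter n (op (Fn R01)) v = 0.
Proof.
move=> kn; rewrite -(subnK kn) iterD.
have -> : iter k.+1 (op (Fn R01)) v = 0.
  have := F01_step k; rewrite subrr mulr0 scale0r => E0.
  by apply: (form_eq0 (h := B)); rewrite {1}iterS (adj brk adjB) E0 form0r mulr0.
by elim: (_ - _)%N => //= m ->; rewrite linear0.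
Qed.

Let z x := op (Fn R01) x + op (Fn R11) x + 2^-1 *: op (Fn R21) x + 6^-1 *: op (Fn R31) x.

Let z_large n : (k < n)%N -> iter n z v = 0.
Proof.
have gv : act V (exp_f1 C) v = v by apply: (exp_f1_fixed dV v0); rewrite -opE.
have conj x : act V (exp_f1 C) (op (Fn R01) x) = z (act V (exp_f1 C) x).
  by rewrite /z opE; apply: exp_f1_conj.
move=> kn; have <- : act V (exp_f1 C) (iter n (op (Fn R01)) v) = iter n z v.
  by elim: (n) => [|m IH] //=; rewrite conj IH.
by rewrite F01_large // linear0.
Qed.

(* On long invariants [T] is adjoint to [z], the conjugate of the operator of f2. *)
Let T : {linear V -> V} := (2^-1 \*: op (Ep R21) : {linear V -> V}) \- op (Ep R11).

Let TE x : T x = 2^-1 *: op (Ep R21) x - op (Ep R11) x.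
Proof. by []. Qed.

Let T_inv u : long_invariant op u -> long_invariant op (T u).
Proof.
move=> uinv r lr; rewrite TE linearB linearZ /=.
by rewrite !(short_stable brk _ uinv) //; [rewrite scaler0 subr0|right|left].
Qed.

Let T_adj u y : long_invariant op u -> B (T u) y = B u (z y).
Proof.
move=> uinv; rewrite TE /z formDl formNl formZl !(adjE brk adjB) /= mul1r mulN1r opprK.
have F0 r x : long r -> B u (op (Fn r) x) = 0.
  by move=> lr; apply: (long_invariant_orth brk adjB) => //; apply: long_imageF.
rewrite !formDr !formZr (F0 R01) // (F0 R31) // mulr0 addr0 add0r addrC; congr (_ + _ * _).
by rewrite fmorphV rmorph_nat.
Qed.

Let T_iter_inv n u : long_invariant op u -> long_invariant op (iter n T u).
Proof. by move=> uinv; elim: n => // n IH; rewrite iterS; apply: T_inv. Qed.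

Let T_large n u : long_invariant op u -> (k < n)%N -> B (iter n T u) v = 0.
Proof.
move=> uinv kn; suff -> : forall y, B (iter n T u) y = B u (iter n z y) by rewrite z_large ?form0r.
elim: (n) => // m IH y; rewrite iterS T_adj ?IH -?iterSr //.
exact: T_iter_inv.
Qed.

Let Z u := long_invariant op u /\ forall x y, B u (Q x y) = 0.

Let E21_iter_inv n u : long_invariant op u -> long_invariant op (iter n (op (Ep R21)) u).
Proof. by move=> uinv; elim: n => // n IH; rewrite iterS; apply: (short_stable brk) => //; left. Qed.

Let E21_iter_E11 n u : long_invariant op u ->
  iter n (op (Ep R21)) (op (Ep R11) u) = op (Ep R11) (iter n (op (Ep R21)) u).
Proof.
move=> uinv; elim: n => // n IH; rewrite !iterS IH (E21_E11 brk) //; exact: E21_iter_inv.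
Qed.

Let pairing u x y : B (iter y (op (Ep R11)) (iter x (op (Ep R21)) u)) v = (-1) ^+ y * B u (Q x y).
Proof. by rewrite !(adjE_iter brk adjB) /= expr1n mul1r. Qed.

(** [E21] and [E11] commute on long invariants, so [Z] is stable under both. By [F10v], only [v]
    itself remains among the vectors F10^n v. *)
Let Z0 u : Z u -> u = 0.
Proof.
have hwv : hw_vector (simple_e op) (simple_h op) (fun i => if i then 0 else k%:R) v.
  by split=> -[]; rewrite /simple_e /simple_h ?vE // v1 scale0r.
apply: (detection (e := simple_e op) (f := simple_f op) brk adjB nilp (fun=> erefl)
  (simple_chevalley brk) hwv v0 irrV (Z := Z)) => //.
- by move=> x [].
- move=> x [xinv xQ]; split; first by apply: (short_stable brk) => //; left.
  by move=> n m; rewrite (adjE brk adjB) mul1r -(xQ n.+1 m).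
- move=> x [xinv xQ]; split; first by apply: (short_stable brk) => //; right.
  move=> n m; have := pairing (op (Ep R11) x) n m.
  rewrite E21_iter_E11 // -iterSr pairing xQ mulr0 => /esym/eqP.
  by rewrite mulf_eq0 expf_eq0 oppr_eq0 oner_eq0 andbF => /eqP.
- move=> x [|n] [xinv xQ]; first exact: (xQ 0%N 0%N).
  rewrite iterSr F10v.
  have -> : iter n (op (Fn R10)) 0 = 0 by elim: n => //= n ->; rewrite linear0.
  exact: form0r.
Qed.

(** Both weights of every [Q x y] are at most [k], so [u] is orthogonal to all of them and [Z0]
    applies. *)
Let weight0 g m u : g = Hc12 \/ g = Hc2 -> long_invariant op u -> op g u = m%:~R *: u ->
  (k%:Z < m)%R -> u = 0.
Proof.
move=> hg uinv gu km; apply: Z0; split=> // x y.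
case: hg gu => -> gu.
- apply: (weight_orth (Hc12_selfadj brk adjB) gu (Q12 x y)); lia.
- apply: (weight_orth (Hc2_selfadj brk adjB) gu (Q2 x y)); lia.
Qed.

(** A binomial expansion, as [E21] and [E11] commute on long invariants. [E21] raises the first
    weight and [E11] the second, so every term except the one with [x] factors [E21] passes [k] in
    one of them and vanishes by [weight0]. *)
Let T_binomial n x y u : (x + y)%N = n -> long_invariant op u ->
  op Hc12 u = (k%:Z - x%:Z)%:~R *: u -> op Hc2 u = (k%:Z - y%:Z)%:~R *: u ->
  B (iter n T u) v = 'C(n, x)%:R * 2^-1 ^+ x * (-1) ^+ y
    * B (iter y (op (Ep R11)) (iter x (op (Ep R21)) u)) v.
Proof.
elim: n x y u => [|n IH] x y u xy uinv u1 u2.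
  have [-> ->] : x = 0%N /\ y = 0%N by lia.
  by rewrite bin0 !expr0 !mul1r.
have iterT m (c : C) w w' : iter m T (c *: w - w') = c *: iter m T w - iter m T w'.
  by elim: m => // m IHm; rewrite !iterS IHm linearB linearZ.
rewrite iterSr TE iterT formDl formNl formZl.
have E1inv : long_invariant op (op (Ep R21) u) by apply: (short_stable brk) => //; left.
have E2inv : long_invariant op (op (Ep R11) u) by apply: (short_stable brk) => //; right.
have E1w1 : op Hc12 (op (Ep R21) u) = (k%:Z - x%:Z + 1)%:~R *: op (Ep R21) u.
  by have := weight_raise brk (r := R21) (g := Hc12) (c := -1) 1 ltac:(by vm_compute) u1; rewrite mulr1 opprK.
have E1w2 : op Hc2 (op (Ep R21) u) = (k%:Z - y%:Z)%:~R *: op (Ep R21) u.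
  by have := weight_raise brk (r := R21) (g := Hc2) (c := 0) 1 ltac:(by vm_compute) u2; rewrite mulr1 subr0.
have E2w1 : op Hc12 (op (Ep R11) u) = (k%:Z - x%:Z)%:~R *: op (Ep R11) u.
  by have := weight_raise brk (r := R11) (g := Hc12) (c := 0) 1 ltac:(by vm_compute) u1; rewrite mulr1 subr0.
have E2w2 : op Hc2 (op (Ep R11) u) = (k%:Z - y%:Z + 1)%:~R *: op (Ep R11) u.
  by have := weight_raise brk (r := R11) (g := Hc2) (c := -1) 1 ltac:(by vm_compute) u2; rewrite mulr1 opprK.
have iter0 m : iter m T 0 = 0 by elim: m => // m IHm; rewrite iterS IHm linear0.
case: x xy u1 E1w1 E2w1 => [|x] xy u1 E1w1 E2w1.
  have -> : op (Ep R21) u = 0 by apply: (weight0 (or_introl erefl) E1inv E1w1); lia.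
  rewrite iter0 form0l mulr0 add0r.
  case: y xy u2 E1w2 E2w2 => [|y] xy u2 E1w2 E2w2; first by lia.
  rewrite (IH 0%N y) //; [|by lia|by rewrite E2w2; congr (_%:~R *: _); lia].
  by rewrite !bin0 !iterSr exprS /=; ring.
rewrite (IH x y) //; [|by lia|by rewrite E1w1; congr (_%:~R *: _); lia].
case: y xy u2 E1w2 E2w2 => [|y] xy u2 E1w2 E2w2.
  have -> : op (Ep R11) u = 0 by apply: (weight0 (or_intror erefl) E2inv E2w2); lia.
  have xn : x = n by lia.
  by rewrite iter0 form0l oppr0 addr0 xn !binn iterSr exprS /=; ring.
rewrite (IH x.+1 y) //; [|by lia|by rewrite E2w2; congr (_%:~R *: _); lia].
rewrite E21_iter_E11 // -!iterSr binS natrD [in LHS]exprS [in RHS]exprS [_ ^+ x.+1]exprS [in RHS](exprS _ y).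
by ring.
Qed.

(** For the projection [w] of [Q x y], [T_binomial] writes [B (iter (x + y) T w) v], which is 0 by
    [T_large], as a nonzero multiple of [B w (Q x y) = B w w]. *)
Let Q_large u x y : long_invariant op u -> (k < x + y)%N -> B u (Q x y) = 0.
Proof.
move=> uinv kxy; have [w [winv wI wt]] := long_projection brk adjB (Q x y).
have w12 := wt Hc12 _ isT (Q12 x y); have w2 := wt Hc2 _ isT (Q2 x y).
have wQ : B w (Q x y) = 0.
  have /esym/eqP := T_binomial erefl winv w12 w2; rewrite T_large // pairing.
  rewrite !mulf_eq0 !expf_eq0 invr_eq0 !pnatr_eq0 oppr_eq0 oner_eq0 !andbF /= orbF.
  by rewrite -leqn0 leqNgt bin_gt0 leq_addr /= => /eqP.
have w0 : w = 0.
  apply: (form_eq0 (h := B)); have := wQ; rewrite -{1}(subrK w (Q x y)) formDr.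
  by rewrite (long_invariant_orth brk adjB winv wI) add0r.
rewrite w0 subr0 in wI; exact: (long_invariant_orth brk adjB).
Qed.

Lemma branching_case2 : gmodule_iso (res_G2_A2 V)
  (\gsum_(a : 'I_k.+1 * 'I_k.+1 * 'I_k.+1 | (a.1.1 + a.1.2 + a.2 == k)%N)
     VH (a.1.1 + a.2)%N (a.1.2 + a.2)%N).
Proof.
(* The weight of [Q a2 a1] is (k - a2, k - a1) = (a1 + a3, a2 + a3); with the sum fixed to [k] it
   determines the triple. *)
apply: (branching_vectors (p := fun a : 'I_k.+1 * 'I_k.+1 * 'I_k.+1 => (a.1.1 + a.2)%N)
  (q := fun a => (a.1.2 + a.2)%N) (Q := fun a => Q a.1.2 a.1.1)).
- move=> [[a1 a2] a3] /= /eqP ak; split.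
  + have [D [D0 [c c0 E]]] := model_vector2 C a1 a2 a3.
    apply: (not_long_image _ D0 c0 (v := v)); first by rewrite phiv expf_neq0 ?theta_neq0.
    by rewrite E phiv ak.
  + by rewrite Q12 pmulrn; congr (_%:~R *: _); lia.
  + by rewrite Q2 pmulrn; congr (_%:~R *: _); lia.
- move=> [[a1 a2] a3] [[b1 b2] b3] /= /eqP ak /eqP bk pE qE.
  by congr (_, _, _); apply: val_inj => /=; lia.
move=> u uinv uQ; apply: Z0; split=> // x y.
have [le|/(Q_large uinv)//] := leqP (x + y) k.
have xk : (x < k.+1)%N by lia.
have yk : (y < k.+1)%N by lia.
have zk : (k - x - y < k.+1)%N by lia.
by have := uQ (Ordinal yk, Ordinal xk, Ordinal zk) ltac:(rewrite /=; lia).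
Qed.

End Case2.
End Cases.

Theorem theorem8 (R : realType)
    (VH : nat -> nat -> gmodule (@A2 R[i]))
    (hVH : forall m1 m2 : nat, is_V_A2 (VH m1 m2) m1 m2)
    (k : nat) :
  (forall V : gmodule (@G2 R[i]), is_V_G2 V k 0 ->
     gmodule_iso (res_G2_A2 V)
       (\gsum_(a : 'I_k.+1 * 'I_k.+1 | (a.1 + a.2 <= k)%N) VH a.1 a.2))
  /\
  (forall V : gmodule (@G2 R[i]), is_V_G2 V 0 k ->
     gmodule_iso (res_G2_A2 V)
       (\gsum_(a : 'I_k.+1 * 'I_k.+1 * 'I_k.+1 | (a.1.1 + a.1.2 + a.2 == k)%N)
          VH (a.1.1 + a.2)%N (a.1.2 + a.2)%N)).
Proof.
split=> V hV; have [d dV] := differential_exists (@subsystem_det R[i] predT) V.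
  have [v [v0 vE v1 v2]] := G2_hw_vector dV hV; rewrite scale0r in v2.
  have [u0 u1 u2] := pd_gen_u0 R[i]; have [x0 x1 x2] := pd_gen_power k u0 u1 u2.
  rewrite mul1r in x1; rewrite mul0r in x2.
  have [|phi [phi_inj phiv phiE phiF]] := G2_embedding dV hV.1 v0 (expf_neq0 k (uv_neq0 _ true 0)) vE v1 _ x0 x1 x2.
    by rewrite v2 scale0r.
  exact: (branching_case1 dV erefl phiE phiF (B := hermitian_pullback (fischer_form _) phi_inj)
    (fun _ _ => erefl) hVH (G2_op_irreducible dV hV.1) v0 vE v1 v2 phiv).
have [v [v0 vE v1 v2]] := G2_hw_vector dV hV; rewrite scale0r in v1.
have [u0 u1 u2] := pd_gen_theta R[i]; have [x0 x1 x2] := pd_gen_power k u0 u1 u2.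
rewrite mul0r in x1; rewrite mul1r in x2.
have [|phi [phi_inj phiv phiE phiF]] := G2_embedding dV hV.1 v0 (expf_neq0 k (theta_neq0 _)) vE _ v2 x0 x1 x2.
  by rewrite v1 scale0r.
exact: (branching_case2 dV erefl phiE phiF (B := hermitian_pullback (fischer_form _) phi_inj)
  (fun _ _ => erefl) hVH (G2_op_irreducible dV hV.1) v0 vE v1 v2 phiv).
Qed.
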